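(* Let $h,k,\ell\in\mathbb{N}$ be fixed and let $\theta_k\in(0,1]$ be an exponent of distribution for $d_k(n)$. Then the asymptotic $$\frac{\sum_{n\leq x}d_k(n+h)d_{\ell}(n)}{x\log^{k+\ell-2}x}\sim\frac{C_{k,\ell}f_{k,\ell}(h)}{(k-1)!(\ell-1)!}\qquad(x\to\infty)$$ holds if and only if $$\sum_{n\leq x}d_k(n+h)\left(d_{\ell}(n)-B^{1-\ell}d_{\ell}(n,B)\right)=o\left( x\log^{k+\ell-2} x \right)\qquad(x\to\infty)$$ for some (and therefore every) $B$ with $0<B<\theta_k$.
   Context: $\mathbb{N}$ denotes the positive integers, and $(m,n)$ denotes the greatest common divisor. $d_k(n)$ is the number of ways of writing $n$ as an ordered product of $k$ positive integer factors (so $d_1(n)=1$, and $d_0(n)=1$ if $n=1$ and $0$ otherwise). For $B\in(0,1]$, $$d_\ell(n,B)=\sum_{\substack{q\mid n\\ q\leq n^B}}d_{\ell-1}(q).$$ The constants are $$C_{k,\ell}=\prod_p\left( \left(1-p^{-1}\right)^{\ell-1}+\left(1-p^{-1}\right)^{k-1}-\left(1-p^{-1}\right)^{k+\ell-2}\right)$$ (product over all primes) and, writing $h=\prod_p p^{\gamma}$ with $\gamma=\gamma(p)$ the exponent of $p$ in $h$, $$f_{k,\ell}(h)=\prod_{p\mid h} \frac{(1-p^{-1})\sum_{\alpha=0}^{\gamma}d_{\ell-1}(p^{\alpha})\sum_{\beta=\alpha}^{\infty}d_k(p^{\beta})p^{-\beta}+d_k(p^{\gamma})\sum_{\alpha=\gamma+1}^{\infty}d_{\ell-1}(p^{\alpha})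 p^{-\alpha}}{(1-p^{-1})^{1-k}+(1-p^{-1})^{1-\ell}-1}.$$ Exponent of distribution: for $g\in\mathbb{N}$, a real number $0<\theta_{g,k}\leq 1$ is an exponent of distribution for $d_k(n)$ (with respect to $g$) if for every fixed $\epsilon>0$ there is a fixed $\delta>0$ such that for every $q\leq x^{\theta_{g,k}-\epsilon}$ and each residue class $h\not\equiv 0\pmod q$ with $(h,q)=g$, $$\sum_{\substack{n\leq x\\ n\equiv h \pmod q}} d_k(n)= \frac{1}{\phi(q/g)}\,\mathrm{Res}\left(\frac{x^{s}}{s}\sum_{(n,q)=g}\frac{d_k(n)}{n^s},\ s=1\right)+O_{\epsilon,\delta,k}\left(\frac{x^{1-\delta}}{\phi(q/g)}\right),$$ where $\phi$ is Euler's function and the Dirichlet series is meromorphically continued to a neighbourhood of $s=1$. Convention: $\theta_k$ denotes a single number that is an exponent of distribution for $d_k(n)$ for all $g$ simultaneously, i.e. one may take $\theta_{g,k}=\theta_k$ for every $g$. *)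

(* Defs.v *)
From mathcomp Require Import all_boot all_order all_algebra.
From mathcomp Require Import complex.
From mathcomp Require Import all_classical all_reals all_analysis.

Set Implicit Arguments.
Unset Strict Implicit.
Unset Printing Implicit Defensive.

Import Order.TTheory GRing.Theory Num.Theory.
Import numFieldNormedType.Exports.

Local Open Scope classical_set_scope.
Local Open Scope ring_scope.
Local Open Scope complex_scope.

(* Ordered factorisations of [n] into [k] factors. For [0 < n] every factor
   lies in [1, n], so bounding the factors by [n] loses nothing; the value at
   [n = 0] is meaningless. *)
Definition divk (k n : nat) : nat :=
  #|[pred f : {ffun 'I_k -> 'I_n.+1} | (\prod_(i < k) f i)%N == n]|.

(* d_l(n, B), to be used with [0 < l]. *)
Definition divkB (R : realType) (l n : nat) (B : R) : nat :=
  (\sum_(q <- divisors n | (q%:R <= n%:R `^ B :> R)%R) divk l.-1 q)%N.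

(* An infinite product over the primes, as a limit of partial products. *)
Definition C_const (R : realType) (k l : nat) : R :=
  \big[*%R/1]_(0 <= p <oo | prime p)
    ((1 - p%:R^-1) ^+ l.-1 + (1 - p%:R^-1) ^+ k.-1
       - (1 - p%:R^-1) ^+ (k + l - 2) : R).

Definition f_factor (R : realType) (k l p gamma : nat) : R :=
  ((1 - p%:R^-1) *
     (\sum_(0 <= alpha < gamma.+1)
        (divk l.-1 (p ^ alpha))%:R *
        \big[+%R/0]_(alpha <= beta <oo) ((divk k (p ^ beta))%:R / p%:R ^+ beta : R))
   + (divk k (p ^ gamma))%:R *
     \big[+%R/0]_(gamma.+1 <= alpha <oo)
        ((divk l.-1 (p ^ alpha))%:R / p%:R ^+ alpha : R))
  / ((1 - p%:R^-1) ^- k.-1 + (1 - p%:R^-1) ^- l.-1 - 1).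

Definition f_const (R : realType) (k l h : nat) : R :=
  \prod_(p <- primes h) f_factor R k l p (logn p h).

(* The alias [R[i]^o] carries the topology of the complex plane. *)
Notation cplx R := (R[i]^o).

(* x^s = exp (s log x) for [0 < x]. *)
Definition cpow (R : realType) (x : R) (s : cplx R) : cplx R :=
  (x `^ complex.Re s * cos (complex.Im s * ln x)) +i*
  (x `^ complex.Re s * sin (complex.Im s * ln x)).

(* [derivable f z 1] is differentiability along complex increments. *)
Definition holomorphic_on (R : realType) (U : set (cplx R))
  (f : cplx R -> cplx R) : Prop :=
  forall z, U z -> derivable f z 1.

(* [F] is meromorphic near [z0] with residue [r] there: it is the sum of a
   finite principal part, in which [r] is the coefficient of (z - z0)^-1, and
   of a function holomorphic near [z0]. *)
Definition is_residue (R : realType) (F : cplx R -> cplx R) (z0 r : cplx R) :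
    Prop :=
  exists N (a : nat -> cplx R) (H : cplx R -> cplx R) (rho : R),
    [/\ 0 < rho,
        holomorphic_on [set z | `|z - z0| < rho%:C] H,
        forall z, 0 < `|z - z0| < rho%:C ->
          F z = \sum_(j < N.+1) a j / (z - z0) ^+ j.+1 + H z
      & r = a 0%N].

Definition dirichlet (R : realType) (k q g : nat) (s : cplx R) : cplx R :=
  \big[+%R/0]_(1 <= n <oo | gcdn n q == g)
     ((divk k n)%:R / cpow n%:R s : cplx R).

(* [D] stands for a meromorphic continuation of the Dirichlet series, which
   itself converges for Re s > 1 only. *)
Definition is_main_residue (R : realType) (k q g : nat) (x : R) (r : cplx R) :
    Prop :=
  exists2 D : cplx R -> cplx R,
    \forall s \near (1 : cplx R), 1 < complex.Re s -> D s = dirichlet k q g s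
  & is_residue (fun s => cpow x s / s * D s) 1 r.

(* The implied constant [K] depends on [g], [k], [eps] and [delta] only. *)
Definition distribution_exponent_at (R : realType) (k g : nat) (theta : R) :
    Prop :=
  0 < theta <= 1 /\
  forall eps : R, 0 < eps ->
  exists2 delta : R, 0 < delta &
  exists K : R, forall (x : R) (q h : nat),
    1 <= x -> (0 < q)%N -> q%:R <= x `^ (theta - eps) ->
    ~~ (q %| h)%N -> gcdn h q = g ->
    exists2 r : cplx R, is_main_residue k q g x r &
      `| (\sum_(1 <= n < (Num.truncn x).+1 | n == h %[mod q]) divk k n)%N%:R
         - r / (totient (q %/ g))%:R |
      <= (K * x `^ (1 - delta) / (totient (q %/ g))%:R)%:C.

Definition distribution_exponent (R : realType) (k : nat) (theta : R) : Prop :=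
  forall g : nat, (0 < g)%N -> distribution_exponent_at k g theta.

Definition corr_sum (R : realType) (k l h : nat) (x : R) : R :=
  \sum_(1 <= n < (Num.truncn x).+1) (divk k (n + h))%:R * (divk l n)%:R.

Definition corr_sum_err (R : realType) (k l h : nat) (B x : R) : R :=
  \sum_(1 <= n < (Num.truncn x).+1)
    (divk k (n + h))%:R * ((divk l n)%:R - B ^- l.-1 * (divkB l n B)%:R).

(* The Landau notations need the filter x -> +oo with its proof packed in. *)
Definition at_infty (R : realType) : filter_on R := FilterType (pinfty_nbhs R) _.

Definition correlation_asymptotic (R : realType) (k l h : nat) : Prop :=
  (fun x : R => corr_sum k l h x / (x * ln x ^+ (k + l - 2)))
    ~_ (at_infty R)
  (fun _ : R => C_const R k l * f_const R k l h
                  / ((k.-1)`!%:R * (l.-1)`!%:R)).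

Definition correlation_error_small (R : realType) (k l h : nat) (B : R) :
    Prop :=
  (fun x : R => corr_sum_err k l h B x)
    =o_ (at_infty R) (fun x : R => x * ln x ^+ (k + l - 2)).

(* Main.v *)
(* Write e = d_k and d = d_(l-1). Opening the divisor sum and restricting n to
   X / M < n <= X, the sum of d_k(n + h) d_l(n, B) becomes, up to a proportion
   1 / M, a sum over q <= X^B of d(q) times sums of e over m = h mod q.
   The residue in the definition of the exponent of distribution never has to
   be computed: it depends on the residue class only through its gcd g with q,
   so averaging over those classes replaces it by the sum of e(m) over m <= Y
   with gcd(m, q) = g. There remains an elementary double sum over (q, m) of
     d(q) e(m) [gcd(m, q) = gcd(h, q)] / phi(q / gcd(h, q)).
   Imposing this weight one prime at a time, each step is a finite linear
   combination of shifts (X / p^b, Q / p^a) and multiplies the asymptotic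
   constant by the Euler factor of C_(k,l) f_(k,l)(h), while the primes beyond
   P change the double sum by a proportion O(1 / P) only. Hence the sum of
   d_k(n + h) d_l(n, B) is asymptotic to B^(l-1) times the conjectured value of
   the sum of d_k(n + h) d_l(n), for every B < theta, and both claims follow
   since C_(k,l) f_(k,l)(h) > 0. *)

Require Import Defs.
From mathcomp Require Import all_boot all_order all_algebra.
From mathcomp Require Import complex.
From mathcomp Require Import all_classical all_reals all_analysis.
From mathcomp Require Import zify ring lra.

Set Implicit Arguments.
Unset Strict Implicit.
Unset Printing Implicit Defensive.

Import Order.TTheory GRing.Theory Num.Theory.
Import numFieldNormedType.Exports.

(** * Divisor functions *)

(** Two limits have to be exchanged. For fixed [P] the Euler factors below [P] come from an
    asymptotic that is not uniform in [P], so the larger primes need an estimate uniform in the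
    ranges. At [p > h] the local weight differs from [1] only when [p] divides [q]: by [1 / (p - 1)]
    if [p] does not divide [m], by [-1] if it does, and such pairs carry proportions [O(1 / p)] and
    [O(1 / p ^ 2)]. Both effects are [O(1 / (p (p - 1)))], which telescopes. A shift changes one
    range and not the other, so the asymptotics are double limits, and [Q] is tied to a power of [X]
    only at the end. Fixing the exponent of [p] is a finite difference because [d_k (p ^ b)] is the
    coefficient of [x ^ b] in [(1 - x) ^- k]. The hypothesis gives each class a residue through a
    continuation of its own; the residues are compared on the real ray [s > 1]. It omits the class
    [0] modulo [q], where the main term turns out to be exact, and its constants depend on
    [gcd (h, q)], which takes finitely many values. The gap between [B] and [theta] is the [eps] of
    the hypothesis. *)

Definition count_fact (k N n : nat) : nat :=
  #|[pred f : {ffun 'I_k -> 'I_N.+1} | (\prod_(i < k) f i)%N == n]|.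

Lemma count_fact0 N n : count_fact 0 N n = (n == 1)%N.
Proof.
rewrite /count_fact -sum1_card (eq_bigl (fun=> n == 1)%N); last first.
  by move=> f; rewrite inE big_ord0 eq_sym.
case: (n == 1)%N; last by rewrite big_pred0_eq.
by rewrite sum1_card card_ffun !card_ord expn0.
Qed.

Lemma count_factS k N n :
  count_fact k.+1 N n =
  (\sum_(a < N.+1)
     #|[pred f : {ffun 'I_k -> 'I_N.+1} | (a * \prod_(i < k) f i)%N == n]|)%N.
Proof.
pose join (u : 'I_N.+1 * {ffun 'I_k -> 'I_N.+1}) : {ffun 'I_k.+1 -> 'I_N.+1} :=
  [ffun i => if unlift ord0 i is Some i' then u.2 i' else u.1].
pose split (f : {ffun 'I_k.+1 -> 'I_N.+1}) :=
  (f ord0, [ffun i : 'I_k => f (lift ord0 i)]).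
rewrite /count_fact -sum1_card (reindex join) /=; last first.
  exists split => [[a f] _|f _]; rewrite /split /join /=.
    rewrite ffunE unlift_none; congr pair; apply/ffunP => i.
    by rewrite !ffunE liftK.
  apply/ffunP => i; rewrite !ffunE; case: unliftP => [i' ->|-> //].
  by rewrite ffunE.
rewrite (eq_bigl (fun u : 'I_N.+1 * {ffun 'I_k -> 'I_N.+1} =>
    (u.1 * \prod_(i < k) u.2 i)%N == n)); last first.
  move=> [a f]; rewrite !inE big_ord_recl /= ffunE unlift_none /=.
  by congr (_ * _ == _)%N; apply: eq_bigr => i _; rewrite ffunE liftK.
transitivity (\sum_(u : 'I_N.+1 * {ffun 'I_k -> 'I_N.+1})
   ((u.1 * \prod_(i < k) u.2 i)%N == n))%N.
  by rewrite big_mkcond; apply: eq_bigr => u _; case: eqP.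
rewrite -(pair_bigA _ (fun (a : 'I_N.+1) (f : {ffun 'I_k -> 'I_N.+1}) =>
   ((a * \prod_(i < k) f i)%N == n) : nat)) /=.
apply: eq_bigr => a _; rewrite -sum1_card [RHS]big_mkcond.
by apply: eq_bigr => f _; rewrite inE; case: eqP.
Qed.

Lemma divisors_index_iota n N : (0 < n <= N)%N ->
  perm_eq (divisors n) [seq a <- index_iota 0 N.+1 | (a %| n)%N].
Proof.
case/andP=> n_gt0 n_le; apply: uniq_perm; rewrite ?divisors_uniq //.
  by rewrite filter_uniq ?iota_uniq.
move=> a; rewrite -dvdn_divisors // mem_filter mem_index_iota ltnS.
by case: (boolP (a %| n)%N) => //= /(dvdn_leq n_gt0) /leq_trans ->.
Qed.

Lemma count_factS_div k N n : (0 < n <= N)%N ->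
  count_fact k.+1 N n = (\sum_(a <- divisors n) count_fact k N (n %/ a))%N.
Proof.
move=> n_bound; have /andP[n_gt0 n_le] := n_bound.
rewrite count_factS (perm_big _ (divisors_index_iota n_bound)) big_filter /=.
rewrite big_mkord [RHS]big_mkcond; apply: eq_bigr => a _.
case: ifPn => [a_dvd|ndvd].
  have a_gt0 := dvdn_gt0 n_gt0 a_dvd.
  rewrite /count_fact; apply: eq_card => f; rewrite !inE.
  by rewrite eqn_div // mulnC.
apply/eqP; rewrite eqn0Ngt; apply/negP.
case/card_gt0P => f; rewrite inE => /eqP E.
by case/negP: ndvd; rewrite -E dvdn_mulr.
Qed.

(** Peeling off a factor replaces [n] by [n %/ a] while the remaining factors keep the old bound.
    With the bound as a separate parameter the induction on [k] goes through. *)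
Lemma count_fact_bound k N N' n : (0 < n <= N)%N -> (0 < n <= N')%N ->
  count_fact k N n = count_fact k N' n.
Proof.
elim: k n => [|k IHk] n nN nN'; first by rewrite !count_fact0.
rewrite !count_factS_div //; apply: eq_big_seq => a; case/andP: (nN) => n0 nleN.
case/andP: nN' => _ nleN'.
rewrite -dvdn_divisors // => a_dvd; have q_gt0 : (0 < n %/ a)%N.
  by rewrite divn_gt0 ?(dvdn_gt0 n0) // dvdn_leq.
by apply: IHk; rewrite q_gt0 (leq_trans (leq_div _ _)).
Qed.

Lemma divk0 n : divk 0 n = (n == 1)%N.
Proof. exact: count_fact0. Qed.

Lemma divisors_divn n : (0 < n)%N ->
  perm_eq (divisors n) [seq (n %/ a)%N | a <- divisors n].
Proof.
move=> n_gt0; have inj : {in divisors n &, injective (fun a => n %/ a)%N}.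
  move=> a b; rewrite -!dvdn_divisors // => a_dvd b_dvd E.
  have := divnK a_dvd; rewrite E => Ea; have := divnK b_dvd; rewrite -{2}Ea.
  have : (0 < n %/ b)%N by rewrite divn_gt0 ?(dvdn_gt0 n_gt0) // dvdn_leq.
  by move=> q_gt0 /eqP; rewrite eqn_mul2l -leqn0 leqNgt q_gt0 /= => /eqP.
apply: uniq_perm; rewrite ?divisors_uniq ?map_inj_in_uniq ?divisors_uniq //.
move=> a; rewrite -dvdn_divisors //; apply/idP/mapP => [a_dvd|[b]].
  exists (n %/ a)%N; first by rewrite -dvdn_divisors // dvdn_div.
  by rewrite divnA // mulKn.
by rewrite -dvdn_divisors // => b_dvd ->; rewrite dvdn_div.
Qed.

Lemma divkS k n : (0 < n)%N ->
  divk k.+1 n = (\sum_(q <- divisors n) divk k q)%N.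
Proof.
move=> n_gt0; rewrite [LHS]count_factS_div ?n_gt0 ?leqnn //.
rewrite [RHS](perm_big _ (divisors_divn n_gt0)) big_map.
apply: eq_big_seq => a; rewrite -dvdn_divisors // => a_dvd.
have q_gt0 : (0 < n %/ a)%N by rewrite divn_gt0 ?(dvdn_gt0 n_gt0) // dvdn_leq.
by apply: count_fact_bound; rewrite q_gt0 ?leq_div ?leqnn.
Qed.

Lemma divkn1 k : divk k 1 = 1%N.
Proof. by elim: k => [|k IHk]; rewrite ?divk0 // divkS // big_seq1 IHk. Qed.

Lemma perm_divisors_pfree p b n : prime p -> ~~ (p %| n)%N ->
  perm_eq (divisors (p ^ b * n))
    [seq (p ^ i * q)%N | i <- index_iota 0 b.+1, q <- divisors n].
Proof.
move=> p_pr p_ndvd.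
have n_gt0 : (0 < n)%N by case: n p_ndvd; rewrite ?dvdn0.
have p_gt0 := prime_gt0 p_pr.
have pbn_gt0 : (0 < p ^ b * n)%N by rewrite muln_gt0 expn_gt0 p_gt0.
have q_log q : q \in divisors n -> logn p q = 0%N.
  rewrite -dvdn_divisors // => q_dvd; rewrite lognE p_pr.
  by case: ifPn => // /and3P[_ _ /dvdn_trans/(_ q_dvd)]; rewrite (negPf p_ndvd).
have q_gt0 q : q \in divisors n -> (0 < q)%N.
  by rewrite -dvdn_divisors // => /(dvdn_gt0 n_gt0).
apply: uniq_perm; first exact: divisors_uniq.
  apply: allpairs_uniq; rewrite ?iota_uniq ?divisors_uniq //.
  move=> x y /allpairsP[[i q] [_ Hq ->]] /allpairsP[[i' q'] [_ Hq' ->]].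
  rewrite /= in Hq Hq' * => E.
  have := congr1 (logn p) E.
  rewrite !lognM ?expn_gt0 ?p_gt0 ?q_gt0 // !pfactorK // !q_log // !addn0.
  move=> Ei; rewrite Ei in E *; move/eqP: E.
  by rewrite eqn_pmul2l ?expn_gt0 ?p_gt0 // => /eqP ->.
move=> a; rewrite -dvdn_divisors //; apply/idP/allpairsPdep.
  move=> a_dvd; have a_gt0 := dvdn_gt0 pbn_gt0 a_dvd.
  have [q cop Ea] := pfactor_coprime p_pr a_gt0.
  exists (logn p a), q; split; last by rewrite mulnC.
    rewrite mem_index_iota ltnS /=.
    have := dvdn_leq_log p pbn_gt0 a_dvd.
    by rewrite lognM ?expn_gt0 ?p_gt0 // pfactorK // (q_log n) ?addn0 //
      -dvdn_divisors.
  rewrite -dvdn_divisors //.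
  have := dvdn_trans _ a_dvd; rewrite {1}Ea => /(_ q (dvdn_mulr _ (dvdnn _))).
  by rewrite Gauss_dvdr // coprime_sym coprimeXl.
case=> i [q [+ +] ->]; rewrite mem_index_iota -dvdn_divisors // ltnS => /= ib
  qn.
by rewrite dvdn_mul // dvdn_exp2l.
Qed.

(** Multiplicativity in the form that splits off one prime: each divisor of [p ^ b * n] is uniquely
    [p ^ i * q] with [q] dividing [n], and the induction on [k] applies to every such pair. *)
Lemma divk_pfree k p b n : prime p -> ~~ (p %| n)%N ->
  divk k (p ^ b * n) = (divk k (p ^ b) * divk k n)%N.
Proof.
move=> p_pr p_ndvd.
have n_gt0 : (0 < n)%N by case: n p_ndvd; rewrite ?dvdn0.
have p_gt0 := prime_gt0 p_pr.
elim: k b n p_ndvd n_gt0 => [|k IHk] b n p_ndvd n_gt0.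
  by rewrite !divk0 muln_eq1; case: eqP; case: eqP.
have cop1 : ~~ (p %| 1)%N by rewrite dvdn1 neq_ltn prime_gt1 ?orbT.
rewrite !divkS ?muln_gt0 ?expn_gt0 ?p_gt0 //.
rewrite (perm_big _ (perm_divisors_pfree b p_pr p_ndvd)) big_allpairs_dep.
have := perm_divisors_pfree b p_pr cop1; rewrite muln1 => Pb.
rewrite (perm_big _ Pb) big_allpairs_dep big_distrl /=; apply: eq_bigr => i _.
rewrite big_seq1 muln1 big_distrr; apply: eq_big_seq => q /=.
rewrite -dvdn_divisors // => q_dvd; apply: IHk; last exact: dvdn_gt0 q_dvd.
by apply: contra p_ndvd => /dvdn_trans ->.
Qed.

(** Pascal's rule for the coefficients of [(1 - x) ^- k]: multiplying the series by [1 - x] lowers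
    the index by one. It takes the place of the binomial formula throughout. *)
Lemma divk_expS k p b : prime p ->
  divk k.+1 (p ^ b.+1) = (divk k.+1 (p ^ b) + divk k (p ^ b.+1))%N.
Proof.
move=> p_pr; have p_gt0 := prime_gt0 p_pr.
have cop1 : ~~ (p %| 1)%N by rewrite dvdn1 neq_ltn prime_gt1 ?orbT.
have E c : divk k.+1 (p ^ c) = (\sum_(0 <= i < c.+1) divk k (p ^ i))%N.
  have := perm_divisors_pfree c p_pr cop1; rewrite muln1 => Pc.
  rewrite divkS ?expn_gt0 ?p_gt0 // (perm_big _ Pc) big_allpairs_dep.
  by apply: eq_bigr => i _; rewrite big_seq1 muln1.
by rewrite !E big_nat_recr.
Qed.

Lemma divk_exp0 p b : prime p -> divk 0 (p ^ b) = (b == 0)%N.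
Proof.
by move=> /prime_gt1 p_gt1; rewrite divk0 -(expn0 p) eqn_exp2l.
Qed.

Lemma divk_exp_le k p b : prime p ->
  (divk k (p ^ b.+1) <= k * divk k (p ^ b))%N.
Proof.
move=> p_pr; elim: k => [|k IHk]; first by rewrite divk_exp0.
rewrite divk_expS // mulSn leq_add2l (leq_trans IHk) // leq_mul2l; apply/orP;
  right.
case: b {IHk} => [|b]; first by rewrite !divkn1.
by rewrite divk_expS // leq_addl.
Qed.

(** As [k] is [d_k (p)], this is a case of submultiplicativity. It will bound the proportion of the
    double sum in which [p] divides [q] or [m], uniformly in the ranges. *)
Lemma divk_prime_mul_le k p n : prime p -> (0 < n)%N ->
  (divk k (p * n) <= k * divk k n)%N.
Proof.
move=> p_pr n_gt0; have [q cop ->] := pfactor_coprime p_pr n_gt0.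
have p_ndvd : ~~ (p %| q)%N by rewrite -prime_coprime.
rewrite [(q * _)%N]mulnC mulnA -expnS !divk_pfree // mulnA leq_mul2r.
by rewrite divk_exp_le ?orbT.
Qed.

Local Open Scope classical_set_scope.
Local Open Scope ring_scope.

(** * Averages of divisor functions *)

Lemma big_nat_multiples (V : nmodType) (p n : nat) (f : nat -> V) : (0 < p)%N ->
  \sum_(1 <= m < n.+1 | (p %| m)%N) f (m %/ p)%N =
  \sum_(1 <= a < (n %/ p).+1) f a.
Proof.
move=> p_gt0; elim: n => [|n IHn]; first by rewrite div0n !big_geq.
rewrite big_mkcond big_nat_recr //= -big_mkcond IHn divnS //.
by case: (p %| n.+1)%N; rewrite ?addr0 // add1n [RHS]big_nat_recr.
Qed.

Lemma sum_divisors_big_nat (V : nmodType) (m n : nat) (f : nat -> V) :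
  (0 < m <= n)%N ->
  \sum_(q <- divisors m) f q = \sum_(1 <= q < n.+1 | (q %| m)%N) f q.
Proof.
move=> m_bound; have /andP[m_gt0 _] := m_bound.
rewrite (perm_big _ (divisors_index_iota m_bound)) big_filter.
rewrite big_mkcond big_nat_recl //= dvd0n; case: eqP m_gt0 => [-> //|_ _].
by rewrite add0r big_add1 [RHS]big_mkcond.
Qed.

Lemma sum_divisors_switch (V : nmodType) (n : nat) (f : nat -> nat -> V) :
  \sum_(1 <= m < n.+1) \sum_(q <- divisors m) f q (m %/ q)%N =
  \sum_(1 <= q < n.+1) \sum_(1 <= a < (n %/ q).+1) f q a.
Proof.
transitivity (\sum_(1 <= m < n.+1) \sum_(1 <= q < n.+1 | (q %| m)%N)
    f q (m %/ q)%N).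
  apply: eq_big_nat => m m_bound.
  exact: (@sum_divisors_big_nat _ m n (fun q => f q (m %/ q)%N)).
rewrite (exchange_big_dep_nat xpredT) //=.
apply: eq_big_nat => q /andP[q_gt0 _].
exact: (@big_nat_multiples _ q n (f q)).
Qed.

Lemma sum_divisors_divn (V : nmodType) (m : nat) (f : nat -> nat -> V) :
  (0 < m)%N ->
  \sum_(q <- divisors m) f q (m %/ q)%N = \sum_(q <- divisors m) f (m %/ q)%N q.
Proof.
move=> m_gt0; rewrite (perm_big _ (divisors_divn m_gt0)) big_map.
apply: eq_big_seq => q; rewrite -dvdn_divisors // => q_dvd.
by rewrite divnA // mulKn.
Qed.

Definition divk_sum (R : realType) (k n : nat) : R :=
  \sum_(1 <= m < n.+1) (divk k m)%:R.

Definition divk_hsum (R : realType) (k n : nat) : R :=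
  \sum_(1 <= m < n.+1) (divk k m)%:R / m%:R.

Lemma divk_sum0 (R : realType) n : divk_sum R 0 n = (0 < n)%:R.
Proof.
rewrite /divk_sum; elim: n => [|n IHn]; first by rewrite big_geq.
rewrite big_nat_recr //= IHn divk0 eqSS.
by case: n {IHn} => [|n]; rewrite ?addr0 ?add0r.
Qed.

Lemma divk_hsum0 (R : realType) n : divk_hsum R 0 n = (0 < n)%:R.
Proof.
rewrite -divk_sum0; apply: eq_big_nat => m _; rewrite divk0.
by case: eqP => [->|_]; rewrite ?divr1 ?mul0r.
Qed.

Lemma divk_sum_ge0 (R : realType) k n : 0 <= divk_sum R k n.
Proof. by apply: sumr_ge0 => m _; rewrite ler0n. Qed.

Lemma divk_hsum_ge0 (R : realType) k n : 0 <= divk_hsum R k n.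
Proof. by apply: sumr_ge0 => m _; rewrite divr_ge0. Qed.

Lemma divk_sumS (R : realType) k n :
  divk_sum R k.+1 n = \sum_(1 <= q < n.+1) (divk k q * (n %/ q))%:R.
Proof.
transitivity (\sum_(1 <= m < n.+1) \sum_(q <- divisors m) (divk k q)%:R : R).
  by apply: eq_big_nat => m /andP[m_gt0 _]; rewrite divkS // natr_sum.
rewrite (sum_divisors_switch n (fun q _ => (divk k q)%:R : R)).
by apply: eq_big_nat => q _; rewrite sumr_const_nat subn1 /= -[LHS]mulr_natr
  natrM.
Qed.

Lemma divk_hsumS (R : realType) k n :
  divk_hsum R k.+1 n = \sum_(1 <= a < n.+1) a%:R^-1 * divk_hsum R k (n %/ a).
Proof.
pose f q a : R := (divk k q)%:R / q%:R / a%:R.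
transitivity (\sum_(1 <= m < n.+1) \sum_(q <- divisors m) f (m %/ q)%N q).
  apply: eq_big_nat => m /andP[m_gt0 _].
  rewrite divkS // natr_sum mulr_suml -(sum_divisors_divn f m_gt0).
  apply: eq_big_seq => q; rewrite -dvdn_divisors // => q_dvd.
  by rewrite /f -mulrA -invfM -natrM mulnC divnK.
rewrite (sum_divisors_switch n (fun a q => f q a)).
apply: eq_big_nat => a _; rewrite mulr_sumr.
by apply: eq_big_nat => q _; rewrite /f mulrC.
Qed.

Lemma exprB_le (R : realType) (n : nat) (x y : R) : 0 <= y <= x ->
  x ^+ n.+1 - y ^+ n.+1 <= n.+1%:R * x ^+ n * (x - y).
Proof.
case/andP=> y_ge0 yx; have x_ge0 := le_trans y_ge0 yx.
rewrite subrXX mulrC ler_wpM2r ?subr_ge0 //= -[n.+1 in leRHS]card_ord mulr_natl.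
rewrite -sumr_const ler_sum // => i _.
rewrite -[in leRHS](@subnK i n) ?leq_ord // exprD ler_wpM2l ?exprn_ge0 //.
by rewrite lerXn2r ?nnegrE.
Qed.

Lemma exprB_ge (R : realType) (n : nat) (x y : R) : 0 <= y <= x ->
  n.+1%:R * y ^+ n * (x - y) <= x ^+ n.+1 - y ^+ n.+1.
Proof.
case/andP=> y_ge0 yx; have x_ge0 := le_trans y_ge0 yx.
rewrite subrXX [leRHS]mulrC ler_wpM2r ?subr_ge0 //= -[n.+1 in leLHS]card_ord.
rewrite mulr_natl -sumr_const ler_sum // => i _.
rewrite -[in leLHS](@subnK i n) ?leq_ord // exprD ler_wpM2r ?exprn_ge0 //.
by rewrite lerXn2r ?nnegrE.
Qed.

Lemma lnS_le (R : realType) n : (0 < n)%N ->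
  ln n.+1%:R - ln n%:R <= n%:R^-1 :> R.
Proof.
move=> n_gt0; rewrite -ln_div ?posrE ?ltr0n //.
have -> : n.+1%:R / n%:R = 1 + n%:R^-1 :> R.
  by rewrite -natr1 mulrDl divff ?mul1r // pnatr_eq0 -lt0n.
by apply: le_ln1Dx; rewrite (lt_le_trans (ltrN10 R)) ?invr_ge0.
Qed.

Lemma lnS_ge (R : realType) n : (0 < n)%N ->
  n.+1%:R^-1 <= ln n.+1%:R - ln n%:R :> R.
Proof.
move=> n_gt0; rewrite -lerN2 opprB -ln_div ?posrE ?ltr0n //.
have -> : n%:R / n.+1%:R = 1 + - n.+1%:R^-1 :> R.
  have -> : n%:R = n.+1%:R - 1 :> R by rewrite -natr1 addrK.
  by rewrite mulrBl divff ?mul1r // pnatr_eq0.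
by apply: le_ln1Dx; rewrite ltrN2 invf_lt1 ?ltr0n // ltr1n ltnS.
Qed.

Lemma ln_natr_ge0 (R : realType) n : 0 <= ln n%:R :> R.
Proof.
by case: n => [|n]; [rewrite ln0 | rewrite ln_ge0 // ler1n].
Qed.

Lemma ler_ln_nat (R : realType) m n : (m <= n)%N -> ln m%:R <= ln n%:R :> R.
Proof.
case: m => [|m] mn; first by rewrite ln0 // ln_natr_ge0.
by rewrite ler_ln ?posrE ?ltr0n ?ler_nat // (leq_trans _ mn).
Qed.

(** With [n + 1] inside the logarithm the induction closes without an error term, because
    [n %/ a + 1 >= (n + 1) / a]. The power of the logarithm is a telescoping sum over [a], whose
    differences the mean value inequality compares with [1 / a]. *)
Lemma divk_hsum_ge (R : realType) k n : (0 < n)%N ->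
  ln n.+1%:R ^+ k / k`!%:R <= divk_hsum R k n.
Proof.
elim: k n => [|k IHk] n n_gt0; first by rewrite divk_hsum0 n_gt0 expr0 divr1.
rewrite divk_hsumS factS natrM invfM mulrA ler_pdivrMr ?ltr0n ?fact_gt0 //.
rewrite ler_pdivrMr ?ltr0n //.
pose t a : R := ln n.+1%:R - ln a%:R.
have -> : ln n.+1%:R ^+ k.+1 =
    \sum_(1 <= a < n.+1) - (t a.+1 ^+ k.+1 - t a ^+ k.+1).
  rewrite sumrN telescope_sumr // opprB /t subrr ln1 subr0 [X in _ - X]expr0n.
  by rewrite subr0.
rewrite !mulr_suml big_nat_cond [leRHS]big_nat_cond; apply: ler_sum => a.
rewrite andbT => /andP[a_gt0 a_le]; rewrite opprB.
have ta : 0 <= t a.+1 <= t a.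
  by rewrite /t subr_ge0 ler_ln_nat //= lerB // ler_ln_nat.
have /andP[ta1 ta2] := ta; have ta0 := le_trans ta1 ta2.
apply: (le_trans (exprB_le _ ta)).
have q_gt0 : (0 < n %/ a)%N by rewrite divn_gt0.
have : t a ^+ k / k`!%:R <= divk_hsum R k (n %/ a).
  apply: le_trans (IHk _ q_gt0); rewrite ler_wpM2r ?invr_ge0 //.
  rewrite lerXn2r ?nnegrE ?ln_natr_ge0 // /t -ln_div ?posrE ?ltr0n //.
  rewrite ler_ln ?posrE ?divr_gt0 ?ltr0n // ler_pdivrMr ?ltr0n // -natrM
    ler_nat.
  by rewrite ltn_ceil.
rewrite ler_pdivrMr ?ltr0n ?fact_gt0 // => IH.
have -> : t a - t a.+1 = ln a.+1%:R - ln a%:R by rewrite /t; ring.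
have le_prod : t a ^+ k * (ln a.+1%:R - ln a%:R) <=
    divk_hsum R k (n %/ a) * k`!%:R * a%:R^-1.
  by rewrite ler_pM ?exprn_ge0 ?lnS_le // subr_ge0 ler_ln_nat.
rewrite -mulrA [leRHS](_ : _ = k.+1%:R *
    (divk_hsum R k (n %/ a) * k`!%:R * a%:R^-1)); last by ring.
by rewrite ler_wpM2l.
Qed.

(** The term [a = 1] is not dominated by a difference [ln a - ln (a - 1)]; the shift by [k] absorbs
    it. Passing to [k + 1] raises the base by one, and [(s + 1) ^ (k + 1) - s ^ (k + 1) >= (k + 1) s
    ^ k]. *)
Lemma divk_hsum_le (R : realType) k n : 
  divk_hsum R k n <= (ln n%:R + k%:R) ^+ k / k`!%:R.
Proof.
elim: k n => [|k IHk] n.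
  by rewrite divk_hsum0 expr0 divr1; case: n.
case: n => [|n].
  by rewrite /divk_hsum big_geq // divr_ge0 ?exprn_ge0 ?addr_ge0 ?ln_natr_ge0.
rewrite divk_hsumS factS natrM invfM mulrA ler_pdivlMr ?ltr0n ?fact_gt0 //.
rewrite ler_pdivlMr ?ltr0n // !mulr_suml.
pose s a : R := ln n.+1%:R - ln a%:R + k%:R.
have s_ge0 a : (a <= n.+1)%N -> 0 <= s a.
  by move=> a_le; rewrite addr_ge0 // subr_ge0 ler_ln_nat.
have term a : (0 < a <= n.+1)%N -> 
    a%:R^-1 * divk_hsum R k (n.+1 %/ a) * k`!%:R * k.+1%:R <=
    k.+1%:R * s a ^+ k * a%:R^-1.
  case/andP=> a_gt0 a_le; rewrite [leLHS]mulrC -[leRHS]mulrA ler_wpM2l //.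
  rewrite -mulrA mulrC ler_wpM2r ?invr_ge0 //.
  apply: le_trans (_ : (ln (n.+1 %/ a)%:R + k%:R) ^+ k <= _).
    by rewrite -ler_pdivlMr ?ltr0n ?fact_gt0.
  rewrite lerXn2r ?nnegrE ?s_ge0 ?addr_ge0 ?ln_natr_ge0 // lerD2r.
  rewrite lerBrDr -lnM ?posrE ?ltr0n // ?divn_gt0 //.
  by rewrite -natrM ler_ln_nat // leq_divM.
rewrite big_ltn //.
have s1 : s 1%N = ln n.+1%:R + k%:R by rewrite /s ln1 subr0.
apply: le_trans (_ : k.+1%:R * s 1%N ^+ k + s 1%N ^+ k.+1 <= _).
  apply: lerD; first by have := term 1%N isT; rewrite invr1 mulr1.
  apply: le_trans (_ : \sum_(1 <= a < n.+1) - (s a.+1 ^+ k.+1 - s a ^+ k.+1) <=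
    _).
    rewrite big_add1 /= big_nat_cond [leRHS]big_nat_cond; apply: ler_sum => a.
    rewrite andbT => /andP[a_gt0 a_le]; rewrite opprB.
    apply: le_trans (term a.+1 _) _; first by rewrite /= .
    have sa : 0 <= s a.+1 <= s a.
      by rewrite s_ge0 //= lerD2r lerB // ler_ln_nat.
    apply: le_trans (exprB_ge k sa).
    rewrite ler_wpM2l ?mulr_ge0 ?exprn_ge0 ?s_ge0 //.
    have -> : s a - s a.+1 = ln a.+1%:R - ln a%:R by rewrite /s; ring.
    exact: lnS_ge.
  rewrite sumrN telescope_sumr // opprB gerBl exprn_ge0 //.
  exact: s_ge0.
rewrite -natr1 addrA -s1 -lerBrDr.
have : 0 <= s 1%N <= s 1%N + 1 by rewrite s_ge0 //= lerDl.
move=> /(exprB_ge k); set A := s 1%N + 1; rewrite -/A.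
have -> : A - s 1%N = 1 by rewrite /A; ring.
by rewrite mulr1 -natr1.
Qed.

Lemma divk_sum_le (R : realType) k n :
  divk_sum R k.+1 n <= n%:R * divk_hsum R k n.
Proof.
rewrite divk_sumS mulr_sumr big_nat_cond [leRHS]big_nat_cond.
apply: ler_sum => q; rewrite andbT => /andP[q_gt0 _].
rewrite natrM mulrCA ler_wpM2l // ler_pdivlMr ?ltr0n // -natrM ler_nat.
exact: leq_divM.
Qed.

(** The floor in [n %/ q] costs at most one for each [q], weighted by [d_k (q)]; the resulting sum
    is a logarithm smaller than the main term. *)
Lemma divk_sum_ge (R : realType) k n :
  n%:R * divk_hsum R k n - divk_sum R k n <= divk_sum R k.+1 n.
Proof.
rewrite divk_sumS mulr_sumr /divk_sum -sumrB big_nat_cond [leRHS]big_nat_cond.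
apply: ler_sum => q; rewrite andbT => /andP[q_gt0 _].
rewrite mulrCA -[X in _ - X]mulr1 -mulrBr natrM ler_wpM2l // lerBlDr.
by rewrite ler_pdivrMr ?ltr0n // natr1 -natrM ler_nat ltnW // ltn_ceil.
Qed.

(** Asymptotic to [ln n], but at least [1] for every natural number, [0] included since [ln 0 = 0],
    so that it can be divided by without side conditions. *)
Definition succ_ln (R : realType) (n : nat) : R := 1 + ln n%:R.

Lemma succ_ln_ge1 (R : realType) n : 1 <= succ_ln R n.
Proof. by rewrite lerDl ln_natr_ge0. Qed.

Lemma succ_ln_gt0 (R : realType) n : 0 < succ_ln R n.
Proof. exact: lt_le_trans ltr01 (succ_ln_ge1 R n). Qed.

Lemma succ_ln_neq0 (R : realType) n : succ_ln R n != 0.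
Proof. by rewrite gt_eqF ?succ_ln_gt0. Qed.

Lemma ler_succ_ln (R : realType) m n : (m <= n)%N -> succ_ln R m <= succ_ln R n.
Proof. by move=> mn; rewrite lerD2l ler_ln_nat. Qed.

Lemma divk_hsum_le_succ_ln (R : realType) k n :
  divk_hsum R k n <= k.+1%:R ^+ k * succ_ln R n ^+ k.
Proof.
apply: le_trans (divk_hsum_le R k n) _.
apply: le_trans (_ : (ln n%:R + k%:R) ^+ k <= _).
  rewrite ler_pdivrMr ?ltr0n ?fact_gt0 // ler_peMr ?ler1n ?fact_gt0 //.
  by rewrite exprn_ge0 // addr_ge0 ?ln_natr_ge0.
have ln0n := ln_natr_ge0 R n.
rewrite -exprMn lerXn2r ?nnegrE ?addr_ge0 ?mulr_ge0 // /succ_ln ?addr_ge0 //.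
have := mulr_ge0 (ler0n R k) ln0n; have := ler0n R k.
by rewrite -natr1 mulrDl mulrDr mulr1 mul1r; lra.
Qed.

Lemma divk_sum_le_succ_ln (R : realType) k n :
  divk_sum R k.+1 n <= k.+1%:R ^+ k * (n%:R * succ_ln R n ^+ k).
Proof.
apply: le_trans (divk_sum_le R k n) _.
by rewrite mulrCA ler_wpM2l ?divk_hsum_le_succ_ln.
Qed.

Lemma cvg_ln_nat (R : realType) : ln n%:R @[n --> \oo] --> (+oo : set_system R).
Proof.
apply/cvgryPge => A; near=> n.
rewrite -[A]expRK ler_ln ?posrE ?expR_gt0 //.
  by near: n; exact: nbhs_infty_ger.
by rewrite ltr0n; near: n; exact: nbhs_infty_gt.
Unshelve. all: by end_near. Qed.

Lemma cvg_succ_ln_inv (R : realType) : (succ_ln R n)^-1 @[n --> \oo] --> (0 :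
  R).
Proof.
apply/gtr0_cvgV0; first by near=> n; exact: succ_ln_gt0.
apply/cvgryPge => A; near=> n; rewrite /succ_ln -lerBlDl.
by near: n; move/cvgryPge: (@cvg_ln_nat R); exact.
Unshelve. all: by end_near. Qed.

Lemma cvg_exprn (R : realType) (T : Type) (F : set_system T) {FF : Filter F}
    (f : T -> R) (a : R) n :
  f x @[x --> F] --> a -> f x ^+ n @[x --> F] --> a ^+ n.
Proof.
move=> fa; elim: n => [|n IHn]; first exact: cvg_cst.
have -> : (fun x => f x ^+ n.+1) = f \* (fun x => f x ^+ n).
  by apply/funext => x; rewrite /= exprS.
by rewrite exprS; exact: cvgM.
Qed.

Lemma cvg_ln_succ_ln (R : realType) (c : R) :
  (ln n%:R + c) / succ_ln R n @[n --> \oo] --> (1 : R).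
Proof.
have -> : (fun n => (ln n%:R + c) / succ_ln R n) =
    (fun n => 1 + (c - 1) * (succ_ln R n)^-1).
  by apply/funext => n; move: (succ_ln_neq0 R n); rewrite /succ_ln => Ln0;
    field.
rewrite -[X in _ --> X]addr0 -[X in _ --> _ + X](mulr0 (c - 1)).
by apply: cvgD; [exact: cvg_cst | apply: cvgMl_tmp; exact: cvg_succ_ln_inv].
Qed.

Lemma cvg_divk_hsum (R : realType) k :
  divk_hsum R k n / succ_ln R n ^+ k @[n --> \oo] --> (k`!%:R^-1 : R).
Proof.
apply: (squeeze_cvgr
   (f := fun n => ((ln n%:R + 0) / succ_ln R n) ^+ k / k`!%:R)
   (h := fun n => ((ln n%:R + k%:R) / succ_ln R n) ^+ k / k`!%:R)).
- near=> n.
  have n_gt0 : (0 < n)%N by near: n; exact: nbhs_infty_gt.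
  have Lk : 0 < succ_ln R n ^+ k by rewrite exprn_gt0 ?succ_ln_gt0.
  rewrite !exprMn !exprVn ![_ / _ ^+ _ / _]mulrAC !ler_pM2r ?invr_gt0 //.
  rewrite divk_hsum_le andbT addr0 (le_trans _ (divk_hsum_ge R k n_gt0)) //.
  by rewrite ler_pM2r ?invr_gt0 ?ltr0n ?fact_gt0 // lerXn2r ?nnegrE
    ?ln_natr_ge0 // ler_ln_nat.
- rewrite -[X in _ --> X]mul1r -[X in X * _](expr1n _ k).
  by apply: cvgMr_tmp; apply: cvg_exprn; exact: cvg_ln_succ_ln.
- rewrite -[X in _ --> X]mul1r -[X in X * _](expr1n _ k).
  by apply: cvgMr_tmp; apply: cvg_exprn; exact: cvg_ln_succ_ln.
Unshelve. all: by end_near. Qed.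

Lemma cvg_divk_sum_lower (R : realType) k :
  divk_sum R k n / (n%:R * succ_ln R n ^+ k) @[n --> \oo] --> (0 : R).
Proof.
apply: (squeeze_cvgr (f := fun=> 0)
   (h := fun n => (maxn 1 k)%:R ^+ k * (succ_ln R n)^-1)); last 2 first.
- exact: cvg_cst.
- rewrite -[X in _ --> X](mulr0 ((maxn 1 k)%:R ^+ k)).
  by apply: cvgMl_tmp; exact: cvg_succ_ln_inv.
near=> n; have n_gt0 : (0 < n)%N by near: n; exact: nbhs_infty_gt.
have nR : 0 < n%:R :> R by rewrite ltr0n.
have Ln := succ_ln_gt0 R n.
rewrite divr_ge0 ?mulr_ge0 ?exprn_ge0 ?divk_sum_ge0 ?(ltW Ln) //=.
rewrite ler_pdivrMr ?mulr_gt0 ?exprn_gt0 //.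
(* For [k = 0] the sum is the single term [m = 1], and the claim reads [1 + ln n <= n]. *)
case: k => [|k].
  rewrite divk_sum0 n_gt0 !expr0 mulr1 mul1r ler_pdivlMl // mulr1.
  have := @le_ln1Dx R (n%:R - 1); rewrite [1 + _]addrC subrK /succ_ln -lerBrDl.
  by apply; rewrite ltrBrDr addNr.
rewrite [leRHS](_ : _ = (maxn 1 k.+1)%:R ^+ k.+1 * (n%:R * succ_ln R n ^+ k));
  last first.
  by rewrite [succ_ln R n ^+ k.+1]exprS; field; exact: succ_ln_neq0.
apply: le_trans (divk_sum_le_succ_ln R k n) _; rewrite ler_pM2r ?mulr_gt0
  ?exprn_gt0 //.
rewrite (maxn_idPr _) // exprS ler_peMl ?exprn_ge0 // ler1n.
Unshelve. all: by end_near. Qed.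

Lemma cvg_divk_sum (R : realType) k :
  divk_sum R k.+1 n / (n%:R * succ_ln R n ^+ k) @[n --> \oo] --> (k`!%:R^-1 :
    R).
Proof.
apply: (squeeze_cvgr
   (f := fun n => divk_hsum R k n / succ_ln R n ^+ k - divk_sum R k n / (n%:R *
     succ_ln R n ^+ k))
   (h := fun n => divk_hsum R k n / succ_ln R n ^+ k)); last 2 first.
- rewrite -[X in _ --> X]subr0; apply: cvgB; first exact: cvg_divk_hsum.
  exact: cvg_divk_sum_lower.
- exact: cvg_divk_hsum.
near=> n; have n_gt0 : (0 < n)%N by near: n; exact: nbhs_infty_gt.
have nR : 0 < n%:R :> R by rewrite ltr0n.
have Lk : 0 < succ_ln R n ^+ k by rewrite exprn_gt0 ?succ_ln_gt0.
have -> : divk_hsum R k n / succ_ln R n ^+ k =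
    n%:R * divk_hsum R k n / (n%:R * succ_ln R n ^+ k).
  by rewrite -mulf_div divff ?mul1r ?gt_eqF.
by rewrite -mulrBl !ler_pM2r ?invr_gt0 ?mulr_gt0 // divk_sum_ge divk_sum_le.
Unshelve. all: by end_near. Qed.

(** * Double sums and their asymptotic constants *)

Definition dsum (R : realType) (W : nat -> nat -> R) (X Q : nat) : R :=
  \sum_(1 <= q < Q.+1) \sum_(1 <= m < X.+1) W q m.

Definition dmain (R : realType) (i j X Q : nat) : R :=
  X%:R * succ_ln R X ^+ i * succ_ln R Q ^+ j.

(** [X] and [Q] tend to infinity independently: a shift by a prime divides one range and leaves the
    other, and the pairs met later, with [Q] close to a power of [X], are paths along this
    filter. *)
Definition dlim (R : realType) (i j : nat) (W : nat -> nat -> R) (c : R) :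
    Prop :=
  dsum W z.1 z.2 / dmain R i j z.1 z.2 @[z --> filter_prod \oo \oo] --> c.

(** The shifts act on weights, so that a double sum over a range divided by [p] becomes a sum over
    the full ranges and can be combined linearly with others. *)
Definition shift_q (R : realType) (p : nat) (W : nat -> nat -> R) q m : R :=
  if (p %| q)%N then W (q %/ p)%N m else 0.

Definition shift_m (R : realType) (p : nat) (W : nat -> nat -> R) q m : R :=
  if (p %| m)%N then W q (m %/ p)%N else 0.

Lemma eq_dsum (R : realType) (W W' : nat -> nat -> R) X Q :
  (forall q m, (0 < q <= Q)%N -> (0 < m <= X)%N -> W q m = W' q m) ->
  dsum W X Q = dsum W' X Q.
Proof.
by move=> eqW; apply: eq_big_nat => q qB; apply: eq_big_nat => m mB; exact: eqW.
Qed.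

Lemma ler_dsum (R : realType) (W W' : nat -> nat -> R) X Q :
  (forall q m, (0 < q)%N -> (0 < m)%N -> W q m <= W' q m) ->
  dsum W X Q <= dsum W' X Q.
Proof.
move=> leW; rewrite /dsum big_nat_cond [leRHS]big_nat_cond.
apply: ler_sum => q; rewrite andbT => /andP[q_gt0 _].
rewrite big_nat_cond [leRHS]big_nat_cond.
by apply: ler_sum => m; rewrite andbT => /andP[m_gt0 _]; exact: leW.
Qed.

Lemma dsumD (R : realType) (W W' : nat -> nat -> R) X Q :
  dsum (fun q m => W q m + W' q m) X Q = dsum W X Q + dsum W' X Q.
Proof.
by rewrite /dsum -big_split; apply: eq_bigr => q _; rewrite -big_split.
Qed.

Lemma dsumZ (R : realType) (a : R) (W : nat -> nat -> R) X Q :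
  dsum (fun q m => a * W q m) X Q = a * dsum W X Q.
Proof.
by rewrite /dsum mulr_sumr; apply: eq_bigr => q _; rewrite mulr_sumr.
Qed.

Lemma ler_norm_dsum (R : realType) (W : nat -> nat -> R) X Q :
  `|dsum W X Q| <= dsum (fun q m => `|W q m|) X Q.
Proof.
apply: le_trans (ler_norm_sum _ _ _) _; apply: ler_sum => q _.
exact: ler_norm_sum.
Qed.

Lemma dsum_ge0 (R : realType) (W : nat -> nat -> R) X Q :
  (forall q m, 0 <= W q m) -> 0 <= dsum W X Q.
Proof. by move=> W0; apply: sumr_ge0 => q _; apply: sumr_ge0. Qed.

Lemma ler_dsum_wid (R : realType) (W : nat -> nat -> R) X Q X' Q' :
  (forall q m, 0 <= W q m) -> (X <= X')%N -> (Q <= Q')%N ->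
  dsum W X Q <= dsum W X' Q'.
Proof.
move=> W0 XX' QQ'; rewrite /dsum [leRHS](big_cat_nat (n := Q.+1)) //=.
rewrite -[leLHS]addr0 lerD ?sumr_ge0 // => [|q _]; last by rewrite sumr_ge0.
apply: ler_sum => q _; rewrite [leRHS](big_cat_nat (n := X.+1)) //=.
by rewrite lerDl sumr_ge0.
Qed.

Lemma dsum_shift_q (R : realType) p (W : nat -> nat -> R) X Q : (0 < p)%N ->
  dsum (shift_q p W) X Q = dsum W X (Q %/ p).
Proof.
move=> p_gt0; rewrite /dsum -(@big_nat_multiples _ p Q) // [RHS]big_mkcond.
apply: eq_bigr => q _; rewrite /shift_q; case: ifP => // _.
by rewrite big1.
Qed.

Lemma dsum_shift_m (R : realType) p (W : nat -> nat -> R) X Q : (0 < p)%N ->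
  dsum (shift_m p W) X Q = dsum W (X %/ p) Q.
Proof.
move=> p_gt0; apply: eq_bigr => q _.
by rewrite -(@big_nat_multiples _ p X) // [RHS]big_mkcond.
Qed.

Lemma dmain_gt0 (R : realType) i j X Q : (0 < X)%N -> 0 < dmain R i j X Q.
Proof. by move=> X_gt0; rewrite !mulr_gt0 ?ltr0n ?exprn_gt0 ?succ_ln_gt0. Qed.

Lemma dmain_ge0 (R : realType) i j X Q : 0 <= dmain R i j X Q.
Proof. by rewrite !mulr_ge0 ?exprn_ge0 // ltW ?succ_ln_gt0. Qed.

Lemma ler_dmain (R : realType) i j X Q X' Q' : (X <= X')%N -> (Q <= Q')%N ->
  dmain R i j X Q <= dmain R i j X' Q'.
Proof.
move=> XX' QQ'; have L0 n := ltW (succ_ln_gt0 R n).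
by rewrite !ler_pM ?mulr_ge0 ?exprn_ge0 ?ler_nat ?lerXn2r ?nnegrE ?ler_succ_ln.
Qed.

Lemma cvg_natr_inv (R : realType) : n%:R^-1 @[n --> \oo] --> (0 : R).
Proof.
apply/gtr0_cvgV0; last exact: cvgr_idn.
by near=> n; rewrite ltr0n; near: n; exact: nbhs_infty_gt.
Unshelve. all: by end_near. Qed.

Lemma cvg_divn_nat (p : nat) : (0 < p)%N -> (n %/ p)%N @[n --> \oo] --> \oo.
Proof.
move=> p_gt0; apply/cvgnyPge => A; near=> n.
by rewrite leq_divRL //; near: n; exact: nbhs_infty_ge.
Unshelve. all: by end_near. Qed.

Lemma cvg_divn_ratio (R : realType) p : (0 < p)%N ->
  (n %/ p)%:R / n%:R @[n --> \oo] --> (p%:R^-1 : R).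
Proof.
move=> p_gt0; have pR : 0 < p%:R :> R by rewrite ltr0n.
apply: (squeeze_cvgr (f := fun n => p%:R^-1 - n%:R^-1) (h := fun=> p%:R^-1)).
- near=> n; have n_gt0 : 0 < n%:R :> R.
    by rewrite ltr0n; near: n; exact: nbhs_infty_gt.
  apply/andP; split; last first.
    by rewrite ler_pdivrMr // ler_pdivlMl // mulrC -natrM ler_nat leq_divM.
  rewrite ler_pdivlMr // mulrBl mulVf ?gt_eqF // lerBlDr ler_pdivrMl // natr1.
  by rewrite -natrM ler_nat mulnC ltnW // ltn_ceil.
- rewrite -[X in _ --> X]subr0; apply: cvgB; first exact: cvg_cst.
  exact: cvg_natr_inv.
- exact: cvg_cst.
Unshelve. all: by end_near. Qed.

Lemma cvg_succ_ln_divn (R : realType) p : (0 < p)%N ->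
  succ_ln R (n %/ p) / succ_ln R n @[n --> \oo] --> (1 : R).
Proof.
move=> p_gt0.
apply: (squeeze_cvgr (f := fun n => (ln n%:R + (1 - ln (2 * p)%:R)) / succ_ln R
  n)
  (h := fun=> 1)).
- near=> n; have p_le : (p <= n)%N by near: n; exact: nbhs_infty_ge.
  have q_gt0 : (0 < n %/ p)%N by rewrite divn_gt0.
  apply/andP; split; last by rewrite ler_pdivrMr ?succ_ln_gt0 // mul1r
    ler_succ_ln ?leq_div.
  rewrite ler_pM2r ?invr_gt0 ?succ_ln_gt0 // addrCA lerD2l lerBlDr.
  rewrite -lnM ?posrE ?ltr0n ?muln_gt0 // -natrM ler_ln_nat //.
  rewrite ltnW // (leq_trans (ltn_ceil n p_gt0)) // mulnA leq_mul2r; lia.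
- exact: cvg_ln_succ_ln.
- exact: cvg_cst.
Unshelve. all: by end_near. Qed.

Lemma dlimD (R : realType) i j (W W' : nat -> nat -> R) c c' :
  dlim i j W c -> dlim i j W' c' ->
  dlim i j (fun q m => W q m + W' q m) (c + c').
Proof.
move=> Wc W'c'; rewrite /dlim.
under eq_fun do rewrite dsumD mulrDl.
exact: cvgD.
Qed.

Lemma dlimZ (R : realType) i j (a : R) (W : nat -> nat -> R) c :
  dlim i j W c -> dlim i j (fun q m => a * W q m) (a * c).
Proof.
move=> Wc; rewrite /dlim; under eq_fun do rewrite dsumZ -mulrA.
exact: cvgMl_tmp.
Qed.

Lemma eq_dlim (R : realType) i j (W W' : nat -> nat -> R) c :
  (forall q m, (0 < q)%N -> (0 < m)%N -> W q m = W' q m) ->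
  dlim i j W c -> dlim i j W' c.
Proof.
move=> eqW; rewrite /dlim; under eq_fun => z.
  by rewrite (@eq_dsum _ _ W') => [|q m /andP[q_gt0 _] /andP[m_gt0 _]];
    [over | exact: eqW].
by [].
Qed.

Lemma dlim_comp (R : realType) i j (W : nat -> nat -> R) c (T : Type)
    (F : set_system T) {FF : Filter F} (X Q : T -> nat) :
  X t @[t --> F] --> \oo -> Q t @[t --> F] --> \oo -> dlim i j W c ->
  dsum W (X t) (Q t) / dmain R i j (X t) (Q t) @[t --> F] --> c.
Proof.
move=> FX FQ Wc.
exact: (@cvg_comp _ _ _ (fun t => (X t, Q t)) _ F _ _ (cvg_pair FX FQ) Wc).
Qed.

(** [dmain] depends on [Q] through slowly varying powers of [succ_ln] alone, so this shift keeps the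
    constant; its factor [X] makes the shift in [m] cost [1 / p]. *)
Lemma dlim_shift_q (R : realType) i j p (W : nat -> nat -> R) c : (0 < p)%N ->
  dlim i j W c -> dlim i j (shift_q p W) c.
Proof.
move=> p_gt0 Wc.
have c1 : z.1 @[z --> filter_prod \oo \oo] --> \oo by exact: cvg_fst.
have c2 : z.2 @[z --> filter_prod \oo \oo] --> \oo by exact: cvg_snd.
have c2p : (z.2 %/ p)%N @[z --> filter_prod \oo \oo] --> \oo.
  exact: cvg_comp c2 (cvg_divn_nat p_gt0).
have Lc : (succ_ln R (z.2 %/ p) / succ_ln R z.2) ^+ j @[z --> filter_prod \oo
  \oo] --> (1 : R).
  rewrite -[X in _ --> X](expr1n _ j); apply: cvg_exprn.
  exact: (cvg_comp _ (fun n => succ_ln R (n %/ p) / succ_ln R n) c2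
    (@cvg_succ_ln_divn R _ p_gt0)).
rewrite /dlim -[c]mulr1; apply: cvg_trans (cvgM (dlim_comp c1 c2p Wc) Lc).
apply: near_eq_cvg; near=> z.
have X0 : z.1%:R != 0 :> R.
  by rewrite pnatr_eq0 -lt0n; near: z; exact: (c1 _ (nbhs_infty_gt 0)).
rewrite /= dsum_shift_q // exprMn exprVn /dmain.
by field; rewrite ?X0 ?expf_neq0 ?succ_ln_neq0.
Unshelve. all: by end_near. Qed.

Lemma dlim_shift_m (R : realType) i j p (W : nat -> nat -> R) c : (0 < p)%N ->
  dlim i j W c -> dlim i j (shift_m p W) (c / p%:R).
Proof.
move=> p_gt0 Wc.
have c1 : z.1 @[z --> filter_prod \oo \oo] --> \oo by exact: cvg_fst.
have c2 : z.2 @[z --> filter_prod \oo \oo] --> \oo by exact: cvg_snd.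
have c1p : (z.1 %/ p)%N @[z --> filter_prod \oo \oo] --> \oo.
  exact: cvg_comp c1 (cvg_divn_nat p_gt0).
have Lc : (succ_ln R (z.1 %/ p) / succ_ln R z.1) ^+ i @[z --> filter_prod \oo
  \oo] --> (1 : R).
  rewrite -[X in _ --> X](expr1n _ i); apply: cvg_exprn.
  exact: (cvg_comp _ (fun n => succ_ln R (n %/ p) / succ_ln R n) c1
    (@cvg_succ_ln_divn R _ p_gt0)).
have Xc : (z.1 %/ p)%:R / z.1%:R @[z --> filter_prod \oo \oo] --> (p%:R^-1 : R).
  exact: (cvg_comp _ (fun n => (n %/ p)%:R / n%:R) c1 (@cvg_divn_ratio R _
    p_gt0)).
rewrite /dlim -[_ / _]mulr1 -mulrA.
apply: cvg_trans (cvgM (dlim_comp c1p c2 Wc) (cvgM Xc Lc)); apply: near_eq_cvg;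
  near=> z.
have z_ge : (p <= z.1)%N by near: z; exact: (c1 _ (nbhs_infty_ge p)).
have X0 : z.1%:R != 0 :> R by rewrite pnatr_eq0 -lt0n (leq_trans p_gt0).
have Xp0 : (z.1 %/ p)%:R != 0 :> R by rewrite pnatr_eq0 -lt0n divn_gt0.
rewrite /= dsum_shift_m // exprMn exprVn /dmain.
by field; rewrite ?X0 ?Xp0 ?expf_neq0 ?succ_ln_neq0.
Unshelve. all: by end_near. Qed.

(** * Imposing the weight at one prime *)

Definition shiftA (R : realType) (u : nat -> nat -> R) a b : R :=
  if a is a'.+1 then u a' b else 0.

Definition shiftB (R : realType) (u : nat -> nat -> R) a b : R :=
  if b is b'.+1 then u a b' else 0.

(** [u] sees the exponents of [p], and [W] the [p]-free parts. The division by a power of [p]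
    supplies the [p]-part of the factor [1 / q] present in the weights below. *)
Definition lift_at (R : realType) (p : nat) (u : nat -> nat -> R)
    (W : nat -> nat -> R) q m : R :=
  u (logn p q) (logn p m) / p%:R ^+ logn p q *
  W (q %/ p ^ logn p q)%N (m %/ p ^ logn p m)%N.

Lemma pfree_mul p n : prime p -> (0 < n)%N ->
  logn p (n * p) = (logn p n).+1 /\
  (n * p %/ p ^ (logn p n).+1 = n %/ p ^ logn p n)%N.
Proof.
move=> p_pr n_gt0; have p_gt0 := prime_gt0 p_pr; split.
  by rewrite lognM // (@logn_prime p p) // eqxx addn1.
by rewrite expnS [(n * p)%N]mulnC divnMl.
Qed.

Lemma lift_shiftA (R : realType) p u (W : nat -> nat -> R) q m :
  prime p -> (0 < q)%N ->
  lift_at p (shiftA u) W q m = p%:R^-1 * shift_q p (lift_at p u W) q m.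
Proof.
move=> p_pr q_gt0; have p_gt0 := prime_gt0 p_pr.
rewrite /shift_q /lift_at; case: (boolP (p %| q)%N) => [/dvdnP[q' Eq]|pq].
  have q'_gt0 : (0 < q')%N by case: q' Eq q_gt0 => // ->.
  subst q; have [-> ->] := pfree_mul p_pr q'_gt0.
  rewrite mulnK //= exprS invfM; ring.
by rewrite mulr0 lognE p_pr q_gt0 (negPf pq) /= !mul0r.
Qed.

Lemma lift_shiftB (R : realType) p u (W : nat -> nat -> R) q m :
  prime p -> (0 < m)%N ->
  lift_at p (shiftB u) W q m = shift_m p (lift_at p u W) q m.
Proof.
move=> p_pr m_gt0; have p_gt0 := prime_gt0 p_pr.
rewrite /shift_m /lift_at; case: (boolP (p %| m)%N) => [/dvdnP[m' Em]|pm].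
  have m'_gt0 : (0 < m')%N by case: m' Em m_gt0 => // ->.
  subst m; have [-> ->] := pfree_mul p_pr m'_gt0.
  by rewrite mulnK.
by rewrite [logn p m]lognE p_pr m_gt0 (negPf pm) /= !mul0r.
Qed.

(** For fixed [W] and [c], [lam] behaves as a linear functional of the [p]-component [u]. Either
    shift of the exponents multiplies it by [1 / p]: in [q] because of the factor [1 / q], in [m]
    because of the length of the range. Its value at the product of divisor functions then fixes the
    Euler factor. *)
Definition loclim (R : realType) (i j p : nat) (W : nat -> nat -> R) (c : R)
    (u : nat -> nat -> R) (lam : R) : Prop :=
  dlim i j (lift_at p u W) (c * lam).

Lemma eq_loclim (R : realType) i j p (W : nat -> nat -> R) c u u' lam lam' :
  (forall a b, u a b = u' a b) -> lam = lam' ->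
  loclim i j p W c u lam -> loclim i j p W c u' lam'.
Proof.
move=> eq_u <-; apply: eq_dlim => q m _ _; by rewrite /lift_at eq_u.
Qed.

Lemma loclimD (R : realType) i j p (W : nat -> nat -> R) c u u' lam lam' :
  loclim i j p W c u lam -> loclim i j p W c u' lam' ->
  loclim i j p W c (fun a b => u a b + u' a b) (lam + lam').
Proof.
move=> Hu Hu'; rewrite /loclim mulrDr; apply: eq_dlim (dlimD Hu Hu') => q m _ _.
by rewrite /lift_at; ring.
Qed.

Lemma loclimZ (R : realType) i j p (W : nat -> nat -> R) c (s : R) u lam :
  loclim i j p W c u lam ->
  loclim i j p W c (fun a b => s * u a b) (s * lam).
Proof.
move=> Hu; rewrite /loclim mulrCA; apply: eq_dlim (dlimZ (a := s) Hu) => q m _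
  _.
by rewrite /lift_at; ring.
Qed.

Lemma loclimB (R : realType) i j p (W : nat -> nat -> R) c u u' lam lam' :
  loclim i j p W c u lam -> loclim i j p W c u' lam' ->
  loclim i j p W c (fun a b => u a b - u' a b) (lam - lam').
Proof.
move=> Hu /(loclimZ (s := -1)) Hu'; apply: eq_loclim (loclimD Hu Hu') => [a b|];
  by rewrite mulN1r.
Qed.

Lemma loclim0 (R : realType) i j p (W : nat -> nat -> R) c u lam :
  loclim i j p W c u lam -> loclim i j p W c (fun _ _ => 0) 0.
Proof.
by move/(loclimZ (s := 0)); apply: eq_loclim => *; rewrite mul0r.
Qed.

(** The pair [u0], [lam0] provides the empty sum: multiplied by zero, it gives the zero weight. *)
Lemma loclim_sum (R : realType) i j p (W : nat -> nat -> R) c u0 lam0 n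
    (u : nat -> nat -> nat -> R) (lam : nat -> R) :
  loclim i j p W c u0 lam0 ->
  (forall s, (s < n)%N -> loclim i j p W c (u s) (lam s)) ->
  loclim i j p W c (fun a b => \sum_(0 <= s < n) u s a b)
    (\sum_(0 <= s < n) lam s).
Proof.
move=> H0; elim: n => [|n IHn] H.
  by apply: eq_loclim (loclim0 H0) => [a b|]; rewrite big_geq.
have IH := IHn (fun s sn => H s (ltnW sn)).
by apply: eq_loclim (loclimD IH (H n (leqnn _))) => [a b|]; rewrite
  big_nat_recr.
Qed.

Lemma loclim_shiftA (R : realType) i j p (W : nat -> nat -> R) c u lam :
  prime p -> loclim i j p W c u lam ->
  loclim i j p W c (shiftA u) (lam / p%:R).
Proof.
move=> p_pr Hu; have := dlimZ (a := p%:R^-1) (dlim_shift_q (prime_gt0 p_pr) Hu).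
rewrite mulrC -mulrA; apply: eq_dlim => q m q_gt0 _.
by rewrite lift_shiftA.
Qed.

Lemma loclim_shiftB (R : realType) i j p (W : nat -> nat -> R) c u lam :
  prime p -> loclim i j p W c u lam ->
  loclim i j p W c (shiftB u) (lam / p%:R).
Proof.
move=> p_pr Hu; have := dlim_shift_m (prime_gt0 p_pr) Hu.
rewrite -mulrA; apply: eq_dlim => q m _ m_gt0.
by rewrite lift_shiftB.
Qed.

Definition divkp (R : realType) (k p a : nat) : R := (divk k (p ^ a))%:R.

Lemma divkp0 (R : realType) p a : prime p -> divkp R 0 p a = (a == 0)%:R.
Proof. by move=> p_pr; rewrite /divkp divk_exp0. Qed.

Lemma divkpn0 (R : realType) k p : divkp R k p 0 = 1.
Proof. by rewrite /divkp expn0 divkn1. Qed.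

Lemma divkpS (R : realType) k p a : prime p ->
  divkp R k.+1 p a.+1 = divkp R k.+1 p a + divkp R k p a.+1.
Proof. by move=> p_pr; rewrite /divkp divk_expS // natrD. Qed.

(* Subtracting from the sum its shift by p lowers by one the index of the
   divisor function at p. *)
Lemma loclim_deltaA (R : realType) i j p (W : nat -> nat -> R) c r v lam s :
  prime p -> loclim i j p W c (fun a b => divkp R r p a * v b) lam ->
  loclim i j p W c (fun a b => (a == s)%:R * v b)
    (lam * (1 - p%:R^-1) ^+ r * p%:R^-1 ^+ s).
Proof.
move=> p_pr; elim: s => [|s IHs].
  rewrite expr0 mulr1; elim: r lam => [|r IHr] lam H.
    apply: eq_loclim H => [a b|]; first by rewrite divkp0.
    by rewrite expr0 mulr1.
  rewrite exprS mulrA; apply: IHr.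
  apply: eq_loclim (loclimB H (loclim_shiftA p_pr H)) => [a b|]; last by ring.
  case: a => [|a] /=; first by rewrite !divkpn0 subr0.
  by rewrite -mulrBl divkpS // addrAC subrr add0r.
move=> /IHs /(loclim_shiftA p_pr); apply: eq_loclim => [a b|].
  by case: a => [|a] /=; rewrite ?mul0r.
by rewrite exprSr mulrA.
Qed.

Lemma loclim_deltaB (R : realType) i j p (W : nat -> nat -> R) c r v lam s :
  prime p -> loclim i j p W c (fun a b => v a * divkp R r p b) lam ->
  loclim i j p W c (fun a b => v a * (b == s)%:R)
    (lam * (1 - p%:R^-1) ^+ r * p%:R^-1 ^+ s).
Proof.
move=> p_pr; elim: s => [|s IHs].
  rewrite expr0 mulr1; elim: r lam => [|r IHr] lam H.
    apply: eq_loclim H => [a b|]; first by rewrite divkp0.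
    by rewrite expr0 mulr1.
  rewrite exprS mulrA; apply: IHr.
  apply: eq_loclim (loclimB H (loclim_shiftB p_pr H)) => [a b|]; last by ring.
  case: b => [|b] /=; first by rewrite !divkpn0 subr0.
  by rewrite -mulrBr divkpS // addrAC subrr add0r.
move=> /IHs /(loclim_shiftB p_pr); apply: eq_loclim => [a b|].
  by case: b => [|b] /=; rewrite ?mulr0.
by rewrite exprSr mulrA.
Qed.

(* With q = p^a q' and m = p^b m', this is the p-part of
   q [gcd(m, q) = gcd(h, q)] / phi(q / gcd(h, q)) when p^g exactly divides h. *)
Definition kap (R : realType) (p g a b : nat) : R :=
  if (a <= g)%N then (if (a <= b)%N then p%:R ^+ a else 0)
  else if b == g then p%:R ^+ g / (1 - p%:R^-1) else 0.

(** The first sum collects [a = s <= g] with [b >= s], the last term [b = g] with [a > g]. Each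
    infinite range of exponents enters as a total mass minus a finite sum, so only finitely many
    shifts occur. *)
Definition local_mean (R : realType) (j k p g : nat) : R :=
  \sum_(0 <= s < g.+1) divkp R j p s * p%:R ^+ s *
     ((1 - p%:R^-1) ^+ j * p%:R^-1 ^+ s -
      \sum_(0 <= t < s) divkp R k p t *
        ((1 - p%:R^-1) ^+ j * p%:R^-1 ^+ s * (1 - p%:R^-1) ^+ k * p%:R^-1 ^+ t))
  + p%:R ^+ g / (1 - p%:R^-1) * divkp R k p g *
     ((1 - p%:R^-1) ^+ k * p%:R^-1 ^+ g -
      \sum_(0 <= s < g.+1) divkp R j p s *
        ((1 - p%:R^-1) ^+ k * p%:R^-1 ^+ g * (1 - p%:R^-1) ^+ j * p%:R^-1 ^+
          s)).

Lemma sum_delta (R : realType) n (F : nat -> R) a :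
  \sum_(0 <= s < n) F s * (a == s)%:R = if (a < n)%N then F a else 0.
Proof.
case: ltnP => an.
  rewrite (bigD1_seq a) ?mem_index_iota ?iota_uniq //= eqxx mulr1.
  by rewrite big1 ?addr0 // => s /negPf sa; rewrite eq_sym sa mulr0.
rewrite big_nat_cond big1 // => s /andP[/andP[_ sn] _].
by rewrite gtn_eqF ?mulr0 // (leq_trans sn).
Qed.

Lemma loclim_kap (R : realType) i j p (W : nat -> nat -> R) c r k g :
  prime p -> loclim i j p W c (fun a b => divkp R r p a * divkp R k p b) 1 ->
  loclim i j p W c (fun a b => divkp R r p a * divkp R k p b * kap R p g a b)
    (local_mean R r k p g).
Proof.
move=> p_pr H.
have HA (s : nat) : loclim i j p W c (fun a b => (a == s)%:R * divkp R k p b)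
    ((1 - p%:R^-1) ^+ r * p%:R^-1 ^+ s).
  by have := loclim_deltaA (v := divkp R k p) (s := s) p_pr H; rewrite mul1r.
have HB (t : nat) : loclim i j p W c (fun a b => divkp R r p a * (b == t)%:R)
    ((1 - p%:R^-1) ^+ k * p%:R^-1 ^+ t).
  by have := loclim_deltaB (v := divkp R r p) (s := t) p_pr H; rewrite mul1r.
have HAB s t := loclim_deltaB (v := fun a => (a == s)%:R) (s := t) p_pr (HA s).
have HBA t s := loclim_deltaA (v := fun b => (b == t)%:R) (s := s) p_pr (HB t).
(* [T1 s] isolates [a = s], [b >= s], and [T2] isolates [b = g], [a > g]; together these are the
   supports of [kap]. *)
have T1 s := loclimZ (s := divkp R r p s * p%:R ^+ s) (loclimB (HA s)
  (loclim_sum H (n := s) (fun t _ => loclimZ (s := divkp R k p t) (HAB s t)))).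
have T2 := loclimZ (s := p%:R ^+ g / (1 - p%:R^-1) * divkp R k p g) (loclimB
  (HB g)
  (loclim_sum H (n := g.+1) (fun s _ => loclimZ (s := divkp R r p s) (HBA g
    s)))).
apply: eq_loclim (loclimD (loclim_sum H (n := g.+1) (fun s _ => T1 s)) T2) =>
  //.
move=> a b; rewrite /kap.
have E1 s : divkp R r p s * p%:R ^+ s * ((a == s)%:R * divkp R k p b -
     \sum_(0 <= t < s) divkp R k p t * ((a == s)%:R * (b == t)%:R)) =
   divkp R r p s * p%:R ^+ s * (divkp R k p b -
     if (b < s)%N then divkp R k p b else 0) * (a == s)%:R.
  rewrite -(sum_delta s (divkp R k p)); under eq_bigr do rewrite mulrCA.
  by rewrite -mulr_sumr; ring.
under eq_bigr do rewrite E1.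
rewrite (sum_delta g.+1 (fun s => divkp R r p s * p%:R ^+ s * _)) ltnS.
under eq_bigr do rewrite mulrA.
rewrite -mulr_suml sum_delta ltnS.
case: (leqP a g) => ag.
  rewrite subrr mulr0 addr0; case: (leqP a b) => ab; last by rewrite subrr
    !mulr0.
  by rewrite subr0; ring.
by rewrite mul0r subr0 add0r; case: eqP => [->|_] /=; rewrite ?mulr1n ?mulr0n;
  ring.
Qed.

(* The weight in which the gcd condition and the totient are taken into account
   at the primes below N only; [wt_gcd] below is its stable value. *)
Definition wt (R : realType) (h j k N q m : nat) : R :=
  (divk j q)%:R * (divk k m)%:R / q%:R *
  \prod_(0 <= p < N | prime p) kap R p (logn p h) (logn p q) (logn p m).

Lemma pfree_part p n : prime p -> (0 < n)%N ->
  [/\ n = (p ^ logn p n * (n %/ p ^ logn p n))%N,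
      (0 < n %/ p ^ logn p n)%N,
      ~~ (p %| n %/ p ^ logn p n)%N &
      forall p0, p0 != p -> logn p0 n = logn p0 (n %/ p ^ logn p n)].
Proof.
move=> p_pr n_gt0; have [q cop En] := pfactor_coprime p_pr n_gt0.
have pa_gt0 : (0 < p ^ logn p n)%N by rewrite expn_gt0 prime_gt0.
have Eq : (n %/ p ^ logn p n = q)%N by rewrite {1}En mulnK.
have q_gt0 : (0 < q)%N by case: q En n_gt0 {cop Eq} => // ->.
rewrite Eq; split=> //; first by rewrite mulnC.
  by rewrite -prime_coprime.
move=> p0 p0p; rewrite {1}En lognM // lognX (@logn_prime p0 p) //.
by rewrite (negPf p0p) muln0 addn0.
Qed.

(** At a prime not yet treated the local component is the pure product of divisor functions, which
    is the starting value that [loclim_kap] asks for. *)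
Lemma wt_lift (R : realType) h j k N p q m : prime p -> (N <= p)%N ->
  (0 < q)%N -> (0 < m)%N ->
  wt R h j k N q m =
  lift_at p (fun a b => divkp R j p a * divkp R k p b) (wt R h j k N) q m.
Proof.
move=> p_pr Np q_gt0 m_gt0; have p_gt0 := prime_gt0 p_pr.
have [Eq q'_gt0 pq' Lq] := pfree_part p_pr q_gt0.
have [Em m'_gt0 pm' Lm] := pfree_part p_pr m_gt0.
rewrite /lift_at /wt -!mulrA.
have -> : \prod_(0 <= p0 < N | prime p0)
      kap R p0 (logn p0 h) (logn p0 q) (logn p0 m) =
    \prod_(0 <= p0 < N | prime p0) kap R p0 (logn p0 h)
      (logn p0 (q %/ p ^ logn p q)%N) (logn p0 (m %/ p ^ logn p m)%N).
  apply: congr_big_nat => // p0 /andP[_ p0N]; have p0p : p0 != p.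
    by rewrite neq_ltn (leq_trans p0N Np).
  by rewrite Lq // Lm.
rewrite {1}Eq {1}Em !divk_pfree // !natrM [q in q%:R^-1]Eq natrM natrX invfM.
by rewrite /divkp; ring.
Qed.

Lemma wtS_lift (R : realType) h j k p q m : prime p ->
  (0 < q)%N -> (0 < m)%N ->
  wt R h j k p.+1 q m =
  lift_at p (fun a b => divkp R j p a * divkp R k p b * kap R p (logn p h) a b)
    (wt R h j k p) q m.
Proof.
move=> p_pr q_gt0 m_gt0; rewrite [LHS]/wt big_mkcond big_nat_recr //= p_pr.
rewrite -big_mkcond mulrA -/(wt R h j k p q m) (@wt_lift _ _ _ _ _ p) //.
by rewrite /lift_at; ring.
Qed.

Lemma wt_notprime (R : realType) h j k N q m : ~~ prime N ->
  wt R h j k N.+1 q m = wt R h j k N q m.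
Proof.
move=> Npr; rewrite /wt big_mkcond big_nat_recr //= (negPf Npr) mulr1.
by rewrite -big_mkcond.
Qed.

Lemma dsum_wt0 (R : realType) h j k X Q :
  dsum (wt R h j k 0) X Q = divk_hsum R j Q * divk_sum R k X.
Proof.
rewrite /divk_hsum mulr_suml; apply: eq_bigr => q _; rewrite mulr_sumr.
by apply: eq_bigr => m _; rewrite /wt big_geq // mulr1 mulrAC.
Qed.

Lemma dlim_wt0 (R : realType) h j k :
  dlim k j (wt R h j k.+1 0) (j`!%:R * k`!%:R)^-1.
Proof.
have c1 : z.1 @[z --> filter_prod \oo \oo] --> \oo by exact: cvg_fst.
have c2 : z.2 @[z --> filter_prod \oo \oo] --> \oo by exact: cvg_snd.
have Ec := cvg_comp _ (fun n => divk_sum R k.+1 n / (n%:R * succ_ln R n ^+ k))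
  c1
  (@cvg_divk_sum R k).
have Fc := cvg_comp _ (fun n => divk_hsum R j n / succ_ln R n ^+ j) c2
  (@cvg_divk_hsum R j).
rewrite /dlim invfM; apply: cvg_trans (cvgM Fc Ec); apply: near_eq_cvg.
near=> z; rewrite /= dsum_wt0 mulf_div /dmain; congr (_ / _).
by rewrite [in LHS]mulrC.
Unshelve. all: by end_near. Qed.

Lemma dlim_wt (R : realType) h j k N :
  dlim k j (wt R h j k.+1 N) ((j`!%:R * k`!%:R)^-1 *
    \prod_(0 <= p < N | prime p) local_mean R j k.+1 p (logn p h)).
Proof.
elim: N => [|p IH]; first by rewrite big_geq // mulr1; exact: dlim_wt0.
case: (boolP (prime p)) => [p_pr|npr]; last first.
  rewrite big_mkcond big_nat_recr //= (negPf npr) mulr1 -big_mkcond.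
  by apply: eq_dlim IH => q m _ _; rewrite wt_notprime.
rewrite big_mkcond big_nat_recr //= p_pr -big_mkcond mulrA.
set c := _ * _ in IH *.
have H : loclim k j p (wt R h j k.+1 p) c
    (fun a b => divkp R j p a * divkp R k.+1 p b) 1.
  rewrite /loclim mulr1; apply: eq_dlim IH => q m q_gt0 m_gt0.
  by rewrite -wt_lift.
have := loclim_kap (g := logn p h) p_pr H; apply: eq_dlim => q m q_gt0 m_gt0.
by rewrite wtS_lift.
Qed.

(** * Uniform bounds for the primes beyond the truncation *)

Lemma onem_inv_gt0 (R : realType) p : prime p -> 0 < 1 - p%:R^-1 :> R.
Proof.
move=> p_pr; rewrite subr_gt0 invf_lt1 ?ltr0n ?prime_gt0 //.
by rewrite ltr1n prime_gt1.
Qed.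

Lemma kap_ge0 (R : realType) p g a b : prime p -> 0 <= kap R p g a b.
Proof.
move=> p_pr; rewrite /kap; case: ifP => _; case: ifP => _ //.
by rewrite divr_ge0 ?exprn_ge0 // ltW // onem_inv_gt0.
Qed.

Lemma wt_ge0 (R : realType) h j k N q m : 0 <= wt R h j k N q m.
Proof.
rewrite /wt mulr_ge0 ?divr_ge0 ?mulr_ge0 // prodr_ge0 // => p p_pr.
exact: kap_ge0.
Qed.

Lemma kap_le (R : realType) p g a b : prime p ->
  kap R p g a b <= 2 * p%:R ^+ g.
Proof.
move=> p_pr; have p_ge2 : 2 <= p%:R :> R by rewrite ler_nat prime_gt1.
have pg : 1 <= p%:R ^+ g :> R.
  by rewrite exprn_ege1 // (le_trans _ p_ge2) // ler1n.
have p2g : 0 <= 2 * p%:R ^+ g :> R by rewrite mulr_ge0 // (le_trans ler01).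
rewrite /kap; case: leqP => ag; case: ifP => _ //.
  apply: le_trans (_ : p%:R ^+ g <= _).
    by rewrite ler_weXn2l // (le_trans _ p_ge2) // ler1n.
  by rewrite ler_peMl // ?ler1n // (le_trans ler01).
rewrite mulrC ler_pM2r ?(lt_le_trans ltr01) // -[leRHS]invrK.
rewrite lef_pV2 ?posrE ?invr_gt0 ?onem_inv_gt0 //.
have : p%:R^-1 <= 2^-1 :> R by rewrite lef_pV2 ?posrE // (lt_le_trans _ p_ge2).
lra.
Qed.

(** When [p] does not divide [h] the weight is [1] if [p] does not divide [q], [p / (p - 1)] if it
    divides [q] but not [m], and [0] if it divides both. *)
Lemma kap_diff (R : realType) p a b : prime p ->
  `|kap R p 0 a b - 1| <=
    if a is _.+1 then if b is _.+1 then 1 else (p%:R - 1)^-1 else 0.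
Proof.
move=> p_pr; have p_gt0 : 0 < p%:R :> R by rewrite ltr0n prime_gt0.
have p1_gt0 : 0 < p%:R - 1 :> R by rewrite subr_gt0 ltr1n prime_gt1.
rewrite /kap; case: a => [|a] /=; first by rewrite expr0 subrr normr0.
case: b => [|b] /=; last by rewrite sub0r normrN1.
rewrite expr0 (_ : 1 / _ - 1 = (p%:R - 1)^-1).
  by rewrite ger0_norm // invr_ge0 ltW.
by field; rewrite !gt_eqF.
Qed.

(** The factor [1 / q] gives [1 / p] and the divisor function at most [j], while the local weights
    below [N] do not see the change. Hence the pairs with [p] dividing [q] carry a proportion at
    most [j / p]. *)
Lemma wt_mul_q_le (R : realType) h j k N p q m : prime p -> (N <= p)%N ->
  (0 < q)%N ->
  wt R h j k N (q * p) m <= j%:R / p%:R * wt R h j k N q m.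
Proof.
move=> p_pr Np q_gt0; have p_gt0 := prime_gt0 p_pr; rewrite /wt.
have -> : \prod_(0 <= p0 < N | prime p0)
      kap R p0 (logn p0 h) (logn p0 (q * p)) (logn p0 m) =
    \prod_(0 <= p0 < N | prime p0) kap R p0 (logn p0 h) (logn p0 q) (logn p0 m).
  apply: congr_big_nat => // p0 /andP[_ p0N]; have p0p : p0 != p.
    by rewrite neq_ltn (leq_trans p0N Np).
  by rewrite lognM // (@logn_prime p0 p) // (negPf p0p) addn0.
rewrite mulrA ler_wpM2r ?prodr_ge0 // => [p0 p0_pr|]; first exact: kap_ge0.
rewrite [leRHS](_ : _ = (j * divk j q)%:R * (divk k m)%:R / (q * p)%:R); last
  first.
  by rewrite !natrM invfM; ring.
rewrite ler_wpM2r ?invr_ge0 // ler_wpM2r // ler_nat mulnC.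
exact: divk_prime_mul_le.
Qed.

Lemma wt_mul_m_le (R : realType) h j k N p q m : prime p -> (N <= p)%N ->
  (0 < m)%N ->
  wt R h j k N q (m * p) <= k%:R * wt R h j k N q m.
Proof.
move=> p_pr Np m_gt0; have p_gt0 := prime_gt0 p_pr; rewrite /wt.
have -> : \prod_(0 <= p0 < N | prime p0)
      kap R p0 (logn p0 h) (logn p0 q) (logn p0 (m * p)) =
    \prod_(0 <= p0 < N | prime p0) kap R p0 (logn p0 h) (logn p0 q) (logn p0 m).
  apply: congr_big_nat => // p0 /andP[_ p0N]; have p0p : p0 != p.
    by rewrite neq_ltn (leq_trans p0N Np).
  by rewrite lognM // (@logn_prime p0 p) // (negPf p0p) addn0.
rewrite mulrA ler_wpM2r ?prodr_ge0 // => [p0 p0_pr|]; first exact: kap_ge0.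
rewrite [leRHS](_ : _ = (divk j q)%:R * (k * divk k m)%:R / q%:R); last first.
  by rewrite natrM; ring.
rewrite ler_wpM2r ?invr_ge0 // ler_wpM2l // ler_nat mulnC.
exact: divk_prime_mul_le.
Qed.

(** The first term covers [p] dividing [q] alone, where the weight moves by [1 / (p - 1)]. The
    second covers [p] dividing both, where it moves by [1] but the shift in [m] gains a further
    [1 / p] after summation. Both end up of order [1 / p ^ 2]. *)
Lemma wtS_diff_le (R : realType) h j k p q m : prime p -> (0 < h < p)%N ->
  (0 < q)%N -> (0 < m)%N ->
  `|wt R h j k p.+1 q m - wt R h j k p q m| <=
    j%:R / (p%:R * (p%:R - 1)) * shift_q p (wt R h j k p) q m +
    j%:R * k%:R / p%:R * shift_m p (shift_q p (wt R h j k p)) q m.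
Proof.
move=> p_pr /andP[h_gt0 hp] q_gt0 m_gt0; have p_gt0 := prime_gt0 p_pr.
have pR : 0 < p%:R :> R by rewrite ltr0n.
have p1R : 0 < p%:R - 1 :> R by rewrite subr_gt0 ltr1n prime_gt1.
have h_log : logn p h = 0%N by rewrite lognE p_pr h_gt0 gtnNdvd.
have -> : wt R h j k p.+1 q m =
    wt R h j k p q m * kap R p 0 (logn p q) (logn p m).
  by rewrite /wt big_mkcond big_nat_recr //= p_pr -big_mkcond mulrA h_log.
rewrite -[X in _ - X]mulr1 -mulrBr normrM ger0_norm ?wt_ge0 //.
apply: le_trans (ler_wpM2l (wt_ge0 _ _ _ _ _ _ _) (kap_diff R _ _ p_pr)) _.
have c1 : 0 <= j%:R / (p%:R * (p%:R - 1)) :> R.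
  by rewrite divr_ge0 // mulr_ge0 // ltW.
have c2 : 0 <= j%:R * k%:R / p%:R :> R by rewrite divr_ge0 ?mulr_ge0 // ltW.
have S1 q' m' : 0 <= shift_q p (wt R h j k p) q' m'.
  by rewrite /shift_q; case: ifP => // _; exact: wt_ge0.
have S2 : 0 <= shift_m p (shift_q p (wt R h j k p)) q m.
  by rewrite /shift_m; case: ifP.
case Ea: (logn p q) => [|a].
  by rewrite mulr0 addr_ge0 // mulr_ge0.
have /dvdnP[q' Eq] : (p %| q)%N.
  by move: Ea; rewrite lognE p_pr q_gt0; case: ifP.
have q'_gt0 : (0 < q')%N by case: q' Eq q_gt0 => // ->.
subst q; case Eb: (logn p m) => [|b].
  apply: ler_wpDr; first by rewrite mulr_ge0.
  rewrite /shift_q dvdn_mull // mulnK //.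
  apply: le_trans (ler_wpM2r _ (wt_mul_q_le _ _ _ _ _ p_pr (leqnn _) q'_gt0)) _.
    by rewrite invr_ge0 ltW.
  by rewrite le_eqVlt; apply/orP; left; apply/eqP; field; rewrite !gt_eqF.
have /dvdnP[m' Em] : (p %| m)%N.
  by move: Eb; rewrite lognE p_pr m_gt0; case: ifP.
have m'_gt0 : (0 < m')%N by case: m' Em m_gt0 => // ->.
subst m; apply: ler_wpDl; first by rewrite mulr_ge0.
rewrite /shift_m /shift_q !dvdn_mull // !mulnK // mulr1.
apply: le_trans (wt_mul_q_le _ _ _ _ _ p_pr (leqnn _) q'_gt0) _.
rewrite [leRHS](_ : _ = j%:R / p%:R * (k%:R * wt R h j k p q' m')); last by
  ring.
rewrite ler_wpM2l ?divr_ge0 ?(ltW pR) //.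
exact: wt_mul_m_le.
Qed.

Lemma dsum_wt0_le (R : realType) h j k X Q :
  dsum (wt R h j k.+1 0) X Q <=
    (j.+1%:R ^+ j * k.+1%:R ^+ k) * dmain R k j X Q.
Proof.
rewrite dsum_wt0 [leRHS](_ : _ = (j.+1%:R ^+ j * succ_ln R Q ^+ j) *
  (k.+1%:R ^+ k * (X%:R * succ_ln R X ^+ k))); last by rewrite /dmain; ring.
by rewrite ler_pM ?divk_hsum_ge0 ?divk_sum_ge0 ?divk_hsum_le_succ_ln
  ?divk_sum_le_succ_ln.
Qed.

Lemma wtS_le (R : realType) h j k p q m : prime p -> (0 < h)%N ->
  wt R h j k p.+1 q m <= 2 * h%:R * wt R h j k p q m.
Proof.
move=> p_pr h_gt0; rewrite [leLHS]/wt big_mkcond big_nat_recr //= p_pr.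
rewrite -big_mkcond mulrA mulrC ler_wpM2r ?wt_ge0 //.
apply: le_trans (kap_le R _ _ _ p_pr) _; rewrite ler_wpM2l // -natrX ler_nat.
by apply: dvdn_leq => //; exact: pfactor_dvdnn.
Qed.

Lemma dsum_wtS_diff (R : realType) h j k p X Q : prime p -> (0 < h < p)%N ->
  `|dsum (wt R h j k p.+1) X Q - dsum (wt R h j k p) X Q| <=
    j%:R / (p%:R * (p%:R - 1)) * dsum (wt R h j k p) X (Q %/ p) +
    j%:R * k%:R / p%:R * dsum (wt R h j k p) (X %/ p) (Q %/ p).
Proof.
move=> p_pr hp; have p_gt0 := prime_gt0 p_pr.
have -> : dsum (wt R h j k p.+1) X Q - dsum (wt R h j k p) X Q =
    dsum (fun q m => wt R h j k p.+1 q m - wt R h j k p q m) X Q.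
  rewrite -[X in _ + X]mulN1r -dsumZ -dsumD.
  by apply: eq_dsum => q m _ _; rewrite mulN1r.
apply: le_trans (ler_norm_dsum _ _ _) _.
rewrite -!dsum_shift_q // -dsum_shift_m // -!dsumZ -dsumD.
by apply: ler_dsum => q m q_gt0 m_gt0; exact: wtS_diff_le.
Qed.

(** For an upper bound only an increase of the weight counts, and it increases only when [p] divides
    [q] and not [m]. Keeping the same ranges on both sides lets the bound be iterated over the
    primes. *)
Lemma dsum_wtS_le (R : realType) h j k p X Q : prime p -> (0 < h < p)%N ->
  dsum (wt R h j k p.+1) X Q <=
    (1 + j%:R / (p%:R * (p%:R - 1))) * dsum (wt R h j k p) X Q.
Proof.
move=> p_pr /andP[h_gt0 hp]; have p_gt0 := prime_gt0 p_pr.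
have pR : 0 < p%:R :> R by rewrite ltr0n.
have p1R : 0 < p%:R - 1 :> R by rewrite subr_gt0 ltr1n prime_gt1.
have c1 : 0 <= j%:R / (p%:R * (p%:R - 1)) :> R.
  by rewrite divr_ge0 // mulr_ge0 // ltW.
have h_log : logn p h = 0%N by rewrite lognE p_pr h_gt0 gtnNdvd.
apply: le_trans (_ : dsum (wt R h j k p) X Q +
    j%:R / (p%:R * (p%:R - 1)) * dsum (wt R h j k p) X (Q %/ p) <= _); last
      first.
  rewrite mulrDl mul1r lerD2l ler_wpM2l // ler_dsum_wid ?leq_div //.
  by move=> q m; exact: wt_ge0.
rewrite -dsum_shift_q // -dsumZ -dsumD; apply: ler_dsum => q m q_gt0 m_gt0.
rewrite [leLHS]/wt big_mkcond big_nat_recr //= p_pr -big_mkcond mulrA h_log.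
rewrite -/(wt R h j k p q m) -lerBlDl -[X in _ - X]mulr1 -mulrBr.
case: (boolP (p %| q)%N) => [/dvdnP[q' Eq]|pq]; last first.
  by rewrite /shift_q (negPf pq) lognE p_pr q_gt0 (negPf pq) /kap /= subrr
    !mulr0.
have q'_gt0 : (0 < q')%N by case: q' Eq q_gt0 => // ->.
subst q; rewrite /shift_q dvdn_mull // mulnK //.
apply: le_trans (_ : wt R h j k p (q' * p) m * (p%:R - 1)^-1 <= _).
  rewrite ler_wpM2l ?wt_ge0 //.
  have p1inv : 0 <= (p%:R - 1)^-1 :> R by rewrite invr_ge0 ltW.
  case: (posnP (logn p m)) => [-> |mb]; last first.
    rewrite /kap leqn0; case: eqP => [->|_].
      by rewrite leq0n expr0 subrr.
    by rewrite gtn_eqF // sub0r (le_trans _ p1inv) // lerN10.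
  apply: le_trans (ler_norm _) _; apply: le_trans (kap_diff R _ _ p_pr) _.
  by case: logn.
rewrite -ler_pdivlMr ?invr_gt0 // invrK.
apply: le_trans (wt_mul_q_le _ _ _ _ _ p_pr (leqnn _) q'_gt0) _.
by rewrite le_eqVlt; apply/orP; left; apply/eqP; field; rewrite !gt_eqF.
Qed.

(** Bounding a sum over primes by the sum over all integers makes it telescope. *)
Lemma inv_mul_pred (R : realType) t : (0 < t)%N ->
  (t.+1%:R * (t.+1%:R - 1))^-1 = t%:R^-1 - t.+1%:R^-1 :> R.
Proof.
move=> t_gt0; have tR : 0 < t%:R :> R by rewrite ltr0n.
rewrite -natr1; field; rewrite -?natr1 !gt_eqF //.
Qed.

(** Crude, with a factor [2 h] at every step; it is applied only up to [h + 1], to pass the primes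
    that may divide [h]. *)
Lemma dsum_wt_growth_small (R : realType) h j k N X Q : (0 < h)%N ->
  dsum (wt R h j k N) X Q <= (2 * h%:R) ^+ N * dsum (wt R h j k 0) X Q.
Proof.
move=> h_gt0; have h2 : 1 <= 2 * h%:R :> R by rewrite -natrM ler1n muln_gt0.
have d_ge0 N' X' Q' : 0 <= dsum (wt R h j k N') X' Q'.
  by apply: dsum_ge0 => q m; exact: wt_ge0.
elim: N => [|p IH]; first by rewrite expr0 mul1r.
rewrite exprS -mulrA; apply: le_trans (_ : 2 * h%:R * dsum (wt R h j k p) X Q
  <= _).
  case: (boolP (prime p)) => p_pr.
    by rewrite -dsumZ; apply: ler_dsum => q m _ _; exact: wtS_le.
  rewrite (@eq_dsum _ _ (wt R h j k p)) => [|q m _ _]; last exact: wt_notprime.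
  by rewrite ler_peMl.
by rewrite ler_wpM2l // (le_trans ler01).
Qed.

Lemma dsum_wt_growth (R : realType) h j k t X Q : (0 < h)%N ->
  dsum (wt R h j k (h.+1 + t)) X Q <=
    expR (j%:R * (h%:R^-1 - (h + t)%:R^-1)) * dsum (wt R h j k h.+1) X Q.
Proof.
move=> h_gt0.
have d_ge0 N' X' Q' : 0 <= dsum (wt R h j k N') X' Q'.
  by apply: dsum_ge0 => q m; exact: wt_ge0.
elim: t => [|t IH]; first by rewrite !addn0 subrr mulr0 expR0 mul1r.
have ht : (0 < h + t)%N by rewrite addn_gt0 h_gt0.
rewrite !addnS addSn; apply: le_trans (_ : expR (j%:R * ((h + t)%:R^-1 - (h +
  t).+1%:R^-1)) *
    dsum (wt R h j k (h.+1 + t)) X Q <= _); last first.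
  rewrite (_ : j%:R * (h%:R^-1 - (h + t).+1%:R^-1) =
      j%:R * ((h + t)%:R^-1 - (h + t).+1%:R^-1) +
      j%:R * (h%:R^-1 - (h + t)%:R^-1)); last by ring.
  by rewrite expRD -mulrA ler_wpM2l ?expR_ge0.
rewrite addSn; have expge : 1 + j%:R / ((h + t).+1%:R * ((h + t).+1%:R - 1)) <=
    expR (j%:R * ((h + t)%:R^-1 - (h + t).+1%:R^-1)) :> R.
  by rewrite inv_mul_pred // expR_ge1Dx.
case: (boolP (prime (h + t).+1)) => p_pr.
  apply: le_trans (dsum_wtS_le _ _ _ _ _ p_pr _) _; first by rewrite h_gt0 ltnS
    leq_addr.
  by rewrite ler_wpM2r.
rewrite (@eq_dsum _ _ (wt R h j k (h + t).+1)) => [|q m _ _]; last exact: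
  wt_notprime.
rewrite ler_peMl // (le_trans _ expge) // lerDl divr_ge0 // mulr_ge0 //
  subr_ge0 ler1n.
Qed.

(** The uniformity in [N] feeds the tail estimate, where the effect of each new prime is bounded by
    the sum with the smaller primes already imposed. *)
Lemma dsum_wt_le (R : realType) h j k : (0 < h)%N ->
  exists2 C : R, 0 <= C & forall N X Q, (h < N)%N ->
    dsum (wt R h j k.+1 N) X Q <= C * dmain R k j X Q.
Proof.
move=> h_gt0; exists (expR j%:R * ((2 * h%:R) ^+ h.+1 *
    (j.+1%:R ^+ j * k.+1%:R ^+ k))) => [|N X Q hN].
  by rewrite !mulr_ge0 ?expR_ge0 ?exprn_ge0 ?mulr_ge0.
rewrite -(subnKC hN) -!mulrA; apply: le_trans (dsum_wt_growth _ _ _ _ _ _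
  h_gt0) _.
apply: ler_pM; first exact: expR_ge0.
- by apply: dsum_ge0 => q m; exact: wt_ge0.
-
  rewrite ler_expR ler_piMr // (le_trans (_ : _ <= h%:R^-1)) //.
    by rewrite gerBl invr_ge0.
  by rewrite invf_le1 ?ltr0n // ler1n.
apply: le_trans (dsum_wt_growth_small _ _ _ _ _ _ h_gt0) _.
rewrite ler_wpM2l ?exprn_ge0 ?mulr_ge0 //.
by rewrite mulrA; exact: dsum_wt0_le.
Qed.

Lemma dmain_divn_le (R : realType) i j p X Q : (0 < p)%N ->
  dmain R i j (X %/ p) (Q %/ p) <= p%:R^-1 * dmain R i j X Q.
Proof.
move=> p_gt0; have L0 n := ltW (succ_ln_gt0 R n).
rewrite /dmain !mulrA !ler_pM ?mulr_ge0 ?exprn_ge0 ?invr_ge0 //.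
- by rewrite ler_pdivlMl ?ltr0n // mulrC -natrM ler_nat leq_divM.
- by rewrite lerXn2r ?nnegrE ?ler_succ_ln ?leq_div.
- by rewrite lerXn2r ?nnegrE ?ler_succ_ln ?leq_div.
Qed.

(** Each new prime changes the sum by [O(1 / (p (p - 1)))] times [dmain]. Written as a difference of
    inverses the bound passes through the induction on [t], and it never exceeds [C / N], whatever
    the ranges. *)
Lemma dsum_wt_tail (R : realType) h j k : (0 < h)%N ->
  exists2 C : R, 0 <= C & forall N t X Q, (h < N)%N ->
    `|dsum (wt R h j k.+1 (N.+1 + t)) X Q - dsum (wt R h j k.+1 N.+1) X Q| <=
      C * (N%:R^-1 - (N + t)%:R^-1) * dmain R k j X Q.
Proof.
move=> h_gt0; have [C0 C0_ge0 HC0] := dsum_wt_le R j k h_gt0.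
exists (j%:R * (1 + k.+1%:R) * C0) => [|N t X Q hN].
  by rewrite !mulr_ge0 // addr_ge0.
set C := _ * C0; have C_ge0 : 0 <= C by rewrite !mulr_ge0 // addr_ge0.
have n_ge0 := dmain_ge0 R k j X Q.
elim: t => [|t IH]; first by rewrite !addn0 !subrr normr0 mulr0 mul0r.
have Nt : (0 < N + t)%N by rewrite addn_gt0 (leq_ltn_trans _ hN).
rewrite !addnS addSn; set D1 := dsum _ _ _; set D0 := dsum _ _ _.
pose Dm := dsum (wt R h j k.+1 (N.+1 + t)) X Q.
rewrite (_ : D1 - D0 = (D1 - Dm) + (Dm - D0)); last by ring.
apply: le_trans (ler_normD _ _) _.
rewrite (_ : C * (N%:R^-1 - (N + t).+1%:R^-1) * _ =
  C * ((N + t)%:R^-1 - (N + t).+1%:R^-1) * dmain R k j X Q +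
  C * (N%:R^-1 - (N + t)%:R^-1) * dmain R k j X Q); last by ring.
apply: lerD IH; rewrite /D1 /Dm addSn -inv_mul_pred //.
set p := (N + t).+1.
have pR : 0 < p%:R :> R by rewrite ltr0n.
have p1R : 0 < p%:R - 1 :> R by rewrite subr_gt0 ltr1n ltnS.
have hp : (0 < h < p)%N by rewrite h_gt0 (ltn_trans hN) // ltnS leq_addr.
case: (boolP (prime p)) => p_pr; last first.
  rewrite (@eq_dsum _ _ (wt R h j k.+1 p)) => [|q m _ _]; last exact:
    wt_notprime.
  by rewrite subrr normr0 mulr_ge0 // mulr_ge0 // invr_ge0 mulr_ge0 // ltW.
apply: le_trans (dsum_wtS_diff _ _ _ _ _ p_pr hp) _.
have /andP[_ hp'] := hp.
have B1 := HC0 p X (Q %/ p)%N hp'; have B2 := HC0 p (X %/ p)%N (Q %/ p)%N hp'.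
have p_gt0 : (0 < p)%N by [].
have B3 : dsum (wt R h j k.+1 p) X (Q %/ p) <= C0 * dmain R k j X Q.
  by apply: le_trans B1 _; rewrite ler_wpM2l // ler_dmain // leq_div.
(* Weakening [1 / p] to [1 / (p - 1)] gives both contributions the denominator [p (p - 1)]. *)
have B4 : dsum (wt R h j k.+1 p) (X %/ p) (Q %/ p) <=
    C0 * ((p%:R - 1)^-1 * dmain R k j X Q).
  apply: le_trans B2 _; rewrite ler_wpM2l //.
  apply: le_trans (dmain_divn_le _ _ _ _ _ p_gt0) _; rewrite ler_wpM2r //.
  by rewrite lef_pV2 ?posrE // gerBl.
rewrite (_ : C / _ * _ = j%:R / (p%:R * (p%:R - 1)) * (C0 * dmain R k j X Q) +
   j%:R * k.+1%:R / p%:R * (C0 * ((p%:R - 1)^-1 * dmain R k j X Q))); last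
     first.
  by rewrite /C; field; rewrite !gt_eqF.
apply: lerD; first by rewrite ler_wpM2l // divr_ge0 // mulr_ge0 // ltW.
by rewrite ler_wpM2l // divr_ge0 ?mulr_ge0 // ltW.
Qed.

(** * Evaluation of the Euler factors *)

Definition divkp_series (R : realType) (k p n : nat) : R :=
  \sum_(0 <= b < n) divkp R k p b * p%:R^-1 ^+ b.

Lemma divkp_ge0 (R : realType) k p a : 0 <= divkp R k p a.
Proof. exact: ler0n. Qed.

(** Multiplication of the series by [1 - x] at [x = 1 / p], by Pascal's rule; the subtracted term is
    the boundary term of the truncation. *)
Lemma divkp_seriesS (R : realType) k p n : prime p ->
  divkp_series R k.+1 p n.+1 * (1 - p%:R^-1) =
  divkp_series R k p n.+1 - divkp R k.+1 p n * p%:R^-1 ^+ n.+1.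
Proof.
move=> p_pr; elim: n => [|n IHn].
  by rewrite /divkp_series !big_nat1 !divkpn0 !expr0 expr1 !mul1r.
rewrite /divkp_series big_nat_recr //= -/(divkp_series R k.+1 p n.+1) mulrDl
  IHn.
rewrite [in RHS]big_nat_recr //= -/(divkp_series R k p n.+1) divkpS //.
by rewrite !exprS; ring.
Qed.

Lemma divkp_series_le (R : realType) k p n : prime p ->
  divkp_series R k p n <= (1 - p%:R^-1) ^- k.
Proof.
move=> p_pr; have x_gt0 := onem_inv_gt0 R p_pr.
have r_ge0 : 0 <= p%:R^-1 :> R by rewrite invr_ge0.
elim: k n => [|k IHk] n.
  rewrite expr0 invr1 /divkp_series; case: n => [|n]; first by rewrite big_geq.
  rewrite big_nat_recl //= divkpn0 expr0 mulr1 big1 ?addr0 // => b _.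
  by rewrite divkp0 // mul0r.
case: n => [|n]; first by rewrite /divkp_series big_geq // invr_ge0 exprn_ge0
  // ltW.
rewrite exprSr invfM -ler_pdivrMr ?invr_gt0 // invrK divkp_seriesS //.
apply: le_trans (IHk n.+1); by rewrite gerBl mulr_ge0 ?divkp_ge0 // exprn_ge0.
Qed.

Lemma is_cvg_divkp_series (R : realType) k p : prime p ->
  cvgn (divkp_series R k p).
Proof.
move=> p_pr; apply: nondecreasing_is_cvgn.
  apply/nondecreasing_seqP => n; rewrite /divkp_series big_nat_recr //= lerDl.
  by rewrite mulr_ge0 ?divkp_ge0 // exprn_ge0 // invr_ge0.
exists ((1 - p%:R^-1) ^- k) => _ [n _ <-]; exact: divkp_series_le.
Qed.

(** The limit is found by induction on [k]. Convergence, known beforehand by monotonicity, makes the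
    boundary term vanish, as it is a general term of the series divided by [p]. *)
Lemma cvg_divkp_series (R : realType) k p : prime p ->
  divkp_series R k p n @[n --> \oo] --> ((1 - p%:R^-1) ^- k : R).
Proof.
move=> p_pr; have x_gt0 := onem_inv_gt0 R p_pr.
elim: k => [|k IHk].
  rewrite expr0 invr1; apply: cvg_near_cst; near=> n.
  have n_gt0 : (0 < n)%N by near: n; exact: nbhs_infty_gt.
  rewrite /divkp_series big_ltn // divkpn0 expr0 mulr1 big_nat_cond big1 ?addr0
    //.
  move=> b /andP[/andP[b_gt0 _] _].
  by rewrite divkp0 // gtn_eqF // mul0r.
have term0 : divkp R k.+1 p n * p%:R^-1 ^+ n @[n --> \oo] --> (0 : R).
  apply: cvg_series_cvg_0; exact: is_cvg_divkp_series.
suff : divkp_series R k.+1 p n.+1 @[n --> \oo] --> ((1 - p%:R^-1) ^- k.+1 : R).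
  by rewrite (cvg_shiftS (divkp_series R k.+1 p)).
have -> : (fun n => divkp_series R k.+1 p n.+1) = (fun n =>
    (divkp_series R k p n.+1 - divkp R k.+1 p n * p%:R^-1 ^+ n * p%:R^-1) *
    (1 - p%:R^-1)^-1).
  apply/funext => n; rewrite -mulrA -exprSr -divkp_seriesS //.
  by rewrite mulfK // gt_eqF.
have -> : (1 - p%:R^-1) ^- k.+1 =
    ((1 - p%:R^-1) ^- k - 0 * p%:R^-1) * (1 - p%:R^-1)^-1 :> R.
  by rewrite exprSr invfM mul0r subr0.
apply: cvgMr_tmp; apply: cvgB; last exact: cvgMr_tmp.
by rewrite (cvg_shiftS (divkp_series R k p)).
Unshelve. all: by end_near. Qed.

Lemma divkp_series_tail (R : realType) k p a : prime p ->
  \big[+%R/0]_(a <= b <oo) ((divk k (p ^ b))%:R / p%:R ^+ b : R) =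
  (1 - p%:R^-1) ^- k - divkp_series R k p a.
Proof.
move=> p_pr; apply: cvg_lim => //.
have H : divkp_series R k p n - divkp_series R k p a @[n --> \oo] -->
    ((1 - p%:R^-1) ^- k - divkp_series R k p a : R).
  by apply: cvgB; [exact: cvg_divkp_series | exact: cvg_cst].
apply: cvg_trans H; apply: near_eq_cvg; near=> n.
have an : (a <= n)%N by near: n; exact: nbhs_infty_ge.
rewrite /divkp_series [X in X - _](big_cat_nat (n := a)) //= addrAC subrr add0r.
by apply: eq_bigr => b _; rewrite exprVn.
Unshelve. all: by end_near. Qed.

(** The Euler factor of [C_const R k.+1 j.+1]. With [u] and [v] the powers of exponents [j] and [k]
    it equals [1 - (1 - u) (1 - v)], the form behind the bounds below. *)
Definition C_factor (R : realType) (j k p : nat) : R :=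
  (1 - p%:R^-1) ^+ j + (1 - p%:R^-1) ^+ k - (1 - p%:R^-1) ^+ (k + j).

(** The second factor is the denominator of [f_factor R k.+1 j.+1], so multiplying by [C_factor]
    clears it. *)
Lemma C_factor_denom (R : realType) j k p : prime p ->
  C_factor R j k p =
  (1 - p%:R^-1) ^+ (k + j) * ((1 - p%:R^-1) ^- k + (1 - p%:R^-1) ^- j - 1).
Proof.
move=> p_pr; have x_gt0 := onem_inv_gt0 R p_pr; rewrite /C_factor exprD.
set x := 1 - _ in x_gt0 *.
by field; rewrite !expf_neq0 // gt_eqF.
Qed.

Lemma local_mean_nondiv (R : realType) j k p : prime p ->
  local_mean R j k.+1 p 0 = C_factor R j k p.
Proof.
move=> p_pr; have x_gt0 := onem_inv_gt0 R p_pr; rewrite /local_mean /C_factor.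
rewrite !big_nat1 big_geq // !divkpn0 !expr0 exprS exprD.
set x := 1 - _ in x_gt0 *.
by field; rewrite gt_eqF.
Qed.

(** Each infinite inner sum of [f_factor] is its closed total minus a partial sum, which is the
    shape of [local_mean]; the powers of [p] cancel and a field identity remains. *)
Lemma local_mean_f_factor (R : realType) j k p g : prime p ->
  C_factor R j k p != 0 ->
  local_mean R j k.+1 p g = C_factor R j k p * f_factor R k.+1 j.+1 p g.
Proof.
move=> p_pr; have x_gt0 := onem_inv_gt0 R p_pr.
have p_neq0 : p%:R != 0 :> R by rewrite pnatr_eq0 -lt0n prime_gt0.
move=> C_neq0; have := C_neq0.
rewrite C_factor_denom // mulf_eq0 negb_or => /andP[_ den_neq0].
rewrite /f_factor /= divkp_series_tail //.
under [in RHS]eq_bigr do rewrite divkp_series_tail //.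
rewrite /local_mean.
have E1 s : divkp R j p s * p%:R ^+ s *
     ((1 - p%:R^-1) ^+ j * p%:R^-1 ^+ s -
      \sum_(0 <= t < s) divkp R k.+1 p t *
        ((1 - p%:R^-1) ^+ j * p%:R^-1 ^+ s * (1 - p%:R^-1) ^+ k.+1 * p%:R^-1 ^+
          t)) =
   (1 - p%:R^-1) ^+ (k + j) * (1 - p%:R^-1) * (divkp R j p s *
     ((1 - p%:R^-1) ^- k.+1 - divkp_series R k.+1 p s)).
  have -> : \sum_(0 <= t < s) divkp R k.+1 p t *
        ((1 - p%:R^-1) ^+ j * p%:R^-1 ^+ s * (1 - p%:R^-1) ^+ k.+1 * p%:R^-1 ^+
          t) =
      (1 - p%:R^-1) ^+ j * p%:R^-1 ^+ s * (1 - p%:R^-1) ^+ k.+1 *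
      divkp_series R k.+1 p s.
    by rewrite mulr_sumr; apply: eq_bigr => t _; ring.
  rewrite exprS exprD exprVn; set x := 1 - _ in x_gt0 *.
  by field; rewrite ?expf_neq0 // ?gt_eqF.
rewrite (eq_bigr _ (fun s _ => E1 s)).
rewrite -mulr_sumr.
have -> : \sum_(0 <= s < g.+1) divkp R j p s *
        ((1 - p%:R^-1) ^+ k.+1 * p%:R^-1 ^+ g * (1 - p%:R^-1) ^+ j * p%:R^-1 ^+
          s) =
   (1 - p%:R^-1) ^+ k.+1 * p%:R^-1 ^+ g * (1 - p%:R^-1) ^+ j *
   divkp_series R j p g.+1.
  by rewrite mulr_sumr; apply: eq_bigr => s _; ring.
rewrite -/(divkp R k.+1 p g).
set S1 := \sum_(_ <= _ < _) _; set S2 := divkp_series _ _ _ _.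
move: C_neq0 den_neq0; rewrite /C_factor exprS exprD exprVn; set x := 1 - _ in
  x_gt0 *.
move=> C_neq0 den_neq0; field.
by rewrite mulN1r C_neq0 !expf_neq0 // ?gt_eqF.
Qed.

Lemma onem_expr_bounds (R : realType) j p : prime p ->
  0 < (1 - p%:R^-1 : R) ^+ j <= 1.
Proof.
move=> p_pr; have x_gt0 := onem_inv_gt0 R p_pr; rewrite exprn_gt0 //=.
by rewrite exprn_ile1 ?(ltW x_gt0) // gerBl invr_ge0.
Qed.

Lemma C_factor_bounds (R : realType) j k p : prime p ->
  0 < C_factor R j k p <= 1.
Proof.
move=> p_pr; rewrite /C_factor exprD.
have /andP[a0 a1] := onem_expr_bounds R j p_pr.
have /andP[b0 b1] := onem_expr_bounds R k p_pr.
set a := _ ^+ j in a0 a1 *; set b := _ ^+ k in b0 b1 *.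
by apply/andP; split; nra.
Qed.

(** By Bernoulli's inequality [1 - (1 - 1 / p) ^ i <= i / p], so the factor falls short of [1] by at
    most [j k / p ^ 2], then weakened to a telescoping denominator. *)
Lemma C_factor_ge (R : realType) j k p : prime p ->
  1 - (j * k)%:R / (p%:R * (p%:R - 1)) <= C_factor R j k p.
Proof.
move=> p_pr; have x_gt0 := onem_inv_gt0 R p_pr.
have pR : 0 < p%:R :> R by rewrite ltr0n prime_gt0.
have p1R : 0 < p%:R - 1 :> R by rewrite subr_gt0 ltr1n prime_gt1.
have bern i : 1 - (1 - p%:R^-1) ^+ i <= i%:R / p%:R :> R.
  case: i => [|i]; first by rewrite expr0 subrr mul0r.
  have : 0 <= (1 - p%:R^-1 : R) <= 1.
    by rewrite (ltW x_gt0) /= gerBl invr_ge0.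
  move=> /(exprB_le i); rewrite !expr1n mulr1.
  by rewrite (_ : 1 - (1 - p%:R^-1) = p%:R^-1) //; ring.
have nn i : 0 <= 1 - (1 - p%:R^-1) ^+ i :> R.
  by rewrite subr_ge0; case/andP: (onem_expr_bounds R i p_pr).
rewrite [leRHS](_ : _ = 1 - (1 - (1 - p%:R^-1) ^+ j) * (1 - (1 - p%:R^-1) ^+
  k)).
  rewrite lerD2l lerN2; apply: le_trans (ler_pM (nn j) (nn k) (bern j) (bern
    k)) _.
  rewrite mulf_div -natrM ler_wpM2l // lef_pV2 ?posrE ?mulr_gt0 //.
  by rewrite ler_wpM2l ?(ltW pR) // gerBl.
by rewrite /C_factor exprD; ring.
Qed.

Lemma f_factor_gt0 (R : realType) j k p g : prime p ->
  0 < f_factor R k.+1 j.+1 p g.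
Proof.
move=> p_pr; have x_gt0 := onem_inv_gt0 R p_pr.
rewrite /f_factor /= divkp_series_tail //.
under eq_bigr do rewrite divkp_series_tail //.
have tail_ge0 i a : 0 <= (1 - p%:R^-1) ^- i - divkp_series R i p a.
  by rewrite subr_ge0 divkp_series_le.
apply: divr_gt0; last first.
  have ge1 i : 1 <= (1 - p%:R^-1) ^- i :> R.
    by have /andP[a0 a1] := onem_expr_bounds R i p_pr; rewrite invf_ge1.
  by have := ge1 k; have := ge1 j; lra.
apply: ltr_wpDr; first by rewrite mulr_ge0.
rewrite mulr_gt0 // big_ltn // ltr_wpDr //; first by rewrite sumr_ge0 // => i
  _; rewrite mulr_ge0.
by rewrite expn0 divkn1 mul1r /divkp_series big_geq // subr0 invr_gt0 exprn_gt0.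
Qed.

Definition C_partial (R : realType) (j k n : nat) : R :=
  \prod_(0 <= p < n | prime p) C_factor R j k p.

Lemma C_partialS (R : realType) j k n :
  C_partial R j k n.+1 =
  C_partial R j k n * (if prime n then C_factor R j k n else 1).
Proof. by rewrite /C_partial big_mkcond big_nat_recr //= -big_mkcond. Qed.

Lemma C_partial_gt0 (R : realType) j k n : 0 < C_partial R j k n.
Proof.
by rewrite prodr_gt0 // => p p_pr; case/andP: (C_factor_bounds R j k p_pr).
Qed.

(** A product of factors [1 - e] is at least [1] minus the sum of the [e]. This sum telescopes, and
    [M >= 2 j k] keeps it at most [1 / 2]. *)
Lemma C_partial_ge (R : realType) j k M t : (0 < M)%N ->
  ((2 * (j * k))%:R <= M%:R :> R) ->
  C_partial R j k M.+1 * (1 - (j * k)%:R * (M%:R^-1 - (M + t)%:R^-1)) <=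
  C_partial R j k (M.+1 + t).
Proof.
move=> M_gt0 M_ge; have c_gt0 := C_partial_gt0 R j k.
elim: t => [|t IHt]; first by rewrite !addn0 subrr mulr0 subr0 mulr1.
have Mt : (0 < M + t)%N by rewrite addn_gt0 M_gt0.
rewrite addSn in IHt; rewrite !addnS addSn [leRHS]C_partialS.
set S := (j * k)%:R * (M%:R^-1 - (M + t)%:R^-1) in IHt *.
have jk0 : 0 <= (j * k)%:R :> R by [].
have S_ge0 : 0 <= S.
  by rewrite mulr_ge0 // subr_ge0 lef_pV2 ?posrE ?ltr0n // ler_nat leq_addr.
pose e : R := (j * k)%:R * ((M + t)%:R^-1 - (M + t).+1%:R^-1).
have e_ge0 : 0 <= e.
  by rewrite mulr_ge0 // subr_ge0 lef_pV2 ?posrE ?ltr0n // ler_nat.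
have -> : (j * k)%:R * (M%:R^-1 - (M + t).+1%:R^-1) = S + e.
  by rewrite /S /e; ring.
have MR : 0 < M%:R :> R by rewrite ltr0n.
have S_le : S <= 2^-1.
  apply: le_trans (_ : (j * k)%:R * M%:R^-1 <= _).
    by rewrite ler_wpM2l // gerBl invr_ge0.
  rewrite ler_pdivrMr // ler_pdivlMl //; move: M_ge; rewrite natrM => M_ge; lra.
have fac : 1 - e <= (if prime (M + t).+1 then C_factor R j k (M + t).+1 else 1).
  case: ifP => p_pr; last by rewrite gerBl.
  apply: le_trans (C_factor_ge R j k p_pr).
  by rewrite /e inv_mul_pred.
have fac0 : 0 <= (if prime (M + t).+1 then C_factor R j k (M + t).+1 else 1).
  by case: ifP => // p_pr; case/andP: (C_factor_bounds R j k p_pr) => /ltW.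
apply: le_trans (_ : C_partial R j k M.+1 * (1 - S) *
    (if prime (M + t).+1 then C_factor R j k (M + t).+1 else 1) <= _); last
      first.
  by rewrite ler_wpM2r.
rewrite -mulrA ler_wpM2l ?(ltW (c_gt0 _)) //.
apply: le_trans (_ : (1 - S) * (1 - e) <= _); first by nra.
by rewrite ler_wpM2l //; lra.
Qed.

(** All factors lie in [(0, 1]], so the partial products decrease to a limit; from [M] on they keep
    at least half of their value, whence positivity. *)
Lemma C_const_limit (R : realType) j k :
  C_partial R j k n @[n --> \oo] --> C_const R k.+1 j.+1 /\
  0 < C_const R k.+1 j.+1.
Proof.
have EC : C_const R k.+1 j.+1 = limn (C_partial R j k).
  rewrite /C_const /C_partial; congr (limn _); apply/funext => n.
  by apply: eq_bigr => p _; rewrite /C_factor addSn addnS !subSS subn0.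
have c_cvg : cvgn (C_partial R j k).
  apply: nonincreasing_is_cvgn.
    apply/nonincreasing_seqP => n; rewrite C_partialS ler_piMr //.
      exact: ltW (C_partial_gt0 _ _ _ _).
    by case: ifP => // p_pr; case/andP: (C_factor_bounds R j k p_pr).
  by exists 0 => _ [n _ <-]; exact: ltW (C_partial_gt0 _ _ _ _).
rewrite EC; split=> //.
pose M := (2 * (j * k)).+1.
have M_ge : (2 * (j * k))%:R <= M%:R :> R by rewrite ler_nat.
apply: lt_le_trans (_ : C_partial R j k M.+1 * 2^-1 <= _).
  by rewrite mulr_gt0 ?C_partial_gt0.
apply: limr_ge => //; near=> n.
have Mn : (M.+1 <= n)%N by near: n; exact: nbhs_infty_ge.
rewrite -(subnKC Mn); apply: le_trans (C_partial_ge _ _ M_ge) => //.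
rewrite ler_wpM2l ?(ltW (C_partial_gt0 _ _ _ _)) //.
set t := (n - M.+1)%N.
have : (j * k)%:R * (M%:R^-1 - (M + t)%:R^-1) <= 2^-1 :> R.
  apply: le_trans (_ : (j * k)%:R * M%:R^-1 <= _).
    by rewrite ler_wpM2l // gerBl invr_ge0.
  rewrite ler_pdivrMr ?ltr0n // ler_pdivlMl //; move: M_ge; rewrite natrM; lra.
lra.
Unshelve. all: by end_near. Qed.

Lemma f_const_gt0 (R : realType) j k h : 0 < f_const R k.+1 j.+1 h.
Proof.
rewrite /f_const big_seq prodr_gt0 // => p; rewrite mem_primes => /and3P[p_pr _
  _].
exact: f_factor_gt0.
Qed.

Lemma local_mean_prod (R : realType) j k h N : (0 < h < N)%N ->
  \prod_(0 <= p < N | prime p) local_mean R j k.+1 p (logn p h) =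
  C_partial R j k N * f_const R k.+1 j.+1 h.
Proof.
case/andP=> h_gt0 hN.
have -> : f_const R k.+1 j.+1 h =
    \prod_(0 <= p < N | prime p)
      (if (p %| h)%N then f_factor R k.+1 j.+1 p (logn p h) else 1).
  rewrite -big_mkcondr /f_const -[RHS]big_filter; apply: perm_big.
  apply: uniq_perm; rewrite ?primes_uniq ?filter_uniq ?iota_uniq // => p.
  rewrite mem_filter mem_primes mem_index_iota h_gt0 /=.
  case: (prime p) => //=; case: (boolP (p %| h)%N) => //= ph.
  by rewrite (leq_ltn_trans (dvdn_leq _ ph) hN).
rewrite -big_split; apply: eq_bigr => p p_pr /=.
have C_neq0 : C_factor R j k p != 0.
  by case/andP: (C_factor_bounds R j k p_pr) => c0 _; rewrite gt_eqF.
case: ifP => ph; first by rewrite local_mean_f_factor.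
by rewrite mulr1 lognE p_pr h_gt0 ph local_mean_nondiv.
Qed.

(** * The full weight *)

Definition wt_gcd (R : realType) (h j k q m : nat) : R :=
  (gcdn m q == gcdn h q)%:R * (divk j q)%:R * (divk k m)%:R /
  (totient (q %/ gcdn h q))%:R.

(** The exponent of [p] in a gcd is a minimum of exponents; in these terms [kap] can be multiplied
    over the primes. *)
Lemma kapE (R : realType) p g a b : prime p ->
  kap R p g a b = (minn b a == minn g a)%:R * (p ^ a)%:R /
    (totient (p ^ (a - minn g a)))%:R.
Proof.
move=> p_pr; have p1R : p%:R - 1 != 0 :> R.
  by rewrite subr_eq0 gt_eqF // ltr1n prime_gt1.
have pR : p%:R != 0 :> R by rewrite pnatr_eq0 -lt0n prime_gt0.
rewrite /kap natrX; case: leqP => ag.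
  rewrite subnn expn0 (_ : totient 1 = 1%N) // divr1; case: leqP => ab.
    by rewrite eqxx mul1r.
  by rewrite ltn_eqF // mul0r.
have -> : (minn b a == g) = (b == g).
  by rewrite /minn; case: ltnP => // ab; rewrite !gtn_eqF // (leq_trans ag).
case: eqP => _; last by rewrite !mul0r.
have [t Et] : exists t, (a - g = t.+1)%N.
  by exists (a - g).-1; rewrite prednK // subn_gt0.
rewrite Et totient_pfactor // natrM natrX -(subnK (ltnW ag)) Et exprD mul1r.
rewrite /= -subn1 natrB ?prime_gt0 // exprS.
by field; rewrite pR p1R expf_neq0.
Qed.

Lemma prod_prime_powers n N : (0 < n < N)%N ->
  (\prod_(0 <= p < N | prime p) p ^ logn p n)%N = n.
Proof.
case/andP=> n_gt0 nN; case: N nN => // N nN.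
rewrite -[RHS](partnT n_gt0) (@widen_partn N) // [RHS]big_mkcond
  [LHS]big_mkcond.
apply: eq_bigr => p _ /=; case: ifP => // /negbT npr.
by rewrite lognE (negPf npr) expn0.
Qed.

Lemma prod_prime_coprime (e : nat -> nat) N c : prime N ->
  coprime (\prod_(0 <= p < N | prime p) p ^ e p)%N (N ^ c).
Proof.
move=> N_pr; rewrite big_nat_cond; apply: (big_ind (fun x => coprime x (N ^
  c))) => [|a b ca cb|p].
- exact: coprime1n.
- by rewrite coprimeMl ca.
case/andP=> /andP[_ pN] p_pr; rewrite coprimeXl // coprimeXr //.
by rewrite prime_coprime // dvdn_prime2 // neq_ltn pN.
Qed.

Lemma prod_prime_mult (R : realType) (f : nat -> nat) (e : nat -> nat) N :
  f 1%N = 1%N ->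
  (forall m n, coprime m n -> f (m * n)%N = (f m * f n)%N) ->
  \prod_(0 <= p < N | prime p) (f (p ^ e p)%N)%:R =
  (f (\prod_(0 <= p < N | prime p) p ^ e p)%N)%:R :> R.
Proof.
move=> f1 fM; elim: N => [|N IH]; first by rewrite !big_geq // f1.
rewrite big_mkcond big_nat_recr //= -big_mkcond IH.
rewrite [in RHS]big_mkcond big_nat_recr //= -big_mkcond.
case: ifP => p_pr; last by rewrite mulr1 muln1.
by rewrite fM ?natrM // prod_prime_coprime.
Qed.

Lemma prod_gcd_eq (R : realType) h q m N : (0 < q < N)%N -> (0 < h)%N ->
  (0 < m)%N ->
  \prod_(0 <= p < N | prime p)
    (minn (logn p m) (logn p q) == minn (logn p h) (logn p q))%:R =
  (gcdn m q == gcdn h q)%:R :> R.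
Proof.
case/andP=> q_gt0 qN h_gt0 m_gt0; case: eqP => [E|ne].
  apply: big1 => p _; rewrite -!logn_gcd // E eqxx //.
pose P p := prime p ==>
  (minn (logn p m) (logn p q) == minn (logn p h) (logn p q)).
case: (boolP (all P (index_iota 0 N))) => [/allP allp|/allPn[p pN]].
  case: ne; apply: eqn_from_log; rewrite ?gcdn_gt0 ?q_gt0 ?orbT // => p.
  rewrite /= !logn_gcd //; case: (boolP (prime p)) => [p_pr|npr].
    case: (ltnP p N) => pN.
      have := allp p; rewrite mem_index_iota /P p_pr => /(_ pN) /eqP; exact.
    have -> : logn p q = 0%N.
      by rewrite lognE p_pr q_gt0 gtnNdvd // (leq_trans qN).
    by rewrite !minn0.
  by rewrite /logn (negPf npr).
rewrite /P negb_imply => /andP[p_pr nep].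
rewrite -big_filter (bigD1_seq p) ?filter_uniq ?iota_uniq ?mem_filter ?p_pr //=.
by rewrite (negPf nep) mul0r.
Qed.

(** Primes from [N] on do not divide [q], so their gcd condition is void and their totient factor is
    [1]. *)
Lemma wt_gcdE (R : realType) h j k N q m : (0 < q < N)%N -> (0 < h)%N ->
  (0 < m)%N -> wt R h j k N q m = wt_gcd R h j k q m.
Proof.
move=> qN h_gt0 m_gt0; have /andP[q_gt0 q_lt] := qN; rewrite /wt.
have g_gt0 : (0 < gcdn h q)%N by rewrite gcdn_gt0 h_gt0.
have qg_gt0 : (0 < q %/ gcdn h q)%N.
  by rewrite divn_gt0 // dvdn_leq // dvdn_gcdr.
have -> : \prod_(0 <= p < N | prime p)
      kap R p (logn p h) (logn p q) (logn p m) =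
    \prod_(0 <= p < N | prime p)
      ((minn (logn p m) (logn p q) == minn (logn p h) (logn p q))%:R *
       (p ^ logn p q)%:R / (totient (p ^ logn p (q %/ gcdn h q)))%:R).
  apply: eq_bigr => p p_pr.
  by rewrite kapE // logn_div ?dvdn_gcdr // logn_gcd.
rewrite big_split prodfV big_split /= prod_gcd_eq //.
rewrite (@prod_prime_mult _ id) // (@prod_prime_mult _ totient) //; last first.
  exact: totient_coprime.
rewrite !prod_prime_powers //; last first.
  by rewrite qg_gt0 (leq_ltn_trans (leq_div _ _)).
have q_neq0 : q%:R != 0 :> R by rewrite pnatr_eq0 -lt0n.
have t_neq0 : (totient (q %/ gcdn h q))%:R != 0 :> R.
  by rewrite pnatr_eq0 -lt0n totient_gt0.
by rewrite /wt_gcd; field; rewrite q_neq0 t_neq0.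
Qed.

Lemma dsum_wt_gcd (R : realType) h j k N X Q : (0 < h)%N -> (Q < N)%N ->
  dsum (wt_gcd R h j k) X Q = dsum (wt R h j k N) X Q.
Proof.
move=> h_gt0 QN; apply: eq_dsum => q m /andP[q_gt0 qQ] /andP[m_gt0 _].
by rewrite (@wt_gcdE _ _ _ _ N) // q_gt0 (leq_ltn_trans qQ).
Qed.

Lemma wt_gcd_ge0 (R : realType) h j k q m : 0 <= wt_gcd R h j k q m.
Proof. by rewrite /wt_gcd divr_ge0 // !mulr_ge0. Qed.

Lemma dsum_wt_gcd_le (R : realType) h j k : (0 < h)%N ->
  exists2 C : R, 0 <= C & forall X Q,
    dsum (wt_gcd R h j k.+1) X Q <= C * dmain R k j X Q.
Proof.
move=> h_gt0; have [C C_ge0 HC] := dsum_wt_le R j k h_gt0.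
exists C => // X Q; rewrite (@dsum_wt_gcd _ _ _ _ (maxn h Q).+1) //.
  by apply: HC; rewrite ltnS leq_maxl.
by rewrite ltnS leq_maxr.
Qed.

(** The exchange of limits: one fixed [N] makes both the tail, uniformly in the ranges, and the
    error in the truncated constant at most [e / 3]; only then do the ranges grow. *)
Lemma dlim_wt_gcd (R : realType) h j k : (0 < h)%N ->
  dlim k j (wt_gcd R h j k.+1)
    (C_const R k.+1 j.+1 * f_const R k.+1 j.+1 h / (k`!%:R * j`!%:R)).
Proof.
move=> h_gt0; have [C C_ge0 HC] := dsum_wt_tail R j k h_gt0.
set c := _ / _.
pose cN N : R := (j`!%:R * k`!%:R)^-1 * (C_partial R j k N * f_const R k.+1
  j.+1 h).
have cN_cvg : cN N.+1 @[N --> \oo] --> c.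
  rewrite (cvg_shiftS cN) /c mulrC [k`!%:R * _]mulrC /cN.
  apply: cvgMl_tmp; apply: cvgMr_tmp.
  by have [] := C_const_limit R j k.
apply/cvgrPdist_le => e e_gt0; have e3 : 0 < e / 3 by rewrite divr_gt0.
have [N [hN CN cNe]] : exists N, [/\ (h < N)%N, C * N%:R^-1 <= e / 3 &
    `|c - cN N.+1| <= e / 3].
  have H1 : \forall N \near \oo, C * N%:R^-1 <= e / 3.
    have : C * N%:R^-1 @[N --> \oo] --> (0 : R).
      by rewrite -[X in _ --> X](mulr0 C); apply: cvgMl_tmp; exact:
        cvg_natr_inv.
    move=> /cvgrPdist_le /(_ _ e3); apply: filterS => N.
    by rewrite sub0r normrN ger0_norm // mulr_ge0 ?invr_ge0.
  near \oo => N; exists N; split; near: N => //.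
  by move/cvgrPdist_le: cN_cvg => /(_ _ e3).
have lim_N := @dlim_wt R h j k N.+1.
rewrite local_mean_prod in lim_N; last by rewrite h_gt0 ltnW.
have c1 : z.1 @[z --> filter_prod \oo \oo] --> \oo by exact: cvg_fst.
move/cvgrPdist_le: lim_N => /(_ _ e3) lim_N.
near=> z.
have X_gt0 : (0 < z.1)%N by near: z; exact: (c1 _ (nbhs_infty_gt 0)).
have m_gt0 := dmain_gt0 R k j z.2 X_gt0.
set A := _ / _; pose B := dsum (wt R h j k.+1 N.+1) z.1 z.2 / dmain R k j z.1
  z.2.
have -> : c - A = (c - cN N.+1) + (cN N.+1 - B) + (B - A) by ring.
have -> : e = e / 3 + e / 3 + e / 3 by field.
apply: le_trans (ler_normD _ _) _; apply: lerD.
  apply: le_trans (ler_normD _ _) _; apply: lerD => //.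
  by rewrite /B; near: z; exact: lim_N.
apply: le_trans CN; rewrite distrC /A /B -mulrBl normrM [`|_^-1|]ger0_norm;
  last first.
  by rewrite invr_ge0 ltW.
(* The truncation level depends on the ranges and exceeds [Q = z.2], so the truncated weight is the
   full one; the tail bound does not depend on it. *)
rewrite ler_pdivrMr // (@dsum_wt_gcd _ _ _ _ (N.+1 + z.2)) //; last first.
  by rewrite addSn ltnS leq_addl.
apply: le_trans (HC _ _ _ _ hN) _; rewrite ler_wpM2r ?(ltW m_gt0) //.
by rewrite ler_wpM2l // gerBl invr_ge0.
Unshelve. all: by end_near. Qed.

(** * Removing the residue *)

(** Multiplying by the highest power of [t] isolates the top coefficient up to [O(t)], so it is
    zero; induction on the order of the pole removes the others. *)
Lemma principal_part_unique (F : numFieldType) n (c : nat -> F) (K d : F) :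
  0 < d ->
  (forall t, 0 < t -> t < d -> `|\sum_(j < n) c j / t ^+ j.+1| <= K) ->
  forall j, (j < n)%N -> c j = 0.
Proof.
move=> d_gt0; elim: n c K => // n IHn c K cK.
have d2 : 0 < d / 2 by rewrite divr_gt0.
have K_ge0 : 0 <= K.
  by apply: le_trans (cK _ d2 _); rewrite // ltr_pdivrMr // ltr_pMr // ltr1n.
pose M := K + \sum_(j < n) `|c j|.
have M_ge0 : 0 <= M by rewrite addr_ge0 // sumr_ge0.
have bound t : 0 < t -> t < d -> t <= 1 -> `|c n| <= t * M.
  move=> t_gt0 td t1; have t_neq0 : t != 0 by rewrite gt_eqF.
  have -> : c n = t ^+ n.+1 * (\sum_(j < n.+1) c j / t ^+ j.+1) -
                  \sum_(j < n) t ^+ (n - j) * c j.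
    rewrite big_ord_recr /= mulrDr [t ^+ n.+1 * (c n / _)]mulrCA divff
      ?expf_neq0 //.
    rewrite mulr1 mulr_sumr addrAC -[LHS]add0r; congr (_ + _).
    apply/esym/eqP; rewrite subr_eq0; apply/eqP; apply: eq_bigr => j _.
    have -> : n.+1 = (n - j + j.+1)%N by rewrite addnS subnK // ltnW.
    by rewrite exprD -mulrA; congr (_ * _); rewrite mulrC divfK // expf_neq0.
  apply: le_trans (ler_normB _ _) _; rewrite /M mulrDr; apply: lerD.
    rewrite normrM ger0_norm ?exprn_ge0 ?(ltW t_gt0) //.
    apply: ler_pM; rewrite ?exprn_ge0 ?(ltW t_gt0) //; last exact: cK.
    by rewrite exprS ler_piMr ?(ltW t_gt0) // exprn_ile1 // ltW.
  apply: le_trans (ler_norm_sum _ _ _) _; rewrite mulr_sumr; apply: ler_sum =>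
    j _.
  rewrite normrM ler_wpM2r // ger0_norm ?exprn_ge0 ?(ltW t_gt0) //.
  by rewrite -(subnSK (ltn_ord j)) exprS ler_piMr ?(ltW t_gt0) // exprn_ile1 //
    ltW.
have cn0 : c n = 0.
  apply/eqP; case: (eqVneq (c n) 0) => // cn_neq0.
  have u_gt0 : 0 < `|c n| by rewrite normr_gt0.
  set u := `|c n| in u_gt0 bound.
  have uM : 0 < u + M by rewrite ltr_wpDr.
  have d1 : 0 < 1 + d by rewrite addr_gt0.
  (* [d / (1 + d)] is below both [1] and [d], and [u / (u + M)] keeps [t * M] below [u], against
     [bound]. *)
  pose t := d / (1 + d) * (u / (u + M)).
  have ratio_le1 : u / (u + M) <= 1 by rewrite ler_pdivrMr // mul1r lerDl.
  have dd_lt1 : d / (1 + d) < 1 by rewrite ltr_pdivrMr // mul1r ltrDr.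
  have dd_gt0 : 0 < d / (1 + d) by rewrite divr_gt0.
  have t_gt0 : 0 < t by rewrite mulr_gt0 // divr_gt0.
  have t_le : t <= d / (1 + d) by rewrite /t ler_piMr // ltW.
  have td : t < d.
    by apply: le_lt_trans t_le _; rewrite ltr_pdivrMr // ltr_pMr // ltrDl.
  have := bound t t_gt0 td (ltW (le_lt_trans t_le dd_lt1)).
  have tM : t * M < u.
    apply: le_lt_trans (_ : d / (1 + d) * u < u); last by rewrite gtr_pMl.
    rewrite /t -mulrA ler_wpM2l ?(ltW dd_gt0) // mulrAC ler_pdivrMr //.
    by rewrite ler_wpM2l ?(ltW u_gt0) // lerDr ltW.
  by move=> /le_lt_trans /(_ tM); rewrite ltxx.
move=> j; rewrite ltnS leq_eqVlt => /orP[/eqP -> //|].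
apply: (IHn c K) => t t_gt0 td; have := cK t t_gt0 td.
by rewrite big_ord_recr /= cn0 mul0r addr0.
Qed.

(** Both continuations agree with the Dirichlet series at [s = 1 + t] for small [t > 0]. Along this
    ray the difference of the principal parts is [H2 - H1], which is bounded near [1]. *)
Lemma main_residue_unique (R : realType) k q g (x : R) r1 r2 :
  is_main_residue k q g x r1 -> is_main_residue k q g x r2 -> r1 = r2.
Proof.
case=> D1 nD1 [N1 [a1 [H1 [rho1 [rho1_gt0 hol1 E1 ->]]]]].
case=> D2 nD2 [N2 [a2 [H2 [rho2 [rho2_gt0 hol2 E2 ->]]]]].
have bound_near (H : cplx R -> cplx R) (rho : R) : 0 < rho ->
    holomorphic_on [set z | `|z - 1| < rho%:C%C] H ->
    \forall z \near (1 : cplx R), `|H z| <= `|H 1| + 1.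
  move=> rho_gt0 hol.
  have der : derivable H 1 1 by apply: hol; rewrite /= subrr normr0 ltcR.
  have cont : {for 1, continuous H}.
    by apply: differentiable_continuous; exact/derivable1_diffP.
  move/cvgrPdist_le: cont => /(_ 1 ltr01); apply: filterS => z Hz.
  rewrite -[H z](subrK (H 1)) addrC (le_trans (ler_normD _ _)) // lerD2l.
  by rewrite distrC.
have nb : \forall z \near (1 : cplx R),
    [/\ 1 < complex.Re z -> D1 z = dirichlet k q g z,
       1 < complex.Re z -> D2 z = dirichlet k q g z,
       `|H1 z| <= `|H1 1| + 1 & `|H2 z| <= `|H2 1| + 1].
  near=> z; split; near: z => //; first exact: bound_near rho1_gt0 hol1.
  exact: bound_near rho2_gt0 hol2.
case/nbhs_ballP: nb => d /= d_gt0 nbhd.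
(* The principal parts may differ in length; both are padded with zeros. *)
pose c j := (if (j <= N1)%N then a1 j else 0) - (if (j <= N2)%N then a2 j else
  0).
pose n := (maxn N1 N2).+1.
have pad (N : nat) (a : nat -> R[i]) t : (N <= maxn N1 N2)%N ->
    \sum_(j < N.+1) a j / t ^+ j.+1 =
    \sum_(j < n) (if (j <= N)%N then a j else 0) / t ^+ j.+1.
  move=> Nn; rewrite (big_ord_widen n (fun j => a j / t ^+ j.+1)) // big_mkcond.
  by apply: eq_bigr => j _; rewrite ltnS; case: ifP; rewrite ?mul0r.
(* A radius below [d], [rho1] and [rho2] at once: a product of factors [x / (1 + x)] serves as a
   minimum. *)
pose d' : R[i] := d * rho1%:C%C * rho2%:C%C /
  ((1 + d) * (1 + rho1%:C%C) * (1 + rho2%:C%C)).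
have rho1C : 0 < rho1%:C%C by rewrite ltcR.
have rho2C : 0 < rho2%:C%C by rewrite ltcR.
have pos1 (a : R[i]) : 0 < a -> 0 < a / (1 + a).
  by move=> a_gt0; rewrite divr_gt0 // addr_gt0.
have lt1 (a : R[i]) : 0 < a -> a / (1 + a) < 1.
  by move=> a_gt0; rewrite ltr_pdivrMr ?addr_gt0 // mul1r ltrDr.
have lta (a : R[i]) : 0 < a -> a / (1 + a) < a.
  by move=> a_gt0; rewrite ltr_pdivrMr ?addr_gt0 // ltr_pMr // ltrDl.
have Ed' : d' = d / (1 + d) * (rho1%:C%C / (1 + rho1%:C%C)) *
    (rho2%:C%C / (1 + rho2%:C%C)).
  by rewrite !mulf_div.
have e0 := pos1 _ d_gt0; have e1 := pos1 _ rho1C; have e2 := pos1 _ rho2C.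
have l0 := ltW (lt1 _ d_gt0); have l1 := ltW (lt1 _ rho1C).
have l2 := ltW (lt1 _ rho2C).
have d'_gt0 : 0 < d' by rewrite Ed'; exact: mulr_gt0 (mulr_gt0 e0 e1) e2.
have le3 (a b b' e : R[i]) : 0 < a -> 0 < b -> 0 < b' -> b <= 1 -> b' <= 1 ->
    a < e -> a * b * b' < e.
  move=> a_gt0 b_gt0 b'_gt0 b1 b'1; apply: le_lt_trans.
  rewrite -mulrA ler_piMr ?(ltW a_gt0) //.
  by rewrite mulr_ile1 ?(ltW b_gt0) ?(ltW b'_gt0).
have d'_d : d' < d by rewrite Ed'; apply: le3 => //; exact: lta.
have d'_1 : d' < rho1%:C%C.
  by rewrite Ed' [X in X * _]mulrC; apply: le3 => //; exact: lta.
have d'_2 : d' < rho2%:C%C.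
  by rewrite Ed' mulrC mulrA; apply: le3 => //; exact: lta.
clear e0 e1 e2 l0 l1 l2.
have c0 : c 0%N = 0.
  apply: (@principal_part_unique _ n c (`|H1 1| + 1 + (`|H2 1| + 1)) d' d'_gt0
    _ 0%N) => //.
  move=> t t_gt0 td'; pose z : cplx R := 1 + t.
  have z1 : z - 1 = t by rewrite /z addrC addKr.
  have zt : `|z - 1| = t by rewrite z1 ger0_norm // ltW.
  have zd : ball (1 : cplx R) d z.
    by rewrite -ball_normE /= distrC zt (lt_trans td').
  have Re_z : 1 < complex.Re z.
    by move: t_gt0; rewrite ltcE /= => /andP[_]; rewrite /z; case: (t) => u v
      /=; rewrite ltrDl.
  have [/(_ Re_z) D1z /(_ Re_z) D2z H1z H2z] := nbhd z zd.
  have e1 : 0 < `|z - 1| < rho1%:C%C by rewrite zt t_gt0 (lt_trans td').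
  have e2 : 0 < `|z - 1| < rho2%:C%C by rewrite zt t_gt0 (lt_trans td').
  have E := E1 z e1.
  rewrite D1z -D2z (E2 z e2) z1 !pad ?leq_maxl ?leq_maxr // in E.
  have -> : \sum_(j < n) c j / t ^+ j.+1 = H2 z - H1 z.
    rewrite /c; under eq_bigr do rewrite mulrBl.
    rewrite sumrB; apply/eqP; rewrite subr_eq addrAC eq_sym subr_eq; apply/eqP.
    by rewrite addrC.
  apply: le_trans (ler_normB _ _) _; rewrite addrC; exact: lerD.
by move: c0; rewrite /c /= => /eqP; rewrite subr_eq0 => /eqP.
Unshelve. all: by end_near. Qed.

Lemma sum_totient_gcd g q : (0 < q)%N -> (g %| q)%N ->
  (\sum_(0 <= a < q | gcdn a q == g) 1 = totient (q %/ g))%N.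
Proof.
move=> q_gt0 /dvdnP[q' Eq]; subst q; have g_gt0 : (0 < g)%N.
  by case: g q_gt0; rewrite ?muln0.
have q'_gt0 : (0 < q')%N by case: q' q_gt0.
(* The residues fill [[0, q)] and the multiples are counted in [[1, q]]; the exchanged endpoints [0]
   and [q] have the same gcd with [q]. *)
have shift1 (f : nat -> nat) N : (0 < N)%N -> f 0%N = f N ->
    (\sum_(0 <= a < N) f a = \sum_(1 <= a < N.+1) f a)%N.
  case: N => // N _ f0; rewrite big_nat_recl // big_add1 big_nat_recr //= f0.
  by rewrite addnC.
rewrite mulnK // totient_count_coprime big_mkcond.
rewrite (shift1 (fun a => coprime q' a : nat)) //; last first.
  by rewrite /coprime gcdn0 gcdnn.
transitivity (\sum_(1 <= a < (q' * g).+1) if gcdn a (q' * g) == g then 1 else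
  0)%N.
  by apply: shift1; rewrite ?muln_gt0 ?q'_gt0 // gcd0n gcdnn.
have M := big_nat_multiples (q' * g) (fun a => coprime q' a : nat) g_gt0.
rewrite mulnK // in M; refine (etrans _ M); rewrite [RHS]big_mkcond.
apply: eq_bigr => a _; case: (boolP (g %| a)%N) => [/dvdnP[a' ->]|ga].
  rewrite mulnK // gcdnC -muln_gcdl -{2}[g]mul1n eqn_pmul2r //.
by case: eqP => // ga'; rewrite -ga' dvdn_gcdl in ga.
Qed.

Lemma sum_residue_classes (V : nmodType) g q X (f : nat -> V) : (0 < q)%N ->
  \sum_(0 <= a < q | gcdn a q == g)
     \sum_(1 <= n < X | n == a %[mod q]) f n =
  \sum_(1 <= n < X | gcdn n q == g) f n.
Proof.
move=> q_gt0; rewrite (exchange_big_dep_nat xpredT) //= [RHS]big_mkcond.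
apply: eq_bigr => n _; have nq : (n %% q < q)%N by rewrite ltn_mod.
rewrite -big_filter.
have -> : [seq a <- index_iota 0 q | (gcdn a q == g) && (n == a %[mod q])] =
    if gcdn n q == g then [:: n %% q]%N else [::].
  rewrite -gcdn_modl; apply: (@irr_sorted_eq _ ltn) => //.
  - exact: ltn_trans.
  - exact: ltnn.
  - by rewrite sorted_filter ?iota_ltn_sorted //; exact: ltn_trans.
  - by case: ifP.
  move=> a; rewrite mem_filter mem_index_iota /=.
  case: (ltnP a q) => aq; last first.
    rewrite andbF; case: ifP => // _; rewrite inE gtn_eqF //.
    exact: leq_trans nq aq.
  rewrite andbT (modn_small aq); case: (eqVneq (n %% q)%N a) => [<-|na].
    by rewrite andbT; case: eqP => // _; rewrite inE eqxx.
  rewrite andbF; case: ifP => // _; rewrite inE eq_sym (negPf na) //.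
by case: ifP => _; rewrite ?big_seq1 ?big_nil.
Qed.

Definition prog_sum (R : realType) (k q h X : nat) : R :=
  \sum_(1 <= n < X.+1 | n == h %[mod q]) (divk k n)%:R.

Definition gcd_sum (R : realType) (k q g X : nat) : R :=
  \sum_(1 <= n < X.+1 | gcdn n q == g) (divk k n)%:R.

(* The main term of the hypothesis depends on the residue class only through
   its gcd with q, so averaging over these classes evaluates it. *)
Lemma prog_sum_average (R : realType) k g (theta eps : R) :
  distribution_exponent_at k g theta -> 0 < eps ->
  exists2 delta : R, 0 < delta & exists2 K : R, 0 <= K &
  forall X q h, (0 < X)%N -> (0 < q)%N -> q%:R <= X%:R `^ (theta - eps) ->
    ~~ (q %| h)%N -> gcdn h q = g ->
    `|prog_sum R k q h X - gcd_sum R k q g X / (totient (q %/ g))%:R| <=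
      K * X%:R `^ (1 - delta) / (totient (q %/ g))%:R.
Proof.
move=> [_ dist] eps_gt0; have [delta delta_gt0 [K HK]] := dist _ eps_gt0.
(* One error [E] comes from the class of [h] and one from the average over the classes; [K] carries
   no sign, hence the absolute value. *)
exists delta => //; exists (2 * `|K|) => [|X q h X_gt0 q_gt0 qX qh hg].
  by rewrite mulr_ge0.
have gq : (g %| q)%N by rewrite -hg dvdn_gcdr.
have g_gt0 : (0 < g)%N by rewrite (dvdn_gt0 q_gt0).
set phi := totient _; have phi_gt0 : (0 < phi)%N.
  by rewrite totient_gt0 divn_gt0 // dvdn_leq.
have X1 : 1 <= X%:R :> R by rewrite ler1n.
set E := K * X%:R `^ (1 - delta) / phi%:R.
have class h' : gcdn h' q = g -> exists2 r : cplx R, is_main_residue k q g X%:R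
  r &
    `|(prog_sum R k q h' X)%:C%C - r / phi%:R| <= E%:C%C.
  (* If [q] divided [h'], then [g = q] and [q] would divide [h] as well. *)
  move=> h'g; have qh' : ~~ (q %| h')%N.
    apply: contra qh => /gcdn_idPr Eq.
    by rewrite -Eq h'g -hg dvdn_gcdl.
  have [r r_res r_le] := HK X%:R q h' X1 q_gt0 qX qh' h'g; exists r => //.
  move: r_le; rewrite natrK natr_sum.
  by rewrite /prog_sum raddf_sum /=; under [in X in _ -> X]eq_bigr do rewrite
    rmorph_nat.
have [r r_res r_le] := class h hg.
(* Each class comes with its own residue; by uniqueness all of them are [r], and the classes can be
   averaged. *)
have r_all h' : gcdn h' q = g -> `|(prog_sum R k q h' X)%:C%C - r / phi%:R| <=
  E%:C%C.
  move=> h'g; have [r' r'_res] := class h' h'g.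
  by rewrite (main_residue_unique r_res r'_res).
have phiC : phi%:R != 0 :> R[i] by rewrite pnatr_eq0 -lt0n.
have sum_le : `|(gcd_sum R k q g X)%:C%C - r| <= phi%:R * E%:C%C.
  have -> : (gcd_sum R k q g X)%:C%C - r =
      \sum_(0 <= a < q | gcdn a q == g) ((prog_sum R k q a X)%:C%C - r /
        phi%:R).
    rewrite sumrB -raddf_sum /= /prog_sum sum_residue_classes //; congr (_ - _).
    transitivity (\sum_(0 <= a < q | gcdn a q == g) (1%N%:R * (r / phi%:R))).
      rewrite -mulr_suml -natr_sum sum_totient_gcd // -/phi mulrC divfK //.
    by apply: eq_bigr => a _; rewrite mul1r.
  apply: le_trans (ler_norm_sum _ _ _) _.
  apply: le_trans (_ : \sum_(0 <= a < q | gcdn a q == g) (1%N%:R * E%:C%C) <=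
    _).
    by apply: ler_sum => a /eqP ag; rewrite mul1r; exact: r_all.
  by rewrite -mulr_suml -natr_sum sum_totient_gcd.
have : `|(prog_sum R k q h X)%:C%C - (gcd_sum R k q g X)%:C%C / phi%:R| <=
    (E + E)%:C%C.
  rewrite -[X in X - _](subrK (r / phi%:R)) -addrA -mulrBl rmorphD /=.
  apply: le_trans (ler_normD _ _) _; apply: lerD => //.
  rewrite normrM distrC normfV ler_pdivrMr ?normr_gt0 //.
  by rewrite mulrC [`|phi%:R|]ger0_norm.
rewrite -(rmorph_nat (real_complex R)) /= -fmorphV -rmorphM -rmorphB /=.
rewrite normc_def /= expr0n addr0 sqrtr_sqr lecR => /le_trans; apply.
rewrite (_ : _ * _ / _ = 2 * (`|K| * X%:R `^ (1 - delta) / phi%:R)); last by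
  ring.
rewrite -mulr2n -[leLHS]mulr_natl ler_wpM2l // /E.
by rewrite ler_wpM2r ?invr_ge0 // ler_wpM2r ?powR_ge0 // ler_norm.
Qed.

(** Only finitely many gcds occur, so the least [delta] and the sum of the constants [K] serve for
    all of them. It is applied with [G = h]. *)
Lemma prog_sum_average_bounded (R : realType) k (theta eps : R) :
  distribution_exponent k theta -> 0 < eps -> forall G : nat,
  exists2 delta : R, 0 < delta & exists2 K : R, 0 <= K &
  forall X q h, (0 < X)%N -> (0 < q)%N -> q%:R <= X%:R `^ (theta - eps) ->
    ~~ (q %| h)%N -> (gcdn h q <= G)%N ->
    `|prog_sum R k q h X -
      gcd_sum R k q (gcdn h q) X / (totient (q %/ gcdn h q))%:R| <=
      K * X%:R `^ (1 - delta) / (totient (q %/ gcdn h q))%:R.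
Proof.
move=> dist eps_gt0; elim=> [|G [d1 d1_gt0 [K1 K1_ge0 H1]]].
  exists 1 => //; exists 0 => // X q h _ q_gt0 _ _.
  by rewrite leqn0 -leqn0 leqNgt gcdn_gt0 q_gt0 orbT.
have [d2 d2_gt0 [K2 K2_ge0 H2]] := prog_sum_average (dist G.+1 isT) eps_gt0.
exists (Num.min d1 d2); first by rewrite lt_min d1_gt0.
exists (K1 + K2) => [|X q h X_gt0 q_gt0 qX qh]; first exact: addr_ge0.
have X1 : 1 <= X%:R :> R by rewrite ler1n.
have mono d K : 0 <= K -> K <= K1 + K2 -> Num.min d1 d2 <= d ->
    K * X%:R `^ (1 - d) / (totient (q %/ gcdn h q))%:R <=
    (K1 + K2) * X%:R `^ (1 - Num.min d1 d2) / (totient (q %/ gcdn h q))%:R.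
  move=> K0 KK dd; rewrite ler_wpM2r ?invr_ge0 // ler_pM ?powR_ge0 //.
  by rewrite ler_powR // lerB.
rewrite leq_eqVlt => /orP[/eqP gG|gG].
  apply: le_trans (mono d2 K2 K2_ge0 _ _); rewrite ?lerDr ?ge_min ?lexx ?orbT
    //.
  by have := H2 X q h X_gt0 q_gt0 qX qh gG; rewrite -gG.
apply: le_trans (mono d1 K1 K1_ge0 _ _); rewrite ?lerDl ?ge_min ?lexx //.
exact: H1.
Qed.

Definition div_prog_sum (R : realType) (h j k Y Q : nat) : R :=
  \sum_(1 <= q < Q.+1) (divk j q)%:R * prog_sum R k q h Y.

Lemma dsum_wt_gcdE (R : realType) h j k X Q :
  dsum (wt_gcd R h j k) X Q = \sum_(1 <= q < Q.+1) (divk j q)%:R *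
    (gcd_sum R k q (gcdn h q) X / (totient (q %/ gcdn h q))%:R).
Proof.
apply: eq_big_nat => q _; rewrite /gcd_sum mulr_suml mulr_sumr [RHS]big_mkcond.
apply: eq_bigr => m _; rewrite /wt_gcd.
by case: eqP => _; [rewrite mul1r; ring | rewrite !mul0r].
Qed.

(** In the class of [0] modulo [q], excluded from the hypothesis, the main term is exact:
    [gcd (m, q) = q] says that [q] divides [m], and the totient is that of [1]. *)
Lemma prog_sum_dvd (R : realType) k q h X : (0 < q)%N -> (q %| h)%N ->
  prog_sum R k q h X =
  gcd_sum R k q (gcdn h q) X / (totient (q %/ gcdn h q))%:R.
Proof.
move=> q_gt0 qh; rewrite (gcdn_idPr qh) divnn q_gt0 (_ : totient 1 = 1%N) //
  divr1.
apply: eq_bigl => m; have -> : (h %% q = 0)%N by apply/eqP.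
by rewrite -/(q %| m)%N; apply/idP/eqP => [/gcdn_idPr|/gcdn_idPr].
Qed.

Lemma divk_gt0 k n : (0 < n)%N -> (0 < divk k.+1 n)%N.
Proof.
move=> n_gt0; rewrite divkS // (bigD1_seq 1%N) ?divisors_uniq //=.
  by rewrite divkn1.
by rewrite -dvdn_divisors // dvd1n.
Qed.

(* The term m = h of the double sum satisfies the gcd condition for every q. *)
Lemma sum_totient_inv_le (R : realType) h j k Q : (0 < h)%N ->
  \sum_(1 <= q < Q.+1) (divk j q)%:R / (totient (q %/ gcdn h q))%:R <=
  dsum (wt_gcd R h j k.+1) h Q.
Proof.
move=> h_gt0; apply: ler_sum => q _; rewrite big_nat_recr //= -[leLHS]add0r.
apply: lerD; first by apply: sumr_ge0 => m _; exact: wt_gcd_ge0.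
rewrite /wt_gcd eqxx mul1r ler_wpM2r ?invr_ge0 // ler_peMr // ler1n.
exact: divk_gt0.
Qed.

Lemma div_prog_sum_diff (R : realType) h j k (theta eps : R) : (0 < h)%N ->
  distribution_exponent k.+1 theta -> 0 < eps ->
  exists2 delta : R, 0 < delta & exists2 K : R, 0 <= K &
  forall Y Q, (0 < Y)%N -> Q%:R <= Y%:R `^ (theta - eps) ->
    `|div_prog_sum R h j k.+1 Y Q - dsum (wt_gcd R h j k.+1) Y Q| <=
    K * Y%:R `^ (1 - delta) * succ_ln R Q ^+ j.
Proof.
move=> h_gt0 dist eps_gt0.
have [delta delta_gt0 [K K_ge0 HK]] := prog_sum_average_bounded dist eps_gt0 h.
have [C C_ge0 HC] := dsum_wt_gcd_le R j k h_gt0.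
have Lh_ge0 : 0 <= h%:R * succ_ln R h ^+ k.
  by rewrite mulr_ge0 // exprn_ge0 // ltW // succ_ln_gt0.
(* The second factor comes from [C * dmain R k j h Q], the bound for the sum of
   [d_j (q) / phi (q / gcd (h, q))], with the power of [succ_ln R Q] taken out. *)
exists delta => //; exists (K * (C * (h%:R * succ_ln R h ^+ k))) => [|Y Q Y_gt0
  QY].
  by rewrite mulr_ge0 // mulr_ge0.
rewrite dsum_wt_gcdE /div_prog_sum -sumrB.
apply: le_trans (ler_norm_sum _ _ _) _.
apply: le_trans (_ : \sum_(1 <= q < Q.+1) (K * Y%:R `^ (1 - delta)) *
    ((divk j q)%:R / (totient (q %/ gcdn h q))%:R) <= _).
  rewrite big_nat_cond [leRHS]big_nat_cond; apply: ler_sum => q.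
  rewrite andbT => /andP[q_gt0 qQ]; rewrite -mulrBr normrM ger0_norm //.
  have KY : 0 <= K * Y%:R `^ (1 - delta) by rewrite mulr_ge0 ?powR_ge0.
  case: (boolP (q %| h)%N) => qh.
    by rewrite prog_sum_dvd // subrr normr0 mulr0 mulr_ge0 // divr_ge0.
  rewrite mulrCA ler_wpM2l //; apply: HK => //.
    by apply: le_trans QY; rewrite ler_nat.
  by rewrite dvdn_leq // dvdn_gcdl.
rewrite -mulr_sumr (_ : _ * _ * succ_ln R Q ^+ j =
  K * Y%:R `^ (1 - delta) * (C * dmain R k j h Q)); last by rewrite /dmain;
    ring.
rewrite ler_wpM2l ?mulr_ge0 ?powR_ge0 //.
exact: le_trans (sum_totient_inv_le _ _ k _ h_gt0) (HC _ _).
Qed.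

Lemma cvg_powR_nat0 (R : realType) (d : R) : 0 < d ->
  n%:R `^ (- d) @[n --> \oo] --> (0 : R).
Proof.
move=> d_gt0; apply/cvgrPdist_le => e e_gt0; near=> n.
have n_gt0 : 0 < n%:R :> R by rewrite ltr0n; near: n; exact: nbhs_infty_gt.
rewrite sub0r normrN ger0_norm ?powR_ge0 //.
rewrite -ler_ln ?posrE ?powR_gt0 // ln_powR mulNr lerNl -ler_pdivrMl //.
near: n; move/cvgryPge: (@cvg_ln_nat R); exact.
Unshelve. all: by end_near. Qed.

(** The error carries the same power of [succ_ln] at [Q] as [dmain], so relative to [dmain] it is at
    most [K] times the power [- delta] of [Y]. *)
Lemma cvg_div_prog_sum (R : realType) h j k (theta eps : R) (Y Q : nat -> nat) :
  (0 < h)%N -> distribution_exponent k.+1 theta -> 0 < eps ->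
  Y n @[n --> \oo] --> \oo -> Q n @[n --> \oo] --> \oo ->
  (\forall n \near \oo, (Q n)%:R <= (Y n)%:R `^ (theta - eps)) ->
  div_prog_sum R h j k.+1 (Y n) (Q n) / dmain R k j (Y n) (Q n) @[n --> \oo] -->
    C_const R k.+1 j.+1 * f_const R k.+1 j.+1 h / (k`!%:R * j`!%:R).
Proof.
move=> h_gt0 dist eps_gt0 Yoo Qoo QY; set c := _ / _.
have [delta delta_gt0 [K K_ge0 HK]] := div_prog_sum_diff j h_gt0 dist eps_gt0.
have main : dsum (wt_gcd R h j k.+1) (Y n) (Q n) / dmain R k j (Y n) (Q n)
    @[n --> \oo] --> c.
  exact: dlim_comp Yoo Qoo (@dlim_wt_gcd R h j k h_gt0).
have small : K * (Y n)%:R `^ (- delta) @[n --> \oo] --> (0 : R).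
  rewrite -[X in _ --> X](mulr0 K); apply: cvgMl_tmp.
  exact: (cvg_comp _ (fun n => n%:R `^ (- delta)) Yoo (cvg_powR_nat0
    delta_gt0)).
apply/cvgrPdist_le => e e_gt0; have e2 : 0 < e / 2 by rewrite divr_gt0.
move/cvgrPdist_le: main => /(_ _ e2) main.
move/cvgrPdist_le: small => /(_ _ e2) small.
near=> n.
have Y_gt0 : (0 < Y n)%N by near: n; exact: (Yoo _ (nbhs_infty_gt 0)).
have QYn : (Q n)%:R <= (Y n)%:R `^ (theta - eps) by near: n.
have m_gt0 := dmain_gt0 R k j (Q n) Y_gt0.
have YR : 0 < (Y n)%:R :> R by rewrite ltr0n.
rewrite (_ : c - _ = (c - dsum (wt_gcd R h j k.+1) (Y n) (Q n) /
    dmain R k j (Y n) (Q n)) - (div_prog_sum R h j k.+1 (Y n) (Q n) -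
    dsum (wt_gcd R h j k.+1) (Y n) (Q n)) / dmain R k j (Y n) (Q n)); last by
      ring.
rewrite (splitr e); apply: le_trans (ler_normB _ _) _; apply: lerD.
  by near: n.
apply: le_trans (_ : K * (Y n)%:R `^ (- delta) <= _); last first.
  apply: le_trans (ler_norm _) _; rewrite -normrN -sub0r.
  by near: n.
rewrite normrM [`|_^-1|]ger0_norm ?invr_ge0 ?(ltW m_gt0) // ler_pdivrMr //.
apply: le_trans (HK _ _ Y_gt0 QYn) _.
rewrite powRD; last by apply/implyP => _; rewrite gt_eqF.
rewrite powRr1 ?ler0n // /dmain.
rewrite (_ : K * ((Y n)%:R * (Y n)%:R `^ (- delta)) * succ_ln R (Q n) ^+ j =
   K * (Y n)%:R `^ (- delta) * ((Y n)%:R * succ_ln R (Q n) ^+ j)); last by ring.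
rewrite ler_wpM2l ?mulr_ge0 ?powR_ge0 // ler_wpM2r ?exprn_ge0 ?(ltW
  (succ_ln_gt0 _ _)) //.
by rewrite ler_peMr ?(ltW YR) // exprn_ege1 // succ_ln_ge1.
Unshelve. all: by end_near. Qed.

(** * The correlation with the truncated divisor function *)

(** The cutoff [Q] is the same for all [n], unlike in [divkB], so the sum over [q] can be taken
    outside. *)
Definition corr_block (R : realType) (h j k Y X Q : nat) : R :=
  \sum_(Y.+1 <= n < X.+1) (divk k (n + h))%:R *
    \sum_(1 <= q < Q.+1 | (q %| n)%N) (divk j q)%:R.

(** With [m = n + h], [q] divides [n] exactly when [m] is congruent to [h] modulo [q], and the range
    of [n] moves up by [h]. *)
Lemma corr_blockE (R : realType) h j k Y X Q : (Y <= X)%N ->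
  corr_block R h j k Y X Q =
  div_prog_sum R h j k (X + h) Q - div_prog_sum R h j k (Y + h) Q.
Proof.
move=> YX; rewrite /div_prog_sum -sumrB /corr_block.
under eq_bigr do rewrite mulr_sumr.
rewrite (exchange_big_dep_nat xpredT) //=; apply: eq_bigr => q _.
rewrite -mulrBr /prog_sum [X in _ * (X - _)](big_cat_nat (n := (Y + h).+1))
  //=; last first.
  by rewrite ltnS leq_add2r.
rewrite addrAC subrr add0r -!addSn big_addn addnK mulr_sumr.
apply: eq_big => [n|n _]; last by rewrite mulrC.
by rewrite eqn_mod_dvd ?leq_addl // addnK.
Qed.

Definition trunc_pow (R : realType) (B : R) (n : nat) : nat :=
  Num.truncn (n%:R `^ B).

Lemma leq_trunc_pow (R : realType) (B : R) q n :
  (q <= trunc_pow B n)%N = (q%:R <= n%:R `^ B).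
Proof. by rewrite truncn_ge_nat // powR_ge0. Qed.

Lemma divkB_trunc_pow (R : realType) (B : R) j n : (0 < n)%N ->
  (divkB j.+1 n B)%:R =
  \sum_(1 <= q < (trunc_pow B n).+1 | (q %| n)%N) (divk j q)%:R :> R.
Proof.
move=> n_gt0; set T := trunc_pow B n; rewrite /divkB natr_sum big_mkcond /=.
have nN : (0 < n <= maxn n T)%N by rewrite n_gt0 leq_maxl.
rewrite (sum_divisors_big_nat _ nN) -big_mkcondr.
rewrite [RHS](big_nat_widen _ _ (maxn n T).+1) ?ltnS ?leq_maxr //.
by apply: eq_bigl => q; rewrite ltnS leq_trunc_pow.
Qed.

Definition corrB_sum (R : realType) (h j k : nat) (B : R) (X : nat) : R :=
  \sum_(1 <= n < X.+1) (divk k (n + h))%:R * (divkB j.+1 n B)%:R.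

Lemma ler_sum_trunc (R : realType) j n Q Q' : (Q <= Q')%N ->
  \sum_(1 <= q < Q.+1 | (q %| n)%N) (divk j q)%:R <=
  \sum_(1 <= q < Q'.+1 | (q %| n)%N) (divk j q)%:R :> R.
Proof.
move=> QQ; rewrite [leRHS](big_cat_nat (n := Q.+1)) //= lerDl sumr_ge0 //.
Qed.

Lemma trunc_pow_mono (R : realType) (B : R) m n : 0 <= B -> (m <= n)%N ->
  (trunc_pow B m <= trunc_pow B n)%N.
Proof.
by move=> B0 mn; apply: le_truncn; rewrite ge0_ler_powR ?nnegrE ?ler_nat.
Qed.

(** All terms are nonnegative, so every cutoff may be raised to that of [X]; for the lower bound the
    terms [n <= Y] are dropped and the cutoffs lowered to that of [Y]. *)
Lemma corrB_sum_le (R : realType) h j k (B : R) X : 0 <= B ->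
  corrB_sum h j k B X <= div_prog_sum R h j k (X + h) (trunc_pow B X).
Proof.
move=> B0; apply: le_trans (_ : corr_block R h j k 0 X (trunc_pow B X) <= _).
  rewrite /corrB_sum /corr_block big_nat_cond [leRHS]big_nat_cond.
  apply: ler_sum => n; rewrite andbT => /andP[n_gt0 nX].
  rewrite divkB_trunc_pow // ler_wpM2l // ler_sum_trunc //.
  exact: trunc_pow_mono.
rewrite corr_blockE // gerBl sumr_ge0 // => q _.
by rewrite mulr_ge0 // sumr_ge0.
Qed.

Lemma corrB_sum_ge (R : realType) h j k (B : R) Y X : 0 <= B -> (Y <= X)%N ->
  div_prog_sum R h j k (X + h) (trunc_pow B Y) -
  div_prog_sum R h j k (Y + h) (trunc_pow B Y) <= corrB_sum h j k B X.
Proof.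
move=> B0 YX; rewrite -corr_blockE // /corrB_sum /corr_block.
rewrite [leRHS](big_cat_nat (n := Y.+1)) //= -[leLHS]add0r.
apply: lerD; first by apply: sumr_ge0 => n _; rewrite mulr_ge0.
rewrite big_nat_cond [leRHS]big_nat_cond; apply: ler_sum => n.
rewrite andbT => /andP[Yn nX]; rewrite divkB_trunc_pow ?(leq_trans _ Yn) //.
by rewrite ler_wpM2l // ler_sum_trunc // trunc_pow_mono // ltnW.
Qed.

Lemma cvg_trunc_pow (R : realType) (B : R) : 0 < B ->
  trunc_pow B n @[n --> \oo] --> \oo.
Proof.
move=> B0; apply/cvgnyPge => -[|A]; near=> n; first exact: leq0n.
have n_gt0 : 0 < n%:R :> R by rewrite ltr0n; near: n; exact: nbhs_infty_gt.
rewrite leq_trunc_pow -ler_ln ?posrE ?powR_gt0 // ln_powR -ler_pdivrMl //.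
by near: n; move/cvgryPge: (@cvg_ln_nat R); exact.
Unshelve. all: by end_near. Qed.

(** The power [B ^ j] in the limit originates here. Rounding down to an integer that is at least [1]
    loses at most a factor [2], hence the [ln 2]. *)
Lemma cvg_succ_ln_trunc_pow (R : realType) (B : R) : 0 < B ->
  succ_ln R (trunc_pow B n) / succ_ln R n @[n --> \oo] --> B.
Proof.
move=> B0; have B_neq0 : B != 0 by rewrite gt_eqF.
apply: (squeeze_cvgr (f := fun n => B * ((ln n%:R + (1 - ln 2) / B) / succ_ln R
  n))
  (h := fun n => B * ((ln n%:R + 1 / B) / succ_ln R n))); last 2 first.
- by rewrite -[X in _ --> X]mulr1; apply: cvgMl_tmp; exact: cvg_ln_succ_ln.
- by rewrite -[X in _ --> X]mulr1; apply: cvgMl_tmp; exact: cvg_ln_succ_ln.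
near=> n.
have n_gt0 : (0 < n)%N by near: n; exact: nbhs_infty_gt.
have nR : 0 < n%:R :> R by rewrite ltr0n.
have pB : 0 < n%:R `^ B by exact: powR_gt0.
have pB1 : 1 <= n%:R `^ B.
  by rewrite -[leLHS](powRr0 n%:R) ler_powR ?ler1n // ltW.
have T_gt0 : (0 < trunc_pow B n)%N by rewrite leq_trunc_pow.
have TR : 0 < (trunc_pow B n)%:R :> R by rewrite ltr0n.
rewrite !mulrA !ler_pM2r ?invr_gt0 ?succ_ln_gt0 // /succ_ln; apply/andP; split.
  rewrite mulrDr mulrCA divff // mulr1 addrCA lerD2l lerBlDr -ln_powR.
  rewrite addrC -lnM ?posrE // ler_ln ?posrE ?mulr_gt0 //.
  apply: le_trans (ltW (truncnS_gt _)) _; rewrite -/(trunc_pow B n) -natrM.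
  by rewrite ler_nat mul2n -addnn -addn1 leq_add2l.
rewrite mulrDr mulrCA divff // mulr1 addrC lerD2r -ln_powR ler_ln ?posrE //.
by rewrite truncn_le powR_ge0.
Unshelve. all: by end_near. Qed.

Lemma cvg_addn_ratio (R : realType) h :
  (n + h)%:R / n%:R @[n --> \oo] --> (1 : R).
Proof.
have H : 1 + h%:R * n%:R^-1 @[n --> \oo] --> (1 + h%:R * 0 : R).
  by apply: cvgD; [exact: cvg_cst | apply: cvgMl_tmp; exact: cvg_natr_inv].
rewrite mulr0 addr0 in H; apply: cvg_trans H; apply: near_eq_cvg; near=> n.
have n_neq0 : n%:R != 0 :> R.
  by rewrite pnatr_eq0 -lt0n; near: n; exact: nbhs_infty_gt.
by rewrite natrD mulrDl divff.
Unshelve. all: by end_near. Qed.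

Lemma cvg_succ_ln_addn (R : realType) h :
  succ_ln R (n + h) / succ_ln R n @[n --> \oo] --> (1 : R).
Proof.
apply: (squeeze_cvgr (f := fun=> 1)
  (h := fun n => (ln n%:R + (1 + ln h.+1%:R)) / succ_ln R n)); last 2 first.
- exact: cvg_cst.
- exact: cvg_ln_succ_ln.
near=> n; have n_gt0 : (0 < n)%N by near: n; exact: nbhs_infty_gt.
apply/andP; split; first by rewrite ler_pdivlMr ?succ_ln_gt0 // mul1r
  ler_succ_ln ?leq_addr.
rewrite ler_pM2r ?invr_gt0 ?succ_ln_gt0 // /succ_ln [leRHS]addrCA lerD2l -lnM
  ?posrE ?ltr0n //.
by rewrite -natrM ler_ln_nat // mulnS leq_add2l leq_pmull.
Unshelve. all: by end_near. Qed.

Lemma cvg_addn_nat h : (n + h)%N @[n --> \oo] --> \oo.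
Proof.
apply/cvgnyPge => A; near=> n; rewrite (leq_trans _ (leq_addr _ _)) //.
by near: n; exact: nbhs_infty_ge.
Unshelve. all: by end_near. Qed.

Definition nmain (R : realType) (i n : nat) : R := n%:R * succ_ln R n ^+ i.

Lemma nmain_gt0 (R : realType) i n : (0 < n)%N -> 0 < nmain R i n.
Proof. by move=> n_gt0; rewrite mulr_gt0 ?ltr0n // exprn_gt0 // succ_ln_gt0.
  Qed.

Lemma cvg_dmain_ratio (R : realType) k j (Y Q : nat -> nat) (y b : R) :
  (Y n)%:R / n%:R @[n --> \oo] --> y -> succ_ln R (Y n) / succ_ln R n @[n -->
    \oo] --> (1 : R) ->
  succ_ln R (Q n) / succ_ln R n @[n --> \oo] --> b ->
  dmain R k j (Y n) (Q n) / nmain R (k + j) n @[n --> \oo] --> y * b ^+ j.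
Proof.
move=> Hy HL HQ.
rewrite -[y]mulr1 -[X in y * X](expr1n R k).
apply: cvg_trans (cvgM (cvgM Hy (cvg_exprn (n := k) HL)) (cvg_exprn (n := j)
  HQ)).
apply: near_eq_cvg; near=> n.
have n_neq0 : n%:R != 0 :> R.
  by rewrite pnatr_eq0 -lt0n; near: n; exact: nbhs_infty_gt.
rewrite /= !exprMn !exprVn /dmain /nmain exprD.
by field; rewrite n_neq0 !expf_neq0 // succ_ln_neq0.
Unshelve. all: by end_near. Qed.

Definition corr_const (R : realType) (h j k : nat) : R :=
  C_const R k.+1 j.+1 * f_const R k.+1 j.+1 h / (k`!%:R * j`!%:R).

Lemma cvg_div_prog_sum_nmain (R : realType) h j k (theta B y b : R)
    (Y Q : nat -> nat) :
  (0 < h)%N -> distribution_exponent k.+1 theta -> B < theta ->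
  Y n @[n --> \oo] --> \oo -> Q n @[n --> \oo] --> \oo ->
  (forall n, (Q n)%:R <= (Y n)%:R `^ B) ->
  (Y n)%:R / n%:R @[n --> \oo] --> y -> succ_ln R (Y n) / succ_ln R n @[n -->
    \oo] --> (1 : R) ->
  succ_ln R (Q n) / succ_ln R n @[n --> \oo] --> b ->
  div_prog_sum R h j k.+1 (Y n) (Q n) / nmain R (k + j) n @[n --> \oo] -->
    corr_const R h j k * (y * b ^+ j).
Proof.
move=> h_gt0 dist Bt Yoo Qoo QY Hy HL HQ.
(* With [eps = theta - B] the admissible moduli reach the power [B] of [Y]. *)
have eps_gt0 : 0 < theta - B by rewrite subr_gt0.
have QY' : \forall n \near \oo, (Q n)%:R <= (Y n)%:R `^ (theta - (theta - B)).
  by near=> n; rewrite subKr.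
apply: cvg_trans (cvgM
  (cvg_div_prog_sum (j := j) h_gt0 dist eps_gt0 Yoo Qoo QY')
  (cvg_dmain_ratio k (j := j) Hy HL HQ)).
apply: near_eq_cvg; near=> n.
have Y_gt0 : (0 < Y n)%N by near: n; exact: (Yoo _ (nbhs_infty_gt 0)).
by rewrite /= mulrA divfK // gt_eqF // dmain_gt0.
Unshelve. all: by end_near. Qed.

(* Restricting to [X / M < n <= X] makes the bounds [q <= n^B] and
   [q <= (X / M)^B] comparable, at the cost of a proportion 1 / M. *)
Lemma cvg_corrB_sum (R : realType) h j k (theta B : R) :
  (0 < h)%N -> distribution_exponent k.+1 theta -> 0 < B < theta ->
  corrB_sum h j k.+1 B n / nmain R (k + j) n @[n --> \oo] -->
    corr_const R h j k * B ^+ j.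
Proof.
move=> h_gt0 dist /andP[B_gt0 Bt]; have B_ge0 := ltW B_gt0.
have tp_le m Y : (m <= Y)%N -> (trunc_pow B m)%:R <= Y%:R `^ B.
  by move=> mY; rewrite -leq_trunc_pow trunc_pow_mono.
have up : div_prog_sum R h j k.+1 (n + h) (trunc_pow B n) / nmain R (k + j) n
    @[n --> \oo] --> corr_const R h j k * (1 * B ^+ j).
  apply: (cvg_div_prog_sum_nmain (Y := fun n => (n + h)%N)
    (Q := trunc_pow B) h_gt0 dist Bt).
  - exact: cvg_addn_nat.
  - exact: cvg_trunc_pow.
  - by move=> n; apply: tp_le; exact: leq_addr.
  - exact: cvg_addn_ratio.
  - exact: cvg_succ_ln_addn.
  - exact: cvg_succ_ln_trunc_pow.
rewrite mul1r in up; set c := corr_const R h j k in up *.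
(* Dividing [n] by a fixed [M] does not affect the ratio of logarithms, so the lower cutoff still
   produces [B ^ j]; only the discarded range costs [1 / M]. *)
have cvgQ M : (0 < M)%N ->
    succ_ln R (trunc_pow B (n %/ M)) / succ_ln R n @[n --> \oo] --> B.
  move=> M_gt0; rewrite -[X in _ --> X]mulr1.
  apply: cvg_trans (cvgM (cvg_comp _ (fun n => succ_ln R (trunc_pow B n) /
    succ_ln R n)
    (cvg_divn_nat M_gt0) (cvg_succ_ln_trunc_pow B_gt0)) (@cvg_succ_ln_divn R M
      M_gt0)).
  by apply: near_eq_cvg; near=> n; rewrite /= mulrA divfK // succ_ln_neq0.
have lo M : (0 < M)%N ->
    (div_prog_sum R h j k.+1 (n + h) (trunc_pow B (n %/ M)) -
     div_prog_sum R h j k.+1 (n %/ M + h) (trunc_pow B (n %/ M))) /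
    nmain R (k + j) n @[n --> \oo] -->
    c * (1 * B ^+ j) - c * (M%:R^-1 * B ^+ j).
  move=> M_gt0; under eq_fun do rewrite mulrBl; apply: cvgB.
    apply: (cvg_div_prog_sum_nmain (Y := fun n => (n + h)%N)
      (Q := fun n => trunc_pow B (n %/ M)) h_gt0 dist Bt).
    - exact: cvg_addn_nat.
    - exact: (cvg_comp _ _ (cvg_divn_nat M_gt0) (cvg_trunc_pow B_gt0)).
    - by move=> n; apply: tp_le; rewrite (leq_trans (leq_div _ _)) ?leq_addr.
    - exact: cvg_addn_ratio.
    - exact: cvg_succ_ln_addn.
    - exact: cvgQ.
  (* The subtracted sum is shorter, but its cutoff is computed from [n %/ M], so the moduli are
     still admissible. *)
  apply: (cvg_div_prog_sum_nmain (Y := fun n => (n %/ M + h)%N)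
    (Q := fun n => trunc_pow B (n %/ M)) h_gt0 dist Bt).
  - exact: (cvg_comp _ _ (cvg_divn_nat M_gt0) (cvg_addn_nat h)).
  - exact: (cvg_comp _ _ (cvg_divn_nat M_gt0) (cvg_trunc_pow B_gt0)).
  - by move=> n; apply: tp_le; exact: leq_addr.
  - rewrite -[X in _ --> X]addr0 -[X in _ + X](mulr0 h%:R).
    under eq_fun do rewrite natrD mulrDl.
    apply: cvgD; first exact: cvg_divn_ratio.
    by apply: cvgMl_tmp; exact: cvg_natr_inv.
  - rewrite -[X in _ --> X]mulr1.
    have LMh : succ_ln R (n %/ M + h) / succ_ln R (n %/ M) @[n --> \oo] --> (1
      : R).
      exact: (cvg_comp _ (fun n => succ_ln R (n + h) / succ_ln R n)
        (cvg_divn_nat M_gt0)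
        (@cvg_succ_ln_addn R h)).
    apply: cvg_trans (cvgM LMh (@cvg_succ_ln_divn R M M_gt0)).
    by apply: near_eq_cvg; near=> n; rewrite /= mulrA divfK // succ_ln_neq0.
  - exact: cvgQ.
apply/cvgrPdist_le => e e_gt0; have e2 : 0 < e / 2 by rewrite divr_gt0.
have [M [M_gt0 cM]] : exists M, (0 < M)%N /\ `|c * (M%:R^-1 * B ^+ j)| <= e / 2.
  have : c * (M%:R^-1 * B ^+ j) @[M --> \oo] --> (c * (0 * B ^+ j) : R).
    by apply: cvgMl_tmp; apply: cvgMr_tmp; exact: cvg_natr_inv.
  rewrite mul0r mulr0 => /cvgrPdist_le /(_ _ e2) H.
  near \oo => M; exists M; split; first by near: M; exact: nbhs_infty_gt.
  by rewrite -normrN -sub0r; near: M.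
have {}lo := lo M M_gt0; rewrite mul1r in lo.
move/cvgrPdist_le: lo => /(_ _ e2) lo; move/cvgrPdist_le: up => /(_ _ e_gt0) up.
near=> n; have n_gt0 : (0 < n)%N by near: n; exact: nbhs_infty_gt.
have N_gt0 := nmain_gt0 R (k + j) n_gt0.
set T := corrB_sum _ _ _ _ _.
have T_le := @corrB_sum_le R h j k.+1 B n B_ge0; rewrite -/T in T_le.
have T_ge := @corrB_sum_ge R h j k.+1 B _ _ B_ge0 (leq_div n M).
rewrite -/T in T_ge.
have up_n : `|c * B ^+ j - div_prog_sum R h j k.+1 (n + h) (trunc_pow B n) /
   nmain R (k + j) n| <= e by near: n.
have lo_n : `|c * B ^+ j - c * (M%:R^-1 * B ^+ j) -
   (div_prog_sum R h j k.+1 (n + h) (trunc_pow B (n %/ M)) -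
    div_prog_sum R h j k.+1 (n %/ M + h) (trunc_pow B (n %/ M))) /
    nmain R (k + j) n| <= e / 2 by near: n.
have T_le' := T_le; rewrite -(ler_pM2r (_ : 0 < (nmain R (k + j) n)^-1))
  ?invr_gt0 // in T_le'.
have T_ge' := T_ge; rewrite -(ler_pM2r (_ : 0 < (nmain R (k + j) n)^-1))
  ?invr_gt0 // in T_ge'.
move: up_n lo_n cM T_le' T_ge'; rewrite !ler_norml.
set a1 := _ / nmain _ _ _; set a2 := _ / nmain _ _ _; set a3 := _ / nmain _ _ _.
move=> /andP[u1 u2] /andP[l1 l2] /andP[m1 m2] t1 t2.
by apply/andP; split; lra.
Unshelve. all: by end_near. Qed.

(** * Passage to a real variable and the equivalence *)

Lemma cvg_truncn (R : realType) : Num.truncn x @[x --> (+oo : set_system R)]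
  --> \oo.
Proof.
apply/cvgnyPge => A; near=> x.
have x_ge : A%:R <= x by near: x; exact: nbhs_pinfty_ge.
by rewrite truncn_ge_nat // (le_trans _ x_ge).
Unshelve. all: by end_near. Qed.

(** Rounding [x >= 1] down changes both [x] and [ln x] by at most [1]. *)
Lemma cvg_nmain_truncn (R : realType) i :
  nmain R i (Num.truncn x) / (x * ln x ^+ i) @[x --> (+oo : set_system R)] -->
    (1 : R).
Proof.
have toy := @cvg_truncn R.
have H1 : (Num.truncn x)%:R / x @[x --> (+oo : set_system R)] --> (1 : R).
  apply: (squeeze_cvgr (f := fun x => 1 - ((Num.truncn x)%:R)^-1) (h := fun=>
    1)).
  - near=> x; have x_gt0 : 0 < x by near: x; exact: nbhs_pinfty_gt.
    have n_gt0 : (0 < Num.truncn x)%N by near: x; exact: (toy _ (nbhs_infty_gt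
      0)).
    have nR : 0 < (Num.truncn x)%:R :> R by rewrite ltr0n.
    have n_le : (Num.truncn x)%:R <= x by rewrite truncn_le ltW.
    apply/andP; split; last by rewrite ler_pdivrMr // mul1r.
    rewrite ler_pdivlMr // mulrBl mul1r lerBlDr.
    apply: le_trans (ltW (truncnS_gt x)) _; rewrite -natr1 lerD2l.
    by rewrite ler_pdivlMl // mulr1.
  - rewrite -[X in _ --> X]subr0; apply: cvgB; first exact: cvg_cst.
    exact: (cvg_comp _ (fun n => n%:R^-1) toy (@cvg_natr_inv R)).
  - exact: cvg_cst.
have H2 : ln x / succ_ln R (Num.truncn x) @[x --> (+oo : set_system R)] --> (1
  : R).
  apply: (squeeze_cvgr
    (f := fun x => (ln (Num.truncn x)%:R + 0) / succ_ln R (Num.truncn x))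
    (h := fun x => (ln (Num.truncn x)%:R + 1) / succ_ln R (Num.truncn x))).
  - near=> x; have x_gt0 : 0 < x by near: x; exact: nbhs_pinfty_gt.
    have n_gt0 : (0 < Num.truncn x)%N by near: x; exact: (toy _ (nbhs_infty_gt
      0)).
    have nR : 0 < (Num.truncn x)%:R :> R by rewrite ltr0n.
    have n_le : (Num.truncn x)%:R <= x by rewrite truncn_le ltW.
    rewrite !ler_pM2r ?invr_gt0 ?succ_ln_gt0 // addr0 ler_ln ?posrE // n_le /=.
    apply: le_trans (_ : ln (Num.truncn x).+1%:R <= _).
      by rewrite ler_ln ?posrE ?ltr0n // ltW // truncnS_gt.
    rewrite addrC -lerBlDr; apply: le_trans (lnS_le R n_gt0) _.
    by rewrite invf_le1 // ler1n.
  - exact: (cvg_comp _ (fun n => (ln n%:R + 0) / succ_ln R n) toy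
    (@cvg_ln_succ_ln R 0)).
  - exact: (cvg_comp _ (fun n => (ln n%:R + 1) / succ_ln R n) toy
    (@cvg_ln_succ_ln R 1)).
have H2V := cvgV (oner_neq0 R) H2; rewrite invr1 in H2V.
rewrite -[X in _ --> X](mulr1 1) -[X in _ * X](expr1n R i).
have H3 : (ln x / succ_ln R (Num.truncn x))^-1 ^+ i @[x --> (+oo : set_system
  R)] -->
    (1 ^+ i : R).
  by apply: cvg_exprn; rewrite -[X in _ --> X]invr1; exact: cvgV.
apply: cvg_trans (cvgM H1 H3); apply: near_eq_cvg; near=> x.
by rewrite /= exprVn exprMn exprVn !invfM invrK /nmain; ring.
Unshelve. all: by end_near. Qed.

Lemma corr_sum_errE (R : realType) k l h (B x : R) :
  corr_sum_err k l.+1 h B x =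
  corr_sum k l.+1 h x - B ^- l * corrB_sum h l k B (Num.truncn x).
Proof.
rewrite /corr_sum_err /corr_sum /corrB_sum mulr_sumr -sumrB.
by apply: eq_bigr => n _; ring.
Qed.

Lemma corr_const_gt0 (R : realType) h j k : 0 < corr_const R h j k.
Proof.
rewrite /corr_const divr_gt0 // ?mulr_gt0 ?ltr0n ?fact_gt0 ?f_const_gt0 //.
by have [] := C_const_limit R j k.
Qed.

(** The relation [~_] measures the error relative to the constant on its right. As this constant is
    positive, the relation amounts to convergence. *)
Lemma correlation_asymptoticP (R : realType) k j h :
  correlation_asymptotic R k.+1 j.+1 h <->
  corr_sum k.+1 j.+1 h x / (x * ln x ^+ (k + j))
    @[x --> (+oo : set_system R)] --> corr_const R h j k.
Proof.
have Ekj : (k.+1 + j.+1 - 2 = k + j)%N by rewrite addSn addnS !subSS subn0.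
have c_gt0 := corr_const_gt0 R h j k.
rewrite /correlation_asymptotic Ekj /= -/(corr_const R h j k).
split=> [/eqaddoP H|H].
  apply/cvgrPdist_le => e e_gt0.
  have := H (e / corr_const R h j k) (divr_gt0 e_gt0 c_gt0).
  apply: filterS => x /=; rewrite [`|corr_const _ _ _ _|]gtr0_norm //.
  by rewrite divfK ?gt_eqF // distrC.
apply/eqaddoP => e e_gt0.
move/cvgrPdist_le: H => /(_ (e * corr_const R h j k) (mulr_gt0 e_gt0 c_gt0)).
apply: filterS => x /=; rewrite [`|corr_const _ _ _ _|]gtr0_norm //.
by rewrite distrC.
Qed.

Lemma correlation_error_smallP (R : realType) k j h (B : R) :
  correlation_error_small k.+1 j.+1 h B <->
  corr_sum_err k.+1 j.+1 h B x / (x * ln x ^+ (k + j))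
    @[x --> (+oo : set_system R)] --> 0.
Proof.
have Ekj : (k.+1 + j.+1 - 2 = k + j)%N by rewrite addSn addnS !subSS subn0.
have N_gt0 : \forall x \near (+oo : set_system R), 0 < x * ln x ^+ (k + j).
  near=> x; have x_gt1 : 1 < x by near: x; exact: nbhs_pinfty_gt.
  by apply: mulr_gt0; [exact: lt_trans ltr01 x_gt1 | rewrite exprn_gt0 //
    ln_gt0].
rewrite /correlation_error_small Ekj.
split=> [/eqoP H|H].
  apply/cvgrPdist_le => e e_gt0; have He := H e e_gt0.
  near=> x; have N0 : 0 < x * ln x ^+ (k + j) by near: x.
  rewrite sub0r normrN normrM normfV ler_pdivrMr ?normr_gt0 ?gt_eqF //.
  by near: x; exact: He.
apply/eqoP => e e_gt0; move/cvgrPdist_le: H => /(_ e e_gt0) H.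
near=> x; have N0 : 0 < x * ln x ^+ (k + j) by near: x.
have : `|0 - corr_sum_err k.+1 j.+1 h B x / (x * ln x ^+ (k + j))| <= e.
  by near: x; exact: H.
by rewrite sub0r normrN normrM normfV ler_pdivrMr ?normr_gt0 ?gt_eqF.
Unshelve. all: by end_near. Qed.

Lemma asymptotic_iff_error_small (R : realType) h j k (theta B : R) :
  (0 < h)%N -> distribution_exponent k.+1 theta -> 0 < B < theta ->
  correlation_asymptotic R k.+1 j.+1 h <->
  correlation_error_small k.+1 j.+1 h B.
Proof.
move=> h_gt0 dist B_bd; have /andP[B_gt0 _] := B_bd.
rewrite correlation_asymptoticP correlation_error_smallP.
have T_lim : B ^- j * (corrB_sum h j k.+1 B (Num.truncn x) / (x * ln x ^+ (k +
  j)))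
    @[x --> (+oo : set_system R)] --> corr_const R h j k.
  rewrite (_ : corr_const R h j k = B ^- j * (corr_const R h j k * B ^+ j *
    1)); last first.
    by rewrite mulr1 mulrC mulfK // expf_neq0 // gt_eqF.
  apply: cvgMl_tmp.
  apply: cvg_trans (cvgM (cvg_comp _ _ (@cvg_truncn R)
    (cvg_corrB_sum (j := j) h_gt0 dist B_bd)) (@cvg_nmain_truncn R (k + j))).
  apply: near_eq_cvg; near=> x.
  have n_gt0 : (0 < Num.truncn x)%N.
    by near: x; exact: (@cvg_truncn R _ (nbhs_infty_gt 0)).
  by rewrite /= mulrA divfK // gt_eqF // nmain_gt0.
have errE : (fun x => corr_sum_err k.+1 j.+1 h B x / (x * ln x ^+ (k + j))) =
    (fun x => corr_sum k.+1 j.+1 h x / (x * ln x ^+ (k + j)) -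
      B ^- j * (corrB_sum h j k.+1 B (Num.truncn x) / (x * ln x ^+ (k + j)))).
  by apply/funext => x; rewrite corr_sum_errE mulrBl mulrA.
rewrite errE; split=> H.
  by rewrite -[X in _ --> X](subrr (corr_const R h j k)); exact: cvgB.
rewrite -[X in _ --> X]add0r; apply: cvg_trans (cvgD H T_lim).
by apply: near_eq_cvg; near=> x; rewrite /= subrK.
Unshelve. all: by end_near. Qed.

Theorem corollary1p6 (R : realType) (h k l : nat) (theta : R)
  (h_gt0 : (0 < h)%N) (k_gt0 : (0 < k)%N) (l_gt0 : (0 < l)%N)
  (theta_exp : distribution_exponent k theta) :
  (correlation_asymptotic R k l h <->
   exists B : R, 0 < B < theta /\ correlation_error_small k l h B) /\
  ((exists B : R, 0 < B < theta /\ correlation_error_small k l h B) ->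
   forall B : R, 0 < B < theta -> correlation_error_small k l h B).
Proof.
case: k k_gt0 theta_exp => // k _ theta_exp; case: l l_gt0 => // l _.
(* The asymptotic does not mention [B], so it transfers the smallness of the error from one [B] to
   any other. *)
have key B := asymptotic_iff_error_small (B := B) l h_gt0 theta_exp.
have [/andP[theta_gt0 _] _] := theta_exp 1%N isT.
split; last by move=> [B [B_bd /(key B B_bd) asym]] B' B'_bd; exact/key.
split=> [asym|[B [B_bd /(key B B_bd)]] //].
have B_bd : 0 < theta / 2 < theta.
  by rewrite divr_gt0 //= ltr_pdivrMr // ltr_pMr // ltr1n.
by exists (theta / 2); split=> //; exact/key.
Qed.
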